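(* Let $\theta\in[0,2]$ and $T>0$, and suppose that the covariance operators $Q_1,Q_2$ of the Wiener processes $W_1,W_2$ satisfy $$\|A^{\theta/2}Q_1^{1/2}\|_{HS}+\|A^{\theta/2}Q_2^{1/2}\|_{HS}<\infty .$$ Let $X_h=(u_{h,1},u_{h,2})^T$ be the mild solution of the spatially semidiscrete equation $dX_h=\mathbb{A}_hX_h\,dt+\mathcal{P}_h\,dW$, $X_h(0)=X_{0,h}$, i.e. $$X_h(t)=e^{t\mathbb{A}_h}X_{0,h}+\int_0^te^{(t-\tau)\mathbb{A}_h}\mathcal{P}_h\,dW(\tau),\qquad t\ge 0,$$ and let $U^n=(U_1^n,U_2^n)^T$ be given by the stochastic trigonometric scheme with time step $k$, $$U^{n+1}=e^{k\mathbb{A}_h}U^n+e^{k\mathbb{A}_h}\mathcal{P}_h\,\Delta W^n,\qquad U^0=X_h(0),$$ where $t_n=nk$ and $\Delta W^n=(W_1(t_{n+1})-W_1(t_n),\,W_2(t_{n+1})-W_2(t_n))^T$. Then there is a constant $C=C(T)$, independent of $h$, $k$ and $n$, such that for all $n$ with $t_n=nk\le T$ and for $j=1,2$, $$\|U_j^n-u_{h,j}(t_n)\|_{L_2(\Omega,\dot H^0)}\le C\,k^{\theta/2}\left(\|A^{\theta/2}Q_1^{1/2}\|_{HS}+\|A^{\theta/2}Q_2^{1/2}\|_{HS}\right).$$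
   Context: Domain and operators. $\mathcal{O}\subset\mathbb{R}^d$, $d\in\{1,2,3\}$, is a bounded convex polygonal domain. $L^2(\mathcal{O})$ is real, with inner product $(\cdot,\cdot)$ and norm $\|\cdot\|$. $A=-\Delta$ with $D(A)=H^2(\mathcal{O})\cap H_0^1(\mathcal{O})$; it has orthonormal eigenpairs $\{(\lambda_j,\phi_j)\}_{j\ge1}$, $0<\lambda_1<\lambda_2\le\cdots\to\infty$. For $\gamma\in\mathbb{R}$, $\dot H^\gamma=D(A^{\gamma/2})$ with $\|v\|_\gamma=\|A^{\gamma/2}v\|$; $\dot H^0=L^2(\mathcal{O})$. $\|\cdot\|_{HS}$ is the Hilbert–Schmidt norm on operators on $L^2(\mathcal{O})$. $\|v\|_{L_2(\Omega,\dot H^0)}=(\mathbb{E}\|v\|^2)^{1/2}$. Noise. $(\Omega,\mathcal{F},P,\{\mathcal{F}_t\}_{t\ge0})$ is a filtered probability space satisfying the usual conditions. For $j=1,2$, $W_j$ is an $L^2(\mathcal{O})$-valued $Q_j$-Wiener process with respect to $\{\mathcal{F}_t\}$ ($Q_j$ self-adjoint, positive semidefinite, trace class; $W_j(t)-W_j(s)$ is Gaussian with mean $0$ and covariance $(t-s)Q_j$ and is independent of $\mathcal{F}_s$). $W_1$ and $W_2$ need not be independent of each other. $W=(W_1,W_2)^T$. Finite elements. $\{\mathcal{T}_h\}$ is a regular family of triangulations of $\mathcal{O}$ with maximal mesh size $h$; $V_h\subset H_0^1(\mathcal{O})$ is the space of continuous piecewise linear functions on $\mathcal{T}_h$ vanishing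 on $\partial\mathcal{O}$. $\mathcal{P}_h:L^2(\mathcal{O})\to V_h$ is the $L^2$-orthogonal projection (applied componentwise to pairs). $A_h:V_h\to V_h$ is defined by $(A_hw_h,\psi)=(\nabla w_h,\nabla\psi)$ for all $\psi\in V_h$. In this finite element setting the following known relation is used as a standing fact: $\|A_h^\gamma\mathcal{P}_hA^{-\gamma}v\|\le C\|v\|$ for $v\in L^2(\mathcal{O})$, $\gamma\in[-\tfrac12,1]$, with $C$ independent of $h$. $$\mathbb{A}_h=\begin{bmatrix} 0 & -A_h \\ A_h & 0 \end{bmatrix},\qquad e^{t\mathbb{A}_h}=\begin{bmatrix} C_h(t) & -S_h(t) \\ S_h(t) & C_h(t) \end{bmatrix},\quad C_h(t)=\cos(tA_h),\ S_h(t)=\sin(tA_h).$$ $X_{0,h}$ is an $\mathcal{F}_0$-measurable $V_h\times V_h$-valued random variable. *)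

(* Defs.v *)
From HB Require Import structures.
From mathcomp Require Import all_boot all_order all_algebra.
From mathcomp Require Import all_classical all_reals all_analysis.

Set Implicit Arguments.
Unset Strict Implicit.
Unset Printing Implicit Defensive.

Import Order.TTheory GRing.Theory Num.Theory.
Import numFieldNormedType.Exports.

Local Open Scope classical_set_scope.
Local Open Scope ring_scope.

Definition rV_display : measure_display. Proof. exact: default_measure_display. Qed.

Section measurable_rV.
Variables (R : realType) (n : nat).

Definition rV_coord (i : 'I_n) (x : 'rV[R]_n) : measurableTypeR R := x 0 i.

Let rV_set0 : g_sigma_preimage rV_coord set0.
Proof. exact: sigma_algebra0. Qed.

Let rV_setC A : g_sigma_preimage rV_coord A -> g_sigma_preimage rV_coord (~` A).
Proof. exact: sigma_algebraC. Qed.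

Let rV_bigcup (F : _^nat) : (forall i, g_sigma_preimage rV_coord (F i)) ->
  g_sigma_preimage rV_coord (\bigcup_i (F i)).
Proof. exact: sigma_algebra_bigcup. Qed.

(* The sigma-algebra generated by the coordinates: the Borel sets of R^n. *)
HB.instance Definition _ := @isMeasurable.Build rV_display
  'rV[R]_n (g_sigma_preimage rV_coord) rV_set0 rV_setC rV_bigcup.

End measurable_rV.

Lemma measurable_rV_coord (R : realType) n (i : 'I_n) :
  measurable_fun [set: 'rV[R]_n] (@rV_coord R n i).
Proof.
move=> _ Y mY; rewrite setTI; apply: sub_sigma_algebra => /=.
rewrite -bigcup_seq/=; exists i => /=; first by rewrite mem_index_enum.
by exists Y => //; rewrite setTI.
Qed.

Lemma measurable_fun_rV d (T : measurableType d) (R : realType) n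
    (f : T -> 'rV[R]_n) :
  (forall i, measurable_fun setT (@rV_coord R n i \o f)) -> measurable_fun setT f.
Proof.
move=> mf _ A mA; rewrite setTI.
suff : preimage_set_system setT f (g_sigma_preimage (@rV_coord R n)) `<=` measurable.
  by apply; exists A => //; rewrite setTI.
rewrite -g_sigma_preimage_comp; apply: smallest_sub.
  exact: sigma_algebra_measurable.
by rewrite -bigcup_seq; apply: bigcup_sub => i _ B [C mC <-]; exact: mf.
Qed.

Section lebesgue_rV.
Variable R : realType.

Definition rV_cons n (p : 'rV[R]_n * measurableTypeR R) : 'rV[R]_n.+1 :=
  \row_i if unlift ord0 i is Some j then p.1 0 j else p.2.

Lemma measurable_rV_cons n : measurable_fun setT (@rV_cons n).
Proof.
apply: measurable_fun_rV => i; case: (unliftP ord0 i) => [j|] ->.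
  rewrite (_ : _ \o _ = @rV_coord R n j \o fst); last first.
    by apply/funext => p; rewrite /= /rV_coord mxE liftK.
  by apply: measurableT_comp; [exact: measurable_rV_coord|exact: measurable_fst].
rewrite (_ : _ \o _ = snd) //.
by apply/funext => p; rewrite /= /rV_coord mxE unlift_none.
Qed.

Fixpoint lebesgue_rV n : {measure set 'rV[R]_n -> \bar R} :=
  match n with
  | 0 => \d_(0 : 'rV[R]_0)
  | m.+1 => measure_function_pushforward__canonical__measure_function_Measure
      (lebesgue_rV m \x @lebesgue_measure R)%E (@measurable_rV_cons m)
  end.

Lemma lebesgue_rV_box n (a b : 'rV[R]_n) : (forall i, a 0 i <= b 0 i) ->
  lebesgue_rV n [set x | forall i, a 0 i < x 0 i <= b 0 i] =
  (\prod_i (b 0 i - a 0 i))%:E.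
Proof.
have mbox m (u v : 'rV[R]_m) :
    measurable [set x : 'rV[R]_m | forall i, u 0 i < x 0 i <= v 0 i].
  rewrite (_ : mkset _ = \big[setI/setT]_(i < m)
      ((@rV_coord R m i) @^-1` `]u 0 i, v 0 i]%classic)); last first.
    rewrite -bigcap_seq; apply/seteqP; split => x /= h i.
      by move=> _; rewrite /= in_itv /=; exact: h.
    by have := h i; rewrite /= mem_index_enum in_itv /=; apply.
  apply: bigsetI_measurable => i _; rewrite -[X in measurable X]setTI.
  by apply: (measurable_rV_coord i) => //; exact: measurable_itv.
elim: n a b => [|n IHn] a b ab /=.
  by rewrite big_ord0 diracE mem_set // => -[].
rewrite /pushforward (_ : _ @^-1` _ =
    [set x : 'rV[R]_n | forall i, (\row_j a 0 (lift ord0 j)) 0 i < x 0 i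
       <= (\row_j b 0 (lift ord0 j)) 0 i] `*` `]a 0 ord0, b 0 ord0]%classic).
  rewrite [LHS]product_measure1E; [|exact: mbox|exact: measurable_itv].
  rewrite IHn => [|i]; last by rewrite !mxE.
  rewrite /= lebesgue_measure_itv /= lte_fin big_ord_recl mulrC EFinM.
  congr (_ * _)%E.
    by congr (_%:E); apply: eq_bigr => i _; rewrite !mxE.
  have [//|ba] := ltP (a 0 ord0) (b 0 ord0).
  by have /eqP -> : b 0 ord0 == a 0 ord0; rewrite ?eq_le ?ba ?ab // subrr.
apply/seteqP; split => -[x y] /=.
  move=> h; split => [i|]; last by have := h ord0; rewrite mxE unlift_none in_itv.
  by have := h (lift ord0 i); rewrite !mxE liftK.
move=> [h1 h2] i; case: (unliftP ord0 i) => [j|] ->.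
  by have := h1 j; rewrite !mxE liftK.
by rewrite !mxE unlift_none; move: h2; rewrite in_itv.
Qed.

End lebesgue_rV.

(* Elements of L^2(O) are represented by functions on R^d; two of them are
   equal in L^2(O) when the norm of their difference vanishes. *)

Section sobolev.
Variables (R : realType) (d : nat).
Notation E := 'rV[R]_d.
Notation fn := (E -> R).
Implicit Types (O : set E) (u v w f g : fn).

Definition L2 O f : Prop :=
  measurable_fun O (f : E -> measurableTypeR R) /\
  (\int[lebesgue_rV R d]_(x in O) (f x ^+ 2)%:E < +oo)%E.

Definition inner O f g : R := \int[lebesgue_rV R d]_(x in O) (f x * g x).

Definition norm O f : R := Num.sqrt (inner O f f).

Definition eqL2 O f g : Prop := norm O (f - g) = 0.

Definition basis_vec (i : 'I_d) : E := delta_mx 0 i.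

Definition partial (i : 'I_d) f : fn := fun x => 'D_(basis_vec i) f x.

Definition smooth f : Prop :=
  forall s : seq 'I_d, continuous (foldr partial f s : E -> R^o) /\
    forall i x, derivable (foldr partial f s : E -> R^o) x (basis_vec i).

(* C_c^oo(O), extended by zero *)
Definition test_function O f : Prop :=
  smooth f /\
  exists K : set E, [/\ compact K, K `<=` O & forall x, ~ K x -> f x = 0].

Definition weak_partial O (i : 'I_d) f g : Prop :=
  forall eta, test_function O eta -> inner O f (partial i eta) = - inner O g eta.

Definition weak_gradient O f (g : 'I_d -> fn) : Prop :=
  L2 O f /\ forall i, L2 O (g i) /\ weak_partial O i f (g i).

(* closure of C_c^oo(O) in H^1(O) *)
Definition H10 O f : Prop :=
  exists g : 'I_d -> fn, weak_gradient O f g /\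
  exists eta : nat -> fn, [/\ forall n, test_function O (eta n),
    (fun n => norm O (eta n - f)) @ \oo --> (0 : R) &
    forall i, (fun n => norm O (partial i (eta n) - g i)) @ \oo --> (0 : R)].

(* v is in D(A) = H^2(O) \cap H^1_0(O) and w = A v = - \Delta v *)
Definition dirichlet_laplacian O v w : Prop :=
  [/\ H10 O v, L2 O w & exists (g : 'I_d -> fn) (h : 'I_d -> 'I_d -> fn),
    [/\ weak_gradient O v g, forall i, weak_gradient O (g i) (h i) &
        eqL2 O w (- \sum_i h i i)]].

(* A nonempty bounded finite intersection of open half-spaces. *)
Definition convex_polygonal_domain O : Prop :=
  [/\ O !=set0, bounded_set O &
    exists (m : nat) (a : 'I_m -> E) (b : 'I_m -> R),
      O = [set x | forall i, \sum_j a i 0 j * x 0 j < b i]].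

Definition eigenpairs O (lam : nat -> R) (phi : nat -> fn) : Prop :=
  [/\ 0 < lam 0%N /\ lam 0%N < lam 1%N,
      {homo lam : i j / (i <= j)%N >-> i <= j} /\ lam @ \oo --> +oo,
      forall j, dirichlet_laplacian O (phi j) (lam j *: phi j),
      forall i j, inner O (phi i) (phi j) = (i == j)%:R &
      forall v, L2 O v ->
        (fun n => norm O (v - \sum_(j < n) inner O v (phi j) *: phi j))
          @ \oo --> (0 : R)].

(* \| A^(gamma/2) v \|^2, which is +oo when v is not in D(A^(gamma/2)) *)
Definition dotnorm_sq O (lam : nat -> R) (phi : nat -> fn) (gamma : R) v : \bar R :=
  (\sum_(0 <= j <oo) (lam j `^ gamma * inner O v (phi j) ^+ 2)%:E)%E.

(* \| A^(gamma/2) S \|_HS, computed in the orthonormal basis phi *)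
Definition HSnorm O (lam : nat -> R) (phi : nat -> fn) (gamma : R)
    (S : fn -> fn) : \bar R :=
  ((\sum_(0 <= j <oo) dotnorm_sq O lam phi gamma (S (phi j))) `^ 2^-1)%E.

(* B is a bounded linear operator from L^2(O) into V, V a subset of L^2(O) *)
Definition bounded_operator O (V : set fn) (B : fn -> fn) : Prop :=
  [/\ forall v, L2 O v -> V (B v),
      forall a v w, L2 O v -> L2 O w -> eqL2 O (B (a *: v + w)) (a *: B v + B w) &
      exists M, forall v, L2 O v -> norm O (B v) <= M * norm O v].

Definition positive_operator O (B : fn -> fn) : Prop :=
  [/\ bounded_operator O (L2 O) B,
      forall v w, L2 O v -> L2 O w -> inner O (B v) w = inner O v (B w) &
      forall v, L2 O v -> 0 <= inner O (B v) v].

Definition covariance_operator O (phi : nat -> fn) (Q : fn -> fn) : Prop :=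
  positive_operator O Q /\
  (\sum_(0 <= j <oo) (inner O (Q (phi j)) (phi j))%:E < +oo)%E.

Definition is_sqrt_operator O (Q S : fn -> fn) : Prop :=
  positive_operator O S /\ forall v, L2 O v -> eqL2 O (S (S v)) (Q v).

Definition enorm (x : E) : R := Num.sqrt (\sum_i x 0 i ^+ 2).

Definition diameter (A : set E) : R :=
  sup [set r | exists x y, [/\ A x, A y & r = enorm (x - y)]].

Definition convex_hull (A : set E) : set E :=
  [set x | exists (m : nat) (c : 'I_m -> R) (p : 'I_m -> E),
    [/\ forall i, 0 <= c i, \sum_i c i = 1, forall i, A (p i) &
        x = \sum_i c i *: p i]].

Record mesh := Mesh { mesh_card : nat;
  mesh_vertex : 'I_mesh_card -> 'I_d.+1 -> E }.

Definition simplex (T : mesh) (K : 'I_(mesh_card T)) : set E :=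
  convex_hull (range (mesh_vertex K)).

Definition mesh_size (T : mesh) : R :=
  \big[Num.max/0]_(K < mesh_card T) diameter (simplex K).

Definition affinely_independent (p : 'I_d.+1 -> E) : Prop :=
  forall c : 'I_d.+1 -> R,
    \sum_i c i = 0 -> \sum_i c i *: p i = 0 -> forall i, c i = 0.

Definition triangulation O (T : mesh) : Prop :=
  [/\ forall K : 'I_(mesh_card T), affinely_independent (mesh_vertex K),
      \bigcup_K @simplex T K = closure O &
      forall K L : 'I_(mesh_card T), simplex K `&` simplex L =
        convex_hull (range (mesh_vertex K) `&` range (mesh_vertex L))].

(* {T_h}, h in H: the diameters of the simplices are bounded, uniformly in h,
   by a multiple of the radii of inscribed balls *)
Definition regular_family O (H : set R) (Th : R -> mesh) : Prop :=
  (forall h, H h -> triangulation O (Th h) /\ mesh_size (Th h) = h) /\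
  exists sigma : R, forall h, H h -> forall K : 'I_(mesh_card (Th h)),
    exists (x : E) (r : R), [/\ 0 < r,
      [set y | enorm (y - x) < r] `<=` simplex K &
      diameter (simplex K) <= sigma * r].

(* V_h; its elements are extended by zero outside O, so that they are
   determined as functions on R^d *)
Definition fespace O (T : mesh) : set fn :=
  [set v | [/\ H10 O v, continuous (v : E -> R^o), forall x, ~ O x -> v x = 0 &
    forall (K : 'I_(mesh_card T)) (c : 'I_d.+1 -> R),
      (forall i, 0 <= c i) -> \sum_i c i = 1 ->
      v (\sum_i c i *: mesh_vertex K i) = \sum_i c i * v (mesh_vertex K i)]].

Definition L2proj O (V : set fn) (w : fn) : fn :=
  xget 0 [set z | V z /\ forall psi, V psi -> inner O z psi = inner O w psi].

Definition discrete_laplacian O (V : set fn) (w : fn) : fn :=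
  xget 0 [set z | V z /\ forall psi, V psi -> forall gw gpsi : 'I_d -> fn,
    weak_gradient O w gw -> weak_gradient O psi gpsi ->
    inner O z psi = \sum_i inner O (gw i) (gpsi i)].

(* F(A) for A self-adjoint on the finite-dimensional space V: the linear
   operator on V that is multiplication by F(mu) on each eigenspace ker(A - mu) *)
Definition op_calculus (V : set fn) (A : fn -> fn) (F : R -> R) : fn -> fn :=
  @xget (fn -> fn) id [set B : fn -> fn | [/\ forall v, V v -> V (B v),
    forall a v w, V v -> V w -> B (a *: v + w) = a *: B v + B w &
    forall (mu : R) v, V v -> A v = mu *: v -> B v = F mu *: v]].

Definition cosA V A (t : R) := op_calculus V A (fun mu => cos (t * mu)).
Definition sinA V A (t : R) := op_calculus V A (fun mu => sin (t * mu)).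
Definition powA V A (gamma : R) := op_calculus V A (fun mu => mu `^ gamma).

(* exp(t [0 -A; A 0]) *)
Definition expA V A (t : R) (w : fn * fn) : fn * fn :=
  (cosA V A t w.1 - sinA V A t w.2, sinA V A t w.1 + cosA V A t w.2).

(* z = P_h A^s v. For s > 0, A^s v is in general only a functional on V, namely
   psi |-> \sum_j lam_j^s (v, phi_j) (phi_j, psi). *)
Definition proj_pow O (lam : nat -> R) (phi : nat -> fn) (V : set fn) (s : R)
    v z : Prop :=
  V z /\ forall psi, V psi ->
  (fun n => \sum_(j < n) lam j `^ s * inner O v (phi j) * inner O (phi j) psi)
    @ \oo --> inner O z psi.

(* \| A_h^gamma P_h A^(-gamma) v \| <= C \| v \|, uniformly in h *)
Definition discrete_norm_bound O (lam : nat -> R) (phi : nat -> fn) (H : set R)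
    (Th : R -> mesh) : Prop :=
  forall gamma : R, - 2^-1 <= gamma <= 1 ->
  exists C : R, forall h, H h -> forall v z, L2 O v ->
    let V := fespace O (Th h) in
    proj_pow O lam phi V (- gamma) v z ->
    norm O (powA V (discrete_laplacian O V) gamma z) <= C * norm O v.

End sobolev.

Section noise.
Variables (R : realType) (d : nat) (dd : measure_display).
Variables (Om : measurableType dd) (P : probability Om R).
Notation fn := ('rV[R]_d -> R).
Implicit Types (O : set 'rV[R]_d) (W : R -> Om -> fn) (Q S : fn -> fn).

Definition usual_filtration (Ft : R -> set (set Om)) : Prop :=
  [/\ forall t : R, 0 <= t -> sigma_algebra setT (Ft t) /\ Ft t `<=` measurable,
      forall s t : R, 0 <= s -> s <= t -> Ft s `<=` Ft t,
      forall (t : R) A, 0 <= t -> (forall s : R, t < s -> Ft s A) -> Ft t A &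
      forall N, P.-negligible N -> Ft 0 N].

(* An L^2(O)-valued random variable measurable with respect to the
   sigma-algebra G. L^2(O) being separable, its Borel sets are generated by the
   functionals (., v). *)
Definition L2measurable O (G : set (set Om)) (X : Om -> fn) : Prop :=
  (forall omega, L2 O (X omega)) /\
  forall v (B : set (measurableTypeR R)), L2 O v -> measurable B ->
    G ((fun omega => inner O (X omega) v) @^-1` B).

Definition generated_sigma O (X : Om -> fn) : set (set Om) :=
  <<s [set A | exists (v : fn) (B : set (measurableTypeR R)),
      [/\ L2 O v, measurable B & A = (fun omega => inner O (X omega) v) @^-1` B]] >>.

(* The law N(0, s2); normal_prob with standard deviation 0 is not a Dirac mass. *)
Definition centered_gaussian (s2 : R) (B : set (measurableTypeR R)) : \bar R :=
  if s2 == 0 then \d_(0 : measurableTypeR R) B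
  else normal_prob 0 (Num.sqrt s2) B.

Definition Wiener O (Ft : R -> set (set Om)) Q W : Prop :=
  [/\ {ae P, forall omega, eqL2 O (W 0 omega) 0},
      forall t : R, 0 <= t -> L2measurable O (Ft t) (W t),
      (forall (s t : R) v, 0 <= s -> s <= t -> L2 O v ->
        forall B : set (measurableTypeR R), measurable B ->
        P ((fun omega => inner O (W t omega - W s omega) v) @^-1` B) =
        centered_gaussian ((t - s) * inner O (Q v) v) B),
      (forall s t : R, 0 <= s -> s <= t -> forall A B, Ft s A ->
        generated_sigma O (fun omega => W t omega - W s omega) B ->
        P (A `&` B) = (P A * P B)%E) &
      {ae P, forall omega, forall t : R, 0 <= t ->
        norm O (W s omega - W t omega) @[s --> within [set s | 0 <= s] (nbhs t)]
          --> (0 : R)}].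

(* sum_(i < m) 1_(]t_i, t_(i+1)]) B_i *)
Record step_integrand := StepIntegrand {
  step_card : nat; step_time : nat -> R; step_op : nat -> fn -> fn }.

Definition step_valid O (V : set fn) (t : R) (X : step_integrand) : Prop :=
  [/\ 0 <= step_time X 0 /\ step_time X (step_card X) <= t,
      forall i, (i < step_card X)%N -> step_time X i <= step_time X i.+1 &
      forall i, (i < step_card X)%N -> bounded_operator O V (step_op X i)].

Definition step_eval (X : step_integrand) (tau : R) (w : fn) : fn :=
  \sum_(i < step_card X | step_time X i < tau <= step_time X i.+1) step_op X i w.

Definition step_integral W (X : step_integrand) (omega : Om) : fn :=
  \sum_(i < step_card X)
    step_op X i (W (step_time X i.+1) omega - W (step_time X i) omega).

(* I = \int_0^t Phi(tau) dW(tau) for a deterministic V-valued integrand Phi and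
   S = Q^(1/2): the L^2(Omega)-limit of the integrals of step integrands Phi_n
   such that \int_0^t \| (Phi_n - Phi)(tau) Q^(1/2) \|_HS^2 dtau --> 0 *)
Definition stochastic_integral O (phi : nat -> fn) (V : set fn) S W (t : R)
    (Phi : R -> fn -> fn) (I : Om -> fn) : Prop :=
  [/\ forall omega, V (I omega), L2measurable O measurable I &
    exists X : nat -> step_integrand, [/\ forall n, step_valid O V t (X n),
      (fun n => \int[@lebesgue_measure R]_(tau in `[0%R, t])
         \sum_(0 <= j <oo) (norm O (step_eval (X n) tau (S (phi j))
                                    - Phi tau (S (phi j))) ^+ 2)%:E)%E
        @ \oo --> 0%E &
      (fun n => \int[P]_omega
         (norm O (step_integral W (X n) omega - I omega) ^+ 2)%:E)%E
        @ \oo --> 0%E]].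

(* X(t) = e^(t A) X0 + \int_0^t e^((t - tau) A) P_h dW(tau), where
   e^(t A) is the block operator expA, so that the components of the integral are
   \int C P_h dW1 - \int S P_h dW2 and \int S P_h dW1 + \int C P_h dW2 *)
Definition mild_solution O (phi : nat -> fn) (V : set fn) (Ft : R -> set (set Om))
    (S1 S2 : fn -> fn) (W1 W2 : R -> Om -> fn)
    (X0 : Om -> fn * fn) (X : R -> Om -> fn * fn) : Prop :=
  let A := discrete_laplacian O V in
  let Cos t tau w := cosA V A (t - tau) (L2proj O V w) in
  let Sin t tau w := sinA V A (t - tau) (L2proj O V w) in
  forall t : R, 0 <= t ->
  [/\ forall omega, V (X t omega).1 /\ V (X t omega).2,
      L2measurable O (Ft t) (fun omega => (X t omega).1),
      L2measurable O (Ft t) (fun omega => (X t omega).2) &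
    exists IC1 IS2 IS1 IC2 : Om -> fn,
    [/\ stochastic_integral O phi V S1 W1 t (Cos t) IC1,
        stochastic_integral O phi V S2 W2 t (Sin t) IS2,
        stochastic_integral O phi V S1 W1 t (Sin t) IS1,
        stochastic_integral O phi V S2 W2 t (Cos t) IC2 &
        {ae P, forall omega, X t omega = expA V A t (X0 omega)
           + (IC1 omega - IS2 omega, IS1 omega + IC2 omega)}]].

Fixpoint trigonometric_scheme O (V : set fn) (W1 W2 : R -> Om -> fn) (k : R)
    (U0 : Om -> fn * fn) (n : nat) (omega : Om) : fn * fn :=
  if n is m.+1 then
    let A := discrete_laplacian O V in
    let dW (W : R -> Om -> fn) := W (m.+1%:R * k) omega - W (m%:R * k) omega in
    expA V A k (trigonometric_scheme O V W1 W2 k U0 m omega)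
    + expA V A k (L2proj O V (dW W1), L2proj O V (dW W2))
  else U0 omega.

End noise.

(* Main.v *)
(* Diagonalise A_h in an orthonormal basis e_i of V_h with eigenvalues mu_i.
   Iterating the scheme, U^n - X_h(t_n) is, component by component, a combination
   of stochastic integrals of F((t_n - t_j) A_h) P_h - F((t_n - tau) A_h) P_h on
   ]t_j, t_(j+1)], with F = cos or sin. Since
     |F(a mu) - F(b mu)|^2 <= 4 |a - b|^theta mu^theta,
   this integrand applied to w is bounded by 4 k^theta \|A_h^(theta/2) P_h w\|^2,
   hence by C k^theta \|A^(theta/2) w\|^2, by the standing norm bound applied to
   v = A^(theta/2) w. It remains to use an Ito inequality, with some constant. For
   finite combinations of (W(t_i), v_i) it follows from
     E (W(s), v) (W(t), w) = c min(s, t) (Q v, w),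
   where c is the second moment of N(0, 1), and it passes to the limit that defines
   the stochastic integral. *)

Require Import Defs.
From HB Require Import structures.
From mathcomp Require Import all_boot all_order all_algebra.
From mathcomp Require Import all_classical all_reals all_analysis.
From mathcomp Require Import measurable_realfun.
From mathcomp Require Import ring lra.

Set Implicit Arguments.
Unset Strict Implicit.
Unset Printing Implicit Defensive.

Import Order.TTheory GRing.Theory Num.Theory.
Import numFieldNormedType.Exports.

Local Open Scope classical_set_scope.
Local Open Scope ring_scope.

(** Second moments of $L^2$-valued variables are reached through real functionals: in $V_h$ the
    squared norm is a finite sum of squared coefficients on $e_m$, and each coefficient of a step
    integral is a finite combination of bounded linear functionals of increments of $W$. The laws of
    $W$ are given through inner products, so such a functional must be turned into an inner product;
    cutting its argument at finitely many $\phi_j$ does this explicitly. The same cut gives a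
    meaning to $A^{\theta/2}w$ for every $w$ in $L^2$ before the standing bound is used. The final
    constant is $\sqrt{64\,c\,T\,B^2}$, with $B$ from the standing bound for $\gamma=\theta/2$: a
    factor 2 is the price of the cut, $2\cdot2$ of the passage from step integrands to their limit,
    4 comes from the Hoelder bound and a last 2 from the two noises. These are separated by
    $\|a+b\|^2\le2\|a\|^2+2\|b\|^2$, so that no covariance between $W_1$ and $W_2$ appears. The
    scheme starts from $X_h(0)$ and the mild formula from $X_{0,h}$; they agree only almost surely,
    hence so do the identities that compare the two. *)

(** * Square-integrable functions on a measure space *)

Section square_integrable.
Context d (T : measurableType d) (R : realType) (mu : {measure set T -> \bar R}).
Variables (D : set T) (mD : measurable D).
Implicit Types f g h : T -> R.

(** Stated for any measure because it serves twice: on [O] under Lebesgue measure, where [L2] and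
    [inner] are instances, and on the sample space under [P], where [ip] is a mixed second
    moment. *)
Definition sqint f : Prop :=
  measurable_fun D f /\ (\int[mu]_(x in D) (f x ^+ 2)%:E < +oo)%E.

Definition ip f g : R := \int[mu]_(x in D) (f x * g x).

Lemma sqint_integrable_sqr f : sqint f -> mu.-integrable D (fun x => (f x ^+ 2)%:E).
Proof.
move=> [mf fy]; apply/integrableP; split.
  by apply/measurable_EFinP; exact: measurable_funX.
under eq_integral do rewrite gee0_abs ?lee_fin ?sqr_ge0//.
exact: fy.
Qed.

Lemma sqint_integrableM f g : sqint f -> sqint g ->
  mu.-integrable D (fun x => (f x * g x)%:E).
Proof.
move=> sf sg; have [[mf _] [mg _]] := (sf, sg).
apply: (le_integrable mD _ _
  (integrableD mD (sqint_integrable_sqr sf) (sqint_integrable_sqr sg))).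
  by apply/measurable_EFinP; exact: measurable_funM.
move=> x Dx; rewrite /= lee_fin [leRHS]ger0_norm ?addr_ge0 ?sqr_ge0 //.
rewrite normrM -(real_normK (num_real (f x))) -(real_normK (num_real (g x))).
(* The domination is $|fg|\le f^2+g^2$, from $(|f|-|g|)^2\ge0$. *)
have := sqr_ge0 (`|f x| - `|g x|); rewrite sqrrB.
have := mulr_ge0 (normr_ge0 (f x)) (normr_ge0 (g x)).
lra.
Qed.

Lemma sqint_lin a f g : sqint f -> sqint g -> sqint (a *: f + g).
Proof.
move=> sf sg; have [[mf _] [mg _]] := (sf, sg).
have mh : measurable_fun D (a *: f + g).
  by apply: measurable_funD => //; exact: measurable_funM.
split => //.
have ih : mu.-integrable D (fun x => (((a *: f + g) x) ^+ 2)%:E).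
  apply: (@eq_integrable _ _ _ _ _ mD (fun x => (a ^+ 2)%:E * (f x ^+ 2)%:E +
     ((2 * a)%:E * (f x * g x)%:E + (g x ^+ 2)%:E))%E).
    move=> x _; rewrite /= -!EFinM -!EFinD; congr (_%:E).
    by rewrite !fctE /GRing.scale /=; ring.
  apply: integrableD => //; first by apply: integrableZl => //; exact: sqint_integrable_sqr.
  apply: integrableD => //; last exact: sqint_integrable_sqr.
  by apply: integrableZl => //; exact: sqint_integrableM.
have := integrable_lty mD ih; apply.
Qed.

Lemma sqint0 : sqint 0.
Proof.
split; first exact: measurable_cst.
by under eq_integral do rewrite expr0n /=; rewrite integral0.
Qed.

Lemma sqintD f g : sqint f -> sqint g -> sqint (f + g).
Proof. by move=> sf sg; rewrite -[f]scale1r; exact: sqint_lin. Qed.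

Lemma sqintZ a f : sqint f -> sqint (a *: f).
Proof. by move=> sf; rewrite -[_ *: _]addr0; exact: (sqint_lin _ sf sqint0). Qed.

Lemma ipC f g : ip f g = ip g f.
Proof. by apply: eq_Rintegral => x _; rewrite mulrC. Qed.

Lemma ip_lin a f g h : sqint f -> sqint g -> sqint h ->
  ip (a *: f + g) h = a * ip f h + ip g h.
Proof.
move=> sf sg sh; rewrite /ip.
rewrite -RintegralZl //; last exact: sqint_integrableM.
rewrite -RintegralD //; last 2 first.
- apply: (@eq_integrable _ _ _ _ _ mD (fun x => a%:E * (f x * h x)%:E)%E) => //.
  by apply: integrableZl => //; exact: sqint_integrableM.
- exact: sqint_integrableM.
by apply: eq_Rintegral => x _; rewrite !fctE /GRing.scale /=; ring.
Qed.

Lemma ip_ge0 f : 0 <= ip f f.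
Proof. by apply: Rintegral_ge0 => x _; rewrite -expr2 sqr_ge0. Qed.

Lemma EFin_ip f g : sqint f -> sqint g ->
  (ip f g)%:E = (\int[mu]_(x in D) (f x * g x)%:E)%E.
Proof.
move=> sf sg; rewrite /ip /Rintegral fineK //.
exact: (integrable_fin_num mD (sqint_integrableM sf sg)).
Qed.

End square_integrable.

Lemma cvg_dist_le (R : realType) (u v : nat -> R) (l : R) :
  (forall n, `|u n - l| <= v n) -> v @ \oo --> (0 : R) -> u @ \oo --> l.
Proof.
move=> uv /cvgrPdist_lt v0; apply/cvgrPdist_lt => e e0.
near=> n; rewrite distrC (le_lt_trans (uv n)) //.
have : `|0 - v n| < e by near: n; exact: v0.
by rewrite sub0r normrN => /(le_lt_trans (ler_norm _)).
Unshelve. all: by end_near. Qed.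

Lemma cvg0_sqr (R : realType) (u : nat -> R) :
  u @ \oo --> (0 : R) -> (fun n => u n ^+ 2) @ \oo --> (0 : R).
Proof.
by move=> u0; have := cvgM u0 u0; rewrite mulr0; apply.
Qed.

(** * Eigenfunction expansions *)

Section L2_domain.
Variables (R : realType) (d : nat) (O : set 'rV[R]_d) (mO : measurable O).
Notation fn := ('rV[R]_d -> R).
Implicit Types f g h u v w : fn.

Lemma L2_lin a f g : L2 O f -> L2 O g -> L2 O (a *: f + g).
Proof. exact: (@sqint_lin _ _ _ (lebesgue_rV R d) O mO). Qed.

Lemma L2_0 : L2 O 0.
Proof. exact: (@sqint0 _ _ _ (lebesgue_rV R d) O). Qed.

Lemma L2D f g : L2 O f -> L2 O g -> L2 O (f + g).
Proof. exact: (@sqintD _ _ _ (lebesgue_rV R d) O mO). Qed.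

Lemma L2Z a f : L2 O f -> L2 O (a *: f).
Proof. exact: (@sqintZ _ _ _ (lebesgue_rV R d) O mO). Qed.

Lemma L2N f : L2 O f -> L2 O (- f).
Proof. by rewrite -scaleN1r; exact: L2Z. Qed.

Lemma L2B f g : L2 O f -> L2 O g -> L2 O (f - g).
Proof. by move=> Lf Lg; apply: L2D => //; exact: L2N. Qed.

Lemma L2_sum (I : Type) (r : seq I) (P : pred I) (F : I -> fn) :
  (forall i, P i -> L2 O (F i)) -> L2 O (\sum_(i <- r | P i) F i).
Proof. by move=> LF; elim/big_ind: _ => //; [exact: L2_0|exact: L2D]. Qed.

Lemma innerC f g : inner O f g = inner O g f.
Proof. exact: ipC. Qed.

Lemma inner_lin a f g h : L2 O f -> L2 O g -> L2 O h ->
  inner O (a *: f + g) h = a * inner O f h + inner O g h.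
Proof. exact: ip_lin. Qed.

Lemma innerDl f g h : L2 O f -> L2 O g -> L2 O h ->
  inner O (f + g) h = inner O f h + inner O g h.
Proof. by move=> Lf Lg Lh; rewrite -[f]scale1r inner_lin // mul1r scale1r. Qed.

Lemma inner0l h : inner O 0 h = 0.
Proof.
rewrite /inner; under eq_Rintegral do rewrite mul0r.
by rewrite /Rintegral integral0.
Qed.

Lemma inner0r h : inner O h 0 = 0.
Proof. by rewrite innerC inner0l. Qed.

Lemma innerZl a f h : L2 O f -> L2 O h -> inner O (a *: f) h = a * inner O f h.
Proof.
by move=> Lf Lh; rewrite -[_ *: _]addr0 inner_lin ?inner0l ?addr0 //; exact: L2_0.
Qed.

Lemma innerNl f h : L2 O f -> L2 O h -> inner O (- f) h = - inner O f h.
Proof. by move=> Lf Lh; rewrite -scaleN1r innerZl // mulN1r. Qed.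

Lemma innerBl f g h : L2 O f -> L2 O g -> L2 O h ->
  inner O (f - g) h = inner O f h - inner O g h.
Proof. by move=> Lf Lg Lh; rewrite innerDl ?innerNl //; exact: L2N. Qed.

Lemma innerDr f g h : L2 O f -> L2 O g -> L2 O h ->
  inner O h (f + g) = inner O h f + inner O h g.
Proof. by move=> *; rewrite innerC innerDl // !(innerC h). Qed.

Lemma innerZr a f h : L2 O f -> L2 O h -> inner O h (a *: f) = a * inner O h f.
Proof. by move=> *; rewrite innerC innerZl // (innerC h). Qed.

Lemma innerNr f h : L2 O f -> L2 O h -> inner O h (- f) = - inner O h f.
Proof. by move=> *; rewrite innerC innerNl // (innerC h). Qed.

Lemma inner_suml (I : Type) (r : seq I) (P : pred I) (F : I -> fn) h :
  (forall i, P i -> L2 O (F i)) -> L2 O h ->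
  inner O (\sum_(i <- r | P i) F i) h = \sum_(i <- r | P i) inner O (F i) h.
Proof.
move=> LF Lh; elim: r => [|x r IH]; first by rewrite !big_nil inner0l.
rewrite !big_cons; case: ifP => // Px.
by rewrite innerDl ?IH //; [exact: LF|exact: L2_sum].
Qed.

Lemma inner_sumr (I : Type) (r : seq I) (P : pred I) (F : I -> fn) h :
  (forall i, P i -> L2 O (F i)) -> L2 O h ->
  inner O h (\sum_(i <- r | P i) F i) = \sum_(i <- r | P i) inner O h (F i).
Proof.
by move=> LF Lh; rewrite innerC inner_suml //; apply: eq_bigr => i _; exact: innerC.
Qed.

Lemma inner_ge0 f : 0 <= inner O f f.
Proof. exact: ip_ge0. Qed.

Lemma norm_ge0 f : 0 <= norm O f.
Proof. exact: sqrtr_ge0. Qed.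

Lemma norm_sqr f : norm O f ^+ 2 = inner O f f.
Proof. by rewrite sqr_sqrtr //; exact: inner_ge0. Qed.

Lemma norm_sqrD f g : L2 O f -> L2 O g ->
  norm O (f + g) ^+ 2 = norm O f ^+ 2 + 2 * inner O f g + norm O g ^+ 2.
Proof.
move=> Lf Lg; have Lfg := L2D Lf Lg.
rewrite !norm_sqr innerDl // !innerDr // (innerC g f); ring.
Qed.

Lemma norm0 : norm O 0 = 0.
Proof. by rewrite /norm inner0l sqrtr0. Qed.

Lemma normZ a f : L2 O f -> norm O (a *: f) = `|a| * norm O f.
Proof.
move=> Lf; rewrite /norm innerZl ?innerZr //; last exact: L2Z.
by rewrite mulrA -expr2 sqrtrM ?sqr_ge0 // sqrtr_sqr.
Qed.

Lemma normN f : L2 O f -> norm O (- f) = norm O f.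
Proof. by move=> Lf; rewrite -scaleN1r normZ // normrN1 mul1r. Qed.

Lemma normBC f g : L2 O f -> L2 O g -> norm O (f - g) = norm O (g - f).
Proof. by move=> Lf Lg; rewrite -normN ?opprB //; exact: L2B. Qed.

(** [norm] is only a seminorm on functions, so the case $\|g\|=0$ is genuine: there
    $\|f+tg\|^2=\|f\|^2+2t(f,g)$, and a nonzero $(f,g)$ would allow a $t$ for which this equals
    $-1$. Otherwise $t$ is the minimiser $-(f,g)/\|g\|^2$. *)
Lemma inner_CauchySchwarz f g : L2 O f -> L2 O g -> `|inner O f g| <= norm O f * norm O g.
Proof.
move=> Lf Lg.
rewrite -(@ler_pXn2r _ 2%N) ?nnegrE ?mulr_ge0 ?norm_ge0 ?normr_ge0 //.
rewrite exprMn real_normK ?num_real //.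
have key (t : R) : 0 <= norm O f ^+ 2 + 2 * t * inner O f g + t ^+ 2 * norm O g ^+ 2.
  have := sqr_ge0 (norm O (f + t *: g)).
  rewrite norm_sqrD ?innerZr ?normZ //; last exact: L2Z.
  by rewrite exprMn real_normK ?num_real // mulrA.
have [g0|g0] := eqVneq (norm O g ^+ 2) 0.
  rewrite g0 mulr0; have [->|fg0] := eqVneq (inner O f g) 0; first by rewrite expr0n.
  have := key (- (norm O f ^+ 2 + 1) / (2 * inner O f g)).
  rewrite g0 mulr0 addr0.
  have -> : 2 * (- (norm O f ^+ 2 + 1) / (2 * inner O f g)) * inner O f g =
     - (norm O f ^+ 2 + 1) by field.
  lra.
have gp : 0 < norm O g ^+ 2 by rewrite lt0r g0 sqr_ge0.
have := key (- inner O f g / norm O g ^+ 2).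
have -> : norm O f ^+ 2 + 2 * (- inner O f g / norm O g ^+ 2) * inner O f g +
  (- inner O f g / norm O g ^+ 2) ^+ 2 * norm O g ^+ 2 =
  norm O f ^+ 2 - inner O f g ^+ 2 / norm O g ^+ 2.
  by field; rewrite sqrf_eq0 in g0.
by rewrite subr_ge0 ler_pdivrMr.
Qed.

Lemma norm_triangle f g : L2 O f -> L2 O g -> norm O (f + g) <= norm O f + norm O g.
Proof.
move=> Lf Lg.
rewrite -(@ler_pXn2r _ 2%N) ?nnegrE ?addr_ge0 ?norm_ge0 //.
rewrite norm_sqrD // sqrrD; have := inner_CauchySchwarz Lf Lg.
rewrite ler_norml => /andP[_]; lra.
Qed.

Lemma norm_sqrD_le f g : L2 O f -> L2 O g ->
  norm O (f + g) ^+ 2 <= 2 * norm O f ^+ 2 + 2 * norm O g ^+ 2.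
Proof.
move=> Lf Lg; rewrite norm_sqrD //.
have := sqr_ge0 (norm O (f - g)).
rewrite norm_sqrD ?normN ?innerNr //; last exact: L2N.
lra.
Qed.

(** Operators respect equality only up to norm zero; Cauchy-Schwarz turns this into true equality of
    inner products, the form in which [eqL2] is exploited. *)
Lemma eqL2_inner f g h : L2 O f -> L2 O g -> L2 O h -> eqL2 O f g ->
  inner O f h = inner O g h.
Proof.
move=> Lf Lg Lh fg; apply/eqP; rewrite -subr_eq0 -innerBl // -normr_le0.
by rewrite (le_trans (inner_CauchySchwarz _ _)) ?fg ?mul0r //; exact: L2B.
Qed.

Lemma cvg_inner (u : nat -> fn) f h : (forall n, L2 O (u n)) -> L2 O f -> L2 O h ->
  norm O (u n - f) @[n --> \oo] --> (0 : R) ->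
  inner O (u n) h @[n --> \oo] --> inner O f h.
Proof.
move=> Lu Lf Lh uf.
apply: (@cvg_dist_le _ _ (fun n => norm O (u n - f) * norm O h)) => [n|].
  by rewrite -innerBl //; apply: inner_CauchySchwarz => //; exact: L2B.
by rewrite -[X in _ --> X](mul0r (norm O h)); apply: cvgM => //; exact: cvg_cst.
Qed.

End L2_domain.

Lemma nneseries_EFin_cvg (R : realType) (u : nat -> R) (l : R) :
  (\sum_(j < n) u j) @[n --> \oo] --> l ->
  (\sum_(0 <= j <oo) (u j)%:E)%E = l%:E.
Proof.
move=> ul; apply/cvg_lim => //.
under eq_fun do rewrite sumEFin big_mkord.
by apply/fine_cvgP; split => //; exact: nearW.
Qed.

Section orthonormal.
Variables (R : realType) (d : nat) (O : set 'rV[R]_d) (mO : measurable O).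
Variables (I : finType) (e : I -> 'rV[R]_d -> R).
Hypothesis Le : forall i, L2 O (e i).
Hypothesis oe : forall i j, inner O (e i) (e j) = (i == j)%:R.

Lemma inner_orthonormal (P : pred I) (c : I -> R) i : P i ->
  inner O (\sum_(j | P j) c j *: e j) (e i) = c i.
Proof.
move=> Pi; rewrite inner_suml //; last by move=> j _; exact: L2Z.
rewrite (bigD1 i) //= innerZl // oe eqxx mulr1 big1 ?addr0 // => j /andP[_ /negPf ji].
by rewrite innerZl // oe ji mulr0.
Qed.

Lemma norm_sqr_orthonormal (c : I -> R) :
  norm O (\sum_j c j *: e j) ^+ 2 = \sum_j c j ^+ 2.
Proof.
rewrite norm_sqr inner_sumr //; last 2 first.
- by move=> j _; exact: L2Z.
- by apply: L2_sum => // j _; exact: L2Z.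
apply: eq_bigr => i _; rewrite innerZr //; last by apply: L2_sum => // j _; exact: L2Z.
by rewrite inner_orthonormal // expr2.
Qed.

Lemma norm_sqr_orthonormal_residual v : L2 O v ->
  norm O (v - \sum_j inner O v (e j) *: e j) ^+ 2 =
  norm O v ^+ 2 - \sum_j inner O v (e j) ^+ 2.
Proof.
move=> Lv; have Ls : L2 O (\sum_j inner O v (e j) *: e j).
  by apply: L2_sum => // j _; exact: L2Z.
rewrite norm_sqrD ?normN ?innerNr //; last exact: L2N.
rewrite norm_sqr_orthonormal inner_sumr //; last by move=> j _; exact: L2Z.
under eq_bigr do rewrite innerZr // -expr2.
ring.
Qed.

End orthonormal.

Section eigenbasis.
Variables (R : realType) (d : nat) (O : set 'rV[R]_d) (mO : measurable O).
Variables (lam : nat -> R) (phi : nat -> 'rV[R]_d -> R).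
Hypothesis A_eigen : eigenpairs O lam phi.
Implicit Types v w : 'rV[R]_d -> R.

Lemma lam_gt0 j : 0 < lam j.
Proof.
by case: A_eigen => -[lam0 _] [homo_lam _] _ _ _; rewrite (lt_le_trans lam0) // homo_lam.
Qed.

Lemma L2_phi j : L2 O (phi j).
Proof. by case: A_eigen => _ _ /(_ j)[[g [[]]]]. Qed.
Hint Resolve L2_phi : core.

Lemma inner_phi i j : inner O (phi i) (phi j) = (i == j)%:R.
Proof. by case: A_eigen. Qed.

(** A finite combination of eigenfunctions has all powers of $A$ and pairs explicitly with every
    linear functional; bounds are proved on it and then carried to [v] by a limit. *)
Definition trunc v n := \sum_(j < n) inner O v (phi j) *: phi j.

Lemma L2_trunc v n : L2 O (trunc v n).
Proof. by apply: L2_sum => // j _; exact: L2Z. Qed.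

Lemma inner_phi_ord n (i j : 'I_n) : inner O (phi i) (phi j) = (i == j)%:R.
Proof. by rewrite inner_phi. Qed.

Lemma inner_trunc v n j :
  inner O (trunc v n) (phi j) = if (j < n)%N then inner O v (phi j) else 0.
Proof.
rewrite /trunc inner_suml //; last by move=> i _; exact: L2Z.
under eq_bigr do rewrite innerZl // inner_phi.
case: ifPn => jn.
  rewrite (bigD1 (Ordinal jn)) //= eqxx mulr1 big1 ?addr0 // => i /eqP ij.
  by rewrite [_ == _]negbTE ?mulr0 //; apply/eqP => ij'; apply: ij; exact: val_inj.
rewrite big1 // => i _; rewrite [_ == _]negbTE ?mulr0 //.
by apply: contraNneq jn => <-.
Qed.

Lemma cvg_trunc v : L2 O v -> norm O (trunc v n - v) @[n --> \oo] --> (0 : R).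
Proof.
move=> Lv; have [_ _ _ _ /(_ _ Lv)] := A_eigen.
rewrite (_ : (fun n => _) = (fun n => norm O (trunc v n - v))) //.
by apply/funext => n; rewrite normBC //; exact: L2_trunc.
Qed.

Lemma norm_sqr_residual v n : L2 O v ->
  norm O (v - trunc v n) ^+ 2 = norm O v ^+ 2 - \sum_(j < n) inner O v (phi j) ^+ 2.
Proof. by move=> Lv; rewrite norm_sqr_orthonormal_residual //; exact: inner_phi_ord. Qed.

Lemma cvg_Parseval v : L2 O v ->
  (\sum_(j < n) inner O v (phi j) ^+ 2) @[n --> \oo] --> norm O v ^+ 2.
Proof.
move=> Lv; apply: (@cvg_dist_le _ _ (fun n => norm O (trunc v n - v) ^+ 2)) => [n|].
  rewrite /= normBC //; last exact: L2_trunc.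
  rewrite distrC -norm_sqr_residual //.
  by rewrite ger0_norm ?sqr_ge0.
exact/cvg0_sqr/cvg_trunc.
Qed.

Lemma Parseval v : L2 O v ->
  (\sum_(0 <= j <oo) (inner O v (phi j) ^+ 2)%:E)%E = (norm O v ^+ 2)%:E.
Proof. by move=> Lv; apply: nneseries_EFin_cvg; exact: cvg_Parseval. Qed.

End eigenbasis.

(** * Measurability and volume on row vectors *)

Section rV_topology.
Variables (R : realType) (d : nat).
Notation E := 'rV[R]_d.

Lemma rV_ballP (x y : E) (e : R) :
  ball x e y <-> 0 < e /\ forall i, `|x 0 i - y 0 i| < e.
Proof.
split=> [[e0 h]|[e0 h]]; split => //; first by move=> i; exact: h.
by move=> i j; rewrite (ord1 i); exact: h.
Qed.

Lemma nbhs_rVP (x : E) (A : set E) :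
  nbhs x A <-> exists2 e : R, 0 < e & forall y : E, (forall i, `|x 0 i - y 0 i| < e) -> A y.
Proof.
split.
  by move=> /nbhs_ballP[e /= e0 h]; exists e => // y xy; apply: h; exact/rV_ballP.
move=> [e e0 h]; apply/nbhs_ballP; exists e => //= y /rV_ballP[_]; exact: h.
Qed.

Lemma measurable_rV_forall (B : 'I_d -> set R) : (forall i, measurable (B i)) ->
  measurable [set x : E | forall i, B i (x 0 i)].
Proof.
move=> mB; rewrite (_ : mkset _ = \bigcap_(i in [set: 'I_d]) ((@rV_coord R d i) @^-1` B i)).
  apply: fin_bigcap_measurable => // i _; rewrite -[X in measurable X]setTI.
  by apply: (measurable_rV_coord i) => //; exact: mB.
by apply/seteqP; split => x /= h i; [move=> _; exact: h|exact: h].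
Qed.

(** The cell of mesh $1/(n+1)$ that contains [x], as an integer vector. It takes countably many
    values, so that every function of it is measurable once the cells are. *)
Definition grid n (x : E) : 'rV[int]_d := \row_i Num.floor (n.+1%:R * x 0 i).

Lemma measurable_fun_grid n (g : 'rV[int]_d -> R) : measurable_fun setT (g \o grid n).
Proof.
move=> _ B mB; rewrite setTI.
rewrite (_ : _ @^-1` B = \bigcup_(z in [set z | B (g z)]) [set x | grid n x = z]); last first.
  by apply/seteqP; split => [x Bx|x [z /= Bz zE]]; [exists (grid n x)|rewrite /= zE].
rewrite bigcup_mkcond; apply: countable_bigcupT_measurable; first exact: countableP.
move=> z; case: ifPn => _ //.
rewrite (_ : mkset _ = [set x : E | forall i, [set y | Num.floor (n.+1%:R * y) = z 0 i] (x 0 i)]).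
  apply: (measurable_rV_forall (B := fun i => [set y | Num.floor (n.+1%:R * y) = z 0 i])) => i.
  rewrite (_ : mkset _ = `[(z 0 i)%:~R / n.+1%:R, (z 0 i + 1)%:~R / n.+1%:R[%classic).
    exact: measurable_itv.
  apply/seteqP; split => y /=; rewrite in_itv /= ler_pdivrMr // ltr_pdivlMr // (mulrC y).
    by move=> <-; exact: floor_itv.
  by move=> h; apply: floor_def.
apply/seteqP; split => x /=; first by move=> <- i; rewrite mxE.
by move=> h; apply/rowP => i; rewrite mxE h.
Qed.

Lemma cvg_grid (x : E) :
  (map_mx (fun z : int => z%:~R / n.+1%:R) (grid n x) : E) @[n --> \oo] --> x.
Proof.
apply/cvg_ballP => e e0; near=> n; apply/rV_ballP; split => // i; rewrite !mxE.
have /andP[h1 h2] := floor_itv (n.+1%:R * x 0 i).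
set z : R := (Num.floor _)%:~R in h1 *.
rewrite intrD -/z in h2.
have -> : x 0 i - z / n.+1%:R = (n.+1%:R * x 0 i - z) / n.+1%:R by field.
rewrite ger0_norm ?divr_ge0 ?subr_ge0 // (@lt_trans _ _ (n.+1%:R^-1)) //.
  by rewrite -[ltRHS]mul1r ltr_pM2r ?invr_gt0 // ltrBlDl.
by near: n; exact: near_infty_natSinv_lt (PosNum e0).
Unshelve. all: by end_near. Qed.

(** The sigma-algebra on row vectors is generated by the coordinates, not by the open sets. Rounding
    the argument to the lower corner of its cell gives measurable functions, which converge to [f]
    pointwise by continuity. *)
Lemma continuous_measurable_rV (f : E -> R) : continuous (f : E -> R^o) ->
  measurable_fun [set: E] f.
Proof.
move=> cf.
apply: (@measurable_fun_cvg _ _ _ _ (fun n => (fun z : 'rV[int]_d =>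
   f (map_mx (fun z : int => z%:~R / n.+1%:R) z)) \o grid n)) => [n|x _].
  exact: (measurable_fun_grid n).
have cx : f y @[y --> x] --> f x by exact: cf.
exact: (cvg_comp _ _ (@cvg_grid x) cx).
Qed.

Definition rV_box (x : E) (r : R) := [set y : E | forall i, x 0 i - r < y 0 i <= x 0 i + r].

Lemma measurable_rV_box x r : measurable (rV_box x r).
Proof.
rewrite (_ : rV_box x r = [set y : E | forall i, `]x 0 i - r, x 0 i + r]%classic (y 0 i)]).
  apply: (measurable_rV_forall (B := fun i => `]x 0 i - r, x 0 i + r]%classic)) => i.
  exact: measurable_itv.
by apply/seteqP; split => y h i; have := h i; rewrite /= in_itv.
Qed.

Lemma lebesgue_rV_cube x r : 0 <= r -> lebesgue_rV R d (rV_box x r) = ((r + r) ^+ d)%:E.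
Proof.
move=> r0; rewrite (_ : rV_box x r = [set y : E | forall i,
    (x - const_mx r : E) 0 i < y 0 i <= (x + const_mx r : E) 0 i]); last first.
  by apply/seteqP; split => y /= h i; have := h i; rewrite !mxE.
apply: etrans (lebesgue_rV_box _) _ => [i|]; first by rewrite !mxE; lra.
congr (_%:E); rewrite (eq_bigr (fun=> r + r)) ?prodr_const ?card_ord //.
by move=> i _; rewrite !mxE; ring.
Qed.

Lemma rV_norm_coord (y : E) i : `|y 0 i| <= `|y|.
Proof.
rewrite [leRHS]/Num.norm /= mx_normrE.
exact: (le_bigmax _ (fun ij => `|y ij.1 ij.2|) (0, i)).
Qed.

Lemma bounded_lebesgue_rV (A : set E) : measurable A -> bounded_set A ->
  (lebesgue_rV R d A < +oo)%E.
Proof.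
move=> mA [M [_ hM]].
(* One unit exceeds the bound [M], whose sign is unknown; the other gives the strict inequality at
   the left ends of the half-open box. *)
have AB : A `<=` rV_box 0 (`|M| + 2).
  move=> y Ay i; have M1 : M < `|M| + 1 by rewrite (le_lt_trans (ler_norm _)) // ltrDl.
  have := le_trans (rV_norm_coord y i) (hM _ M1 y Ay).
  by rewrite !mxE ler_norml => /andP[? ?]; apply/andP; split; lra.
apply: (@le_lt_trans _ _ (lebesgue_rV R d (rV_box 0 (`|M| + 2)))).
  by apply: le_measure => //; rewrite inE //; exact: measurable_rV_box.
by rewrite lebesgue_rV_cube ?addr_ge0 // ltry.
Qed.

End rV_topology.

Section convex_polygonal.
Variables (R : realType) (d : nat) (O : set 'rV[R]_d).
Hypothesis O_domain : convex_polygonal_domain O.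
Notation E := 'rV[R]_d.

Lemma convex_polygonal_measurable : measurable O.
Proof.
have [_ _ [m [a [b OE]]]] := O_domain.
rewrite (_ : O = \bigcap_(i in [set: 'I_m])
   ((fun x : E => \sum_j a i 0 j * x 0 j) @^-1` `]-oo, b i[%classic)); last first.
  by rewrite OE; apply/seteqP; split => x /= h i; [move=> _; have := h i|have := h i I];
    rewrite /= in_itv.
apply: fin_bigcap_measurable => // i _; rewrite -[X in measurable X]setTI.
suff mf : measurable_fun [set: E] (fun x : E => \sum_j a i 0 j * x 0 j).
  by apply: mf => //; exact: measurable_itv.
apply: measurable_sum => j; apply: measurable_funM => //.
exact: (measurable_rV_coord j).
Qed.

Lemma convex_polygonal_nbhs x : O x -> nbhs x O.
Proof.
have [_ _ [m [a [b ->]]]] := O_domain => Ox.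
apply: (@filter_forall E 'I_m (fun i => [set y : E | \sum_j a i 0 j * y 0 j < b i]) (nbhs x)) => i.
have := Ox i; rewrite -subr_gt0; set e := b i - _ => e0.
have s0 : 0 < \sum_j `|a i 0 j| + 1 by rewrite ltr_wpDl // sumr_ge0.
(* [e] is the slack of the [i]-th constraint at [x]; the 1 in the denominator keeps it positive when
   the vector [a i] is zero. *)
apply/nbhs_rVP; exists (e / (\sum_j `|a i 0 j| + 1)); first by rewrite divr_gt0.
move=> y xy /=; rewrite -subr_gt0.
have -> : b i - \sum_j a i 0 j * y 0 j = e + \sum_j a i 0 j * (x 0 j - y 0 j).
  rewrite /e -addrA; congr (_ + _); rewrite -!sumrN -big_split /=.
  by apply: eq_bigr => j _; ring.
suff : `|\sum_j a i 0 j * (x 0 j - y 0 j)| < e.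
  by rewrite ltr_norml => /andP[? _]; rewrite -ltrBlDl sub0r.
apply: (@le_lt_trans _ _ (\sum_j `|a i 0 j| * (e / (\sum_j `|a i 0 j| + 1)))).
  apply: (le_trans (ler_norm_sum _ _ _)); apply: ler_sum => j _.
  by rewrite normrM ler_wpM2l // ltW.
rewrite -mulr_suml mulrCA -[ltRHS]mulr1 ltr_pM2l // ltr_pdivrMr // mul1r.
by rewrite ltrDl.
Qed.

End convex_polygonal.

(** * The finite element space *)

Section finite_elements.
Variables (R : realType) (d : nat) (O : set 'rV[R]_d).
Hypotheses (mO : measurable O) (bO : bounded_set O).
Notation E := 'rV[R]_d.
Notation fn := (E -> R).
Implicit Types f g v w : fn.

(** Continuity is on the whole of $\mathbb R^d$, hence on a closed ball that contains [O]: there [f]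
    is bounded, and [O] has finite volume. *)
Lemma L2_continuous f : continuous (f : E -> R^o) -> L2 O f.
Proof.
move=> cf; have mf := continuous_measurable_rV cf.
have [M [Mreal hM]] := bO.
pose K := [set x : E | `|x| <= M + 1].
have OK : O `<=` K by move=> x Ox; apply: hM => //; rewrite ltrDl.
have cK : compact K.
  apply: bounded_closed_compact.
    by exists (M + 1); split; [exact: num_real|move=> t /ltW Mt x /= /le_trans; apply].
  have : closed ((fun x : E => `|x|) @^-1` [set r | r <= M + 1]).
    apply: preimage_closed; last exact: closed_le.
    by move=> x _; exact: norm_continuous.
  exact.
have [N [_ hN]] : bounded_set (f @` K : set R^o).
  apply/compact_bounded/continuous_compact => //.
  exact: continuous_subspaceT.
have fN x : O x -> `|f x| <= `|N| + 1.
  move=> Ox; apply: (hN (`|N| + 1)); last by exists x => //; exact: OK.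
  by rewrite (le_lt_trans (ler_norm _)) // ltrDl.
have mfO : measurable_fun O f by exact: measurable_funTS.
split=> //.
apply: (@le_lt_trans _ _ (\int[lebesgue_rV R d]_(x in O) (((`|N| + 1) ^+ 2)%:E))%E).
  apply: ge0_le_integral => //.
  - by move=> x _; rewrite lee_fin sqr_ge0.
  - by apply/measurable_EFinP; exact: measurable_funX.
  - move=> x Ox; rewrite lee_fin -(real_normK (num_real (f x))).
    by rewrite ler_pXn2r ?nnegrE ?addr_ge0 //; exact: fN.
rewrite integral_cst // lte_mul_pinfty ?lee_fin ?sqr_ge0 //.
exact: bounded_lebesgue_rV.
Qed.

Lemma partial_lin (i : 'I_d) a f g :
  (forall x, derivable (f : E -> R^o) x (basis_vec R i)) ->
  (forall x, derivable (g : E -> R^o) x (basis_vec R i)) ->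
  partial i (a *: f + g) = a *: partial i f + partial i g.
Proof.
move=> df dg; apply/funext => x; rewrite /partial.
have dZ := @derivableZ R _ R^o f a x (basis_vec R i) (df x).
rewrite [LHS](@deriveD R _ R^o (a \*: (f : E -> R^o)) g x _ dZ (dg x)).
by rewrite [X in X + _ = _](@deriveZ R _ R^o f a x _ (df x)).
Qed.

Lemma smooth_partials_lin a f g s : smooth f -> smooth g ->
  foldr (@partial R d) (a *: f + g) s = a *: foldr (@partial R d) f s + foldr (@partial R d) g s.
Proof.
move=> sf sg; elim: s => //= i s ->.
by rewrite partial_lin // => x; [have [_] := sf s|have [_] := sg s].
Qed.

Lemma continuous_lin a f g : continuous (f : E -> R^o) -> continuous (g : E -> R^o) ->
  continuous (a *: f + g : E -> R^o).
Proof.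
move=> cf cg x; have cfx : f y @[y --> x] --> f x by exact: cf.
have cgx : g y @[y --> x] --> g x by exact: cg.
exact: (cvgD (cvgM (cvg_cst a) cfx) cgx).
Qed.

Lemma smooth_lin a f g : smooth f -> smooth g -> smooth (a *: f + g).
Proof.
move=> sf sg s; rewrite smooth_partials_lin //.
have [cf df] := sf s; have [cg dg] := sg s; split=> [x|i x].
  exact: continuous_lin.
apply: (@derivableD R _ R^o (a \*: (foldr (@partial R d) f s : E -> R^o))); last exact: dg.
by apply: derivableZ; exact: df.
Qed.

Lemma test_function_lin a f g :
  test_function O f -> test_function O g -> test_function O (a *: f + g).
Proof.
move=> [sf [K [cK KO fK]]] [sg [L [cL LO gL]]]; split; first exact: smooth_lin.
exists (K `|` L); split; [exact: compactU|by move=> x [/KO|/LO]|].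
move=> x /not_orP[Kx Lx].
by rewrite !fctE fK // gL // scaler0 addr0.
Qed.

Lemma L2_smooth_partials f s : smooth f -> L2 O (foldr (@partial R d) f s).
Proof. by move=> sf; apply: L2_continuous; have [] := sf s. Qed.

Lemma L2_test_function f : test_function O f -> L2 O f.
Proof. by move=> [sf _]; exact: (L2_smooth_partials [::]). Qed.

Lemma L2_partial_test_function i f : test_function O f -> L2 O (partial i f).
Proof. by move=> [sf _]; exact: (L2_smooth_partials [:: i]). Qed.

Lemma weak_partial_lin i a f g f' g' : L2 O f -> L2 O g -> L2 O f' -> L2 O g' ->
  weak_partial O i f f' -> weak_partial O i g g' ->
  weak_partial O i (a *: f + g) (a *: f' + g').
Proof.
move=> Lf Lg Lf' Lg' ff' gg' eta teta.
have Leta := L2_test_function teta; have Lpeta := L2_partial_test_function i teta.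
by rewrite !inner_lin // ff' // gg' // opprD mulrN.
Qed.

Lemma weak_gradient_lin a f g (f' g' : 'I_d -> fn) : weak_gradient O f f' -> weak_gradient O g g' ->
  weak_gradient O (a *: f + g) (fun i => a *: f' i + g' i).
Proof.
move=> [Lf ff'] [Lg gg']; split; first exact: L2_lin.
move=> i; have [Lf' wf] := ff' i; have [Lg' wg] := gg' i.
by split; [exact: L2_lin|exact: weak_partial_lin].
Qed.

Lemma cvg_norm_lin a (u v : nat -> fn) f g :
  (forall n, L2 O (u n)) -> (forall n, L2 O (v n)) -> L2 O f -> L2 O g ->
  norm O (u n - f) @[n --> \oo] --> (0 : R) ->
  norm O (v n - g) @[n --> \oo] --> (0 : R) ->
  norm O (a *: u n + v n - (a *: f + g)) @[n --> \oo] --> (0 : R).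
Proof.
move=> Lu Lv Lf Lg uf vg.
apply: (@cvg_dist_le _ _ (fun n => `|a| * norm O (u n - f) + norm O (v n - g))).
  move=> n; rewrite subr0 ger0_norm ?norm_ge0 // -(normZ mO); last exact: L2B.
  rewrite (_ : _ - _ = a *: (u n - f) + (v n - g)).
    by apply: (norm_triangle mO); [apply: (L2Z mO)|]; exact: L2B.
  by rewrite scalerBr opprD addrACA.
by have := cvgD (cvgM (cvg_cst `|a|) uf) vg; rewrite mulr0 addr0; apply.
Qed.

Lemma H10_lin a f g : H10 O f -> H10 O g -> H10 O (a *: f + g).
Proof.
move=> [f' [wf [u [tu uf uf']]]] [g' [wg [v [tv vg vg']]]].
have Lf : L2 O f by case: wf. have Lg : L2 O g by case: wg.
have Lf' i : L2 O (f' i) by case: wf => _ /(_ i)[].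
have Lg' i : L2 O (g' i) by case: wg => _ /(_ i)[].
exists (fun i => a *: f' i + g' i); split; first exact: weak_gradient_lin.
exists (fun n => a *: u n + v n); split.
- by move=> n; exact: test_function_lin.
- by apply: cvg_norm_lin => // n; exact: L2_test_function.
- move=> i.
  rewrite (_ : (fun n => _) = (fun n => norm O (a *: partial i (u n) + partial i (v n)
     - (a *: f' i + g' i)))).
    by apply: cvg_norm_lin => // n; exact: L2_partial_test_function.
  apply/funext => n; rewrite partial_lin // => x.
    by case: (tu n) => /(_ [::])[_ /(_ i)].
  by case: (tv n) => /(_ [::])[_ /(_ i)].
Qed.

Lemma test_function0 : test_function O 0.
Proof.
split; last first.
  exists set0; split => //.
  exact: (@compact0 E).
have s0 s : foldr (@partial R d) (0 : fn) s = 0.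
  elim: s => //= i s ->; apply/funext => x.
  exact: (@derive_cst R _ R^o 0 x).
move=> s; rewrite s0; split => [|i x]; first exact: (@cst_continuous E R^o 0).
exact: (@derivable_cst R _ R^o 0).
Qed.

Lemma H10_0 : H10 O 0.
Proof.
have p0 i : partial i (0 : fn) = 0.
  by apply/funext => x; exact: (@derive_cst R _ R^o 0 x).
have w0 : weak_gradient O 0 (fun=> 0).
  split; first exact: L2_0.
  by move=> i; split; [exact: L2_0|move=> eta _; rewrite !inner0l oppr0].
exists (fun=> 0); split => //; exists (fun=> 0); split.
- by move=> n; exact: test_function0.
- by rewrite subrr norm0; exact: cvg_cst.
- by move=> i; rewrite p0 subrr norm0; exact: cvg_cst.
Qed.

Variable T : mesh R d.
Notation V := (fespace O T).

Lemma fespace_L2 v : V v -> L2 O v.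
Proof. by move=> [[g [[]]]]. Qed.

Lemma fespace0 : V 0.
Proof.
split => //; [exact: H10_0|exact: (@cst_continuous E R^o 0)|].
by move=> K c _ _; apply/esym/big1 => i _; rewrite mulr0.
Qed.

Lemma fespace_lin a v w : V v -> V w -> V (a *: v + w).
Proof.
move=> [hv cv v0 vK] [hw cw w0 wK]; split.
- exact: H10_lin.
- exact: continuous_lin.
- by move=> x Ox; rewrite !fctE v0 // w0 // scaler0 addr0.
- move=> K c c0 c1; rewrite !fctE vK // wK // scaler_sumr -big_split /=.
  by apply: eq_bigr => i _; rewrite mulrDr /GRing.scale /= mulrCA.
Qed.

End finite_elements.

Section definiteness.
Variables (R : realType) (d : nat) (O : set 'rV[R]_d).
Hypothesis O_domain : convex_polygonal_domain O.
Notation E := 'rV[R]_d.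
Notation fn := (E -> R).
Let mO := convex_polygonal_measurable O_domain.

(** Norm zero means zero almost everywhere, whereas elements of the finite element space have to be
    equal as functions. If $v(x)\ne0$ at a point of the open set [O], then $|v|\ge|v(x)|/2$ on a
    cube around it inside [O], and the positive volume of the cube makes the norm positive. *)
Lemma continuous_norm_eq0 (v : fn) : continuous (v : E -> R^o) ->
  (forall x, ~ O x -> v x = 0) -> L2 O v -> norm O v = 0 -> v = 0.
Proof.
move=> cv v0 Lv nv; apply/funext => x.
have [Ox|/v0//] := pselect (O x).
apply: contrapT => /eqP vx0.
have e0 : 0 < `|v x| / 2 by rewrite divr_gt0 // normr_gt0.
have /cvgrPdist_lt /(_ _ e0) vnear : v y @[y --> x] --> v x by exact: cv.
have Onear := convex_polygonal_nbhs O_domain Ox.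
have /nbhs_rVP[r r0 hr] : nbhs x [set y | O y /\ `|v x - v y| < `|v x| / 2].
  by apply: filterI => //; exact: vnear.
(* Half the radius, so that the closed sides of the cube stay inside the open ball of radius [r]. *)
have r20 : 0 < r / 2 by rewrite divr_gt0.
have hbox y : rV_box x (r / 2) y -> O y /\ `|v x| / 2 <= `|v y|.
  move=> xy; have [Oy vxy] : O y /\ `|v x - v y| < `|v x| / 2.
    apply: hr => i; have /andP[? ?] := xy i.
    by rewrite ltr_norml; apply/andP; split; lra.
  by split => //; have := lerB_dist (v x) (v y); lra.
have mbox := measurable_rV_box x (r / 2).
have boxO : rV_box x (r / 2) `<=` O by move=> y /hbox[].
have I0 : (\int[lebesgue_rV R d]_(y in O) (v y * v y)%:E = 0)%E.
  by rewrite -(EFin_ip mO Lv Lv) -[ip _ _ _ _]/(inner O v v) -norm_sqr nv expr0n.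
have mv2 : measurable_fun O (fun y => (v y * v y)%:E).
  by apply/measurable_EFinP; apply: measurable_funM; case: Lv.
suff : (0 < \int[lebesgue_rV R d]_(y in O) (v y * v y)%:E)%E by rewrite I0 ltxx.
apply: (@lt_le_trans _ _
   (\int[lebesgue_rV R d]_(y in rV_box x (r / 2)) (((`|v x| / 2) ^+ 2)%:E))%E).
  rewrite integral_cst //= lebesgue_rV_cube ?ltW // -EFinM lte_fin mulr_gt0 ?exprn_gt0 //.
  by rewrite addr_gt0.
apply: (@le_trans _ _ (\int[lebesgue_rV R d]_(y in rV_box x (r / 2)) (v y * v y)%:E)%E).
  apply: ge0_le_integral => //.
  - exact: measurable_funS mv2.
  - move=> y /hbox[_ vy]; rewrite lee_fin -expr2 -(real_normK (num_real (v y))).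
    by rewrite ler_pXn2r ?nnegrE // ltW.
apply: ge0_subset_integral => //.
by move=> y _; rewrite lee_fin -expr2 sqr_ge0.
Qed.

Variable T : mesh R d.
Hypothesis T_triang : triangulation O T.

(** The simplices cover the closure of [O] and [v] is affine on each of them, so the vertex values
    determine [v]. They are the finitely many functionals that make the space finite dimensional. *)
Lemma fespace_eq0_vertex (v : fn) : fespace O T v ->
  (forall (K : 'I_(mesh_card T)) i, v (mesh_vertex K i) = 0) -> v = 0.
Proof.
move=> [_ _ v0 vK] v00; apply/funext => x.
have [Ox|/v0//] := pselect (O x).
have [_ Tcover _] := T_triang.
have : closure O x by exact: subset_closure.
rewrite -Tcover => -[K _ [m [c [p [c0 c1 pK ->]]]]].
have /choice[s hs] : forall i, exists j, mesh_vertex K j = p i.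
  by move=> i; have [j _ jp] := pK i; exists j.
(* The convex combination may list a vertex several times; [c'] collects the weights that belong to
   vertex index [j], so that the affinity of [v] on the simplex applies. *)
pose c' j := \sum_(i | s i == j) c i.
rewrite (_ : \sum_i _ = \sum_j c' j *: mesh_vertex K j); last first.
  rewrite (partition_big s predT) //=; apply: eq_bigr => j _.
  by rewrite scaler_suml; apply: eq_bigr => i /eqP <-; rewrite hs.
rewrite vK; last 2 first.
- by move=> j; apply: sumr_ge0.
- by rewrite -c1 (partition_big s predT).
by rewrite big1 // => j _; rewrite v00 mulr0.
Qed.

Lemma fespace_definite (v : fn) : fespace O T v -> norm O v = 0 -> v = 0.
Proof.
move=> Vv; have Lv := fespace_L2 Vv; case: Vv => _ cv v0 _.
exact: continuous_norm_eq0.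
Qed.

End definiteness.

Lemma cvg_bigsum (R : realType) (U : Type) (F : set_system U) {FF : Filter F}
    (I : Type) (r : seq I) (f : I -> U -> R) (l : I -> R) :
  (forall i, f i x @[x --> F] --> l i) ->
  \sum_(i <- r) f i x @[x --> F] --> \sum_(i <- r) l i.
Proof.
move=> cf; elim: r => [|i r IH].
  rewrite big_nil (_ : (fun _ => _) = cst 0); first exact: cvg_cst.
  by apply/funext => y; rewrite big_nil.
rewrite big_cons (_ : (fun _ => _) = (fun y => f i y + \sum_(j <- r) f j y)).
  exact: (cvgD (cf i) IH).
by apply/funext => y; rewrite big_cons.
Qed.

Lemma continuous_bigsum (R : realType) (U : topologicalType) (I : Type) (r : seq I)
    (F : I -> U -> R) : (forall i, continuous (F i : U -> R^o)) ->
  continuous ((fun x => \sum_(i <- r) F i x) : U -> R^o).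
Proof. by move=> cF x; apply: (cvg_bigsum _ (f := F)) => i; exact: cF. Qed.

(** * Finite-dimensional subspaces: orthonormal bases, spectral theorem, functional calculus *)

Section finite_dimension.
Variables (R : realType) (d : nat) (O : set 'rV[R]_d) (mO : measurable O).
Notation fn := ('rV[R]_d -> R).
Variables (J : finType) (ev : J -> fn -> R).
Hypothesis ev_lin : forall j a v w, ev j (a *: v + w) = a * ev j v + ev j w.

(* The functionals [ev] (vertex values in the application) separate the points of V,
   so that V is finite dimensional. *)
Definition finite_subspace (V : set fn) :=
  [/\ V 0, forall a v w, V v -> V w -> V (a *: v + w), forall v, V v -> L2 O v,
      forall v, V v -> norm O v = 0 -> v = 0 &
      forall v, V v -> (forall j, ev j v = 0) -> v = 0].

Definition orthonormal_in (V : set fn) p (e : nat -> fn) :=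
  (forall i, (i < p)%N -> V (e i)) /\
  (forall i j, (i < p)%N -> (j < p)%N -> inner O (e i) (e j) = (i == j)%:R).

Lemma subspace_sum V (I : Type) (r : seq I) (P : pred I) (c : I -> R) (e : I -> fn) :
  finite_subspace V -> (forall i, P i -> V (e i)) -> V (\sum_(i <- r | P i) c i *: e i).
Proof.
move=> [V0 Vlin _ _ _] Ve; elim: r => [|i r IH]; first by rewrite big_nil.
by rewrite big_cons; case: ifP => // Pi; apply: Vlin => //; exact: Ve.
Qed.

(** With more vectors than functionals, the matrix of the values [ev j (e i)] has a nonzero vector
    in its left kernel. The combination with these coefficients is annihilated by every [ev j],
    hence zero, which contradicts orthonormality. *)
Lemma orthonormal_in_size V p e : finite_subspace V -> orthonormal_in V p e ->
  (p <= #|J|)%N.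
Proof.
move=> fV [Ve oe]; have [V0 Vlin VL Vdef Vev] := fV.
rewrite leqNgt; apply/negP => Jp.
pose M := \matrix_(i < p, j < #|J|) ev (enum_val j) (e i).
have : kermx M != 0.
  rewrite -mxrank_eq0 mxrank_ker subn_eq0 -ltnNge.
  by rewrite (leq_ltn_trans (rank_leq_col M)).
move=> /rowV0Pn[r rM]; apply/negP/negPn/eqP.
have rM0 : r *m M = 0 by apply/sub_kermxP.
pose v := \sum_(i < p) r 0 i *: e i.
have Vv : V v by apply: subspace_sum => // i _; exact: Ve.
have v0 : v = 0.
  apply: Vev => // j; have /rowP/(_ (enum_rank j)) := rM0.
  rewrite !mxE (eq_bigr (fun i : 'I_p => r 0 i * ev j (e i))); last first.
    by move=> i _; rewrite mxE enum_rankK.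
  move=> <-; rewrite /v.
  have ev0 : ev j 0 = 0.
    have := ev_lin j 1 0 0; rewrite scaler0 addr0 mul1r => /eqP.
    by rewrite -subr_eq subrr => /eqP.
  by elim/big_rec2: _ => // i y w _ <-; rewrite ev_lin.
have oe' (i j : 'I_p) : inner O (e i) (e j) = (i == j)%:R by rewrite oe.
apply/rowP => i; rewrite mxE.
rewrite -(@inner_orthonormal _ _ _ mO _ (fun i : 'I_p => e i) _ oe' predT (r 0) i) //.
  by rewrite -[X in inner O X _]/v v0 inner0l.
by move=> k; apply/VL/Ve.
Qed.

(** The bound on the size yields an orthonormal family of maximal size. It spans: a nonzero
    remainder $v-\sum_i(v,e_i)e_i$ would, by the extension hypothesis, let one more vector be
    adjoined. The predicate [Pr] lets the same argument serve for orthonormal bases, with [Pr]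
    trivial, and for eigenbases. *)
Lemma maximal_orthonormal (Pr : fn -> Prop) V : finite_subspace V ->
  (forall p e, orthonormal_in V p e -> (forall i, (i < p)%N -> Pr (e i)) ->
     forall v, V v -> v <> 0 -> (forall i, (i < p)%N -> inner O v (e i) = 0) ->
     exists w, [/\ V w, Pr w, inner O w w = 1 &
       forall i, (i < p)%N -> inner O w (e i) = 0]) ->
  exists N (e : 'I_N -> fn),
    [/\ forall i, V (e i), forall i, Pr (e i),
        forall i j, inner O (e i) (e j) = (i == j)%:R &
        forall v, V v -> v = \sum_i inner O v (e i) *: e i].
Proof.
move=> fV ext; have [V0 Vlin VL Vdef Vev] := fV.
pose good p := `[< exists2 e, orthonormal_in V p e & forall i, (i < p)%N -> Pr (e i) >].
have exg : exists p, good p by exists 0%N; apply/asboolP; exists (fun=> 0) => //; split.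
have ubg p : good p -> (p <= #|J|)%N.
  by move=> /asboolP[e oe _]; exact: orthonormal_in_size oe.
case: (ex_maxnP exg ubg) => N /asboolP[e oe Pe] maxN.
exists N, (fun i => e i); have [Ve oe2] := oe; split => //.
- by move=> i; exact: Ve.
- by move=> i; exact: Pe.
- by move=> i j; rewrite oe2.
move=> v Vv; apply/eqP; rewrite -subr_eq0; apply/eqP; set w := (v - _).
apply: contrapT => w0.
have Vs : V (\sum_(i < N) inner O v (e i) *: e i).
  by apply: subspace_sum => // i _; exact: Ve.
have Vw : V w by rewrite /w addrC -scaleN1r; apply: Vlin.
have we i : (i < N)%N -> inner O w (e i) = 0.
  move=> iN; have Lei : L2 O (e i) by apply/VL/Ve.
  rewrite /w innerBl //; try exact: VL.
  apply/eqP; rewrite subr_eq0 eq_sym; apply/eqP.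
  rewrite -[e i]/(e (Ordinal iN)).
  apply: (@inner_orthonormal _ _ _ mO _ (fun i : 'I_N => e i) _ _ predT
     (fun i : 'I_N => inner O v (e i))) => //.
    by move=> k; apply/VL/Ve.
  by move=> k l; rewrite oe2.
have [z [Vz Pz nz ze]] := ext _ _ oe Pe _ Vw w0 we.
suff /maxN : good N.+1 by rewrite ltnn.
apply/asboolP; exists (fun i => if i == N then z else e i).
  split=> [i iN|i j iN jN].
    by case: eqVneq => // iN'; apply: Ve; rewrite ltn_neqAle iN' -ltnS.
  have [iE|iN'] := eqVneq i N; have [jE|jN'] := eqVneq j N; rewrite ?iE ?jE ?eqxx //.
  - by rewrite ze ?[N == j]eq_sym ?(negbTE jN') // ltn_neqAle jN' -ltnS.
  - by rewrite innerC ze ?(negbTE iN') // ltn_neqAle iN' -ltnS.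
  - by rewrite oe2 // ltn_neqAle ?iN' ?jN' -ltnS.
by move=> i iN; case: eqVneq => // iN'; apply: Pe; rewrite ltn_neqAle iN' -ltnS.
Qed.

Lemma normalize V v : finite_subspace V -> V v -> v <> 0 ->
  let w := (norm O v)^-1 *: v in V w /\ inner O w w = 1.
Proof.
move=> [V0 Vlin VL Vdef Vev] Vv v0 w.
have Vw : V w by rewrite /w -[_ *: _]addr0; exact: Vlin.
have nv : norm O v != 0 by apply/eqP => nv0; apply: v0; exact: Vdef.
split => //; rewrite -norm_sqr /w normZ; [|exact: mO|exact: VL].
by rewrite ger0_norm ?invr_ge0 ?norm_ge0 // mulVf // expr1n.
Qed.

Lemma orthonormal_basis V : finite_subspace V ->
  exists N (e : 'I_N -> fn),
    [/\ forall i, V (e i), forall i j, inner O (e i) (e j) = (i == j)%:R &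
        forall v, V v -> v = \sum_i inner O v (e i) *: e i].
Proof.
move=> fV; have [|N [e [Ve _ oe spane]]] := @maximal_orthonormal (fun=> True) _ fV.
  move=> p e [Ve _] _ v Vv v0 ve.
  have [Vw nw] := normalize fV Vv v0; exists ((norm O v)^-1 *: v); split => // i ip.
  have [_ _ VL _ _] := fV.
  by rewrite (innerZl mO) ?ve ?mulr0 //; apply: VL => //; exact: Ve.
by exists N, e.
Qed.

End finite_dimension.

Section spectral.
Variables (R : realType) (d : nat) (O : set 'rV[R]_d) (mO : measurable O).
Notation fn := ('rV[R]_d -> R).
Variables (J : finType) (ev : J -> fn -> R).
Hypothesis ev_lin : forall j a v w, ev j (a *: v + w) = a * ev j v + ev j w.

Definition symmetric_on (V : set fn) (A : fn -> fn) :=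
  [/\ forall v, V v -> V (A v),
      forall a v w, V v -> V w -> A (a *: v + w) = a *: A v + A w &
      forall v w, V v -> V w -> inner O (A v) w = inner O v (A w)].

Lemma compact_rV_sphere q : compact [set u : 'rV[R]_q | \sum_i u 0 i ^+ 2 = 1].
Proof.
apply: bounded_closed_compact.
  exists 1; split; first exact: num_real.
  move=> t t1 u /= u1; rewrite /Num.norm /= mx_normrE.
  apply: bigmax_le => [|[i j] _]; first exact: (le_trans _ (ltW t1)).
  rewrite (ord1 i) /= (le_trans _ (ltW t1)) // -(@ler_pXn2r _ 2%N) ?nnegrE //.
  rewrite expr1n real_normK ?num_real // -u1 (bigD1 j) //= lerDl.
  by apply: sumr_ge0 => k _; exact: sqr_ge0.
have : closed ((fun u : 'rV[R]_q => \sum_i u 0 i ^+ 2) @^-1` [set 1]); last exact.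
apply: preimage_closed; last exact: closed_eq.
move=> u _; apply: continuous_bigsum => i x.
have cx : (y : 'rV[R]_q) 0 i @[y --> x] --> x 0 i by exact: coord_continuous.
exact: (cvgM cx cx).
Qed.

(* The maximizer of the Rayleigh quotient on the unit sphere is an eigenvector. *)
Lemma exists_eigenvector V A : finite_subspace O ev V -> symmetric_on V A ->
  (exists2 v, V v & v <> 0) ->
  exists w mu, [/\ V w, inner O w w = 1 & A w = mu *: w].
Proof.
move=> fV [VA Alin Asym] [v1 Vv1 v1n0].
have [V0 Vlin VL Vdef _] := fV.
have [N [e [Ve oe spane]]] := orthonormal_basis mO ev_lin fV.
have Le i : L2 O (e i) by exact/VL/Ve.
have LAe i : L2 O (A (e i)) by apply/VL/VA/Ve.
pose vec (u : 'rV[R]_N) := \sum_i u 0 i *: e i.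
have Vvec u : V (vec u) by apply: (subspace_sum (ev := ev) (O := O)).
have Lvec u : L2 O (vec u) by exact/VL/Vvec.
have nvec u : inner O (vec u) (vec u) = \sum_i u 0 i ^+ 2.
  by rewrite -norm_sqr (norm_sqr_orthonormal mO).
have A0 : A 0 = 0.
  have := Alin 1 0 0 V0 V0; rewrite scale1r addr0 scale1r => /eqP.
  by rewrite -subr_eq subrr => /eqP.
have Avec u : A (vec u) = \sum_i u 0 i *: A (e i).
  rewrite /vec.
  suff [] : V (\sum_i u 0 i *: e i) /\ A (\sum_i u 0 i *: e i) = \sum_i u 0 i *: A (e i) by [].
  elim/big_rec2: _ => // i y z _ [Vz <-]; split; first exact: Vlin.
  by rewrite Alin.
pose f (u : 'rV[R]_N) := inner O (A (vec u)) (vec u).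
have fE u : f u = \sum_i \sum_j u 0 i * (u 0 j * inner O (A (e i)) (e j)).
  rewrite /f Avec inner_suml //; last by move=> i _; exact: L2Z.
  apply: eq_bigr => i _; rewrite innerZl // inner_sumr //; last by move=> j _; exact: L2Z.
  by rewrite mulr_sumr; apply: eq_bigr => j _; rewrite innerZr.
have cf : continuous (f : 'rV[R]_N -> R^o).
  rewrite (funext fE).
  apply: (continuous_bigsum (F := fun i (u : 'rV[R]_N) =>
    \sum_j u 0 i * (u 0 j * inner O (A (e i)) (e j)))) => i.
  apply: (continuous_bigsum (F := fun j (u : 'rV[R]_N) =>
    u 0 i * (u 0 j * inner O (A (e i)) (e j)))) => j x.
  have cx k : (y : 'rV[R]_N) 0 k @[y --> x] --> x 0 k by exact: coord_continuous.
  exact: (cvgM (cx i) (cvgM (cx j) (cvg_cst _))).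
pose S := [set u : 'rV[R]_N | \sum_i u 0 i ^+ 2 = 1].
have coord v : V v -> v = vec (\row_i inner O v (e i)).
  by move=> Vv; rewrite {1}(spane _ Vv); apply: eq_bigr => i _; rewrite mxE.
have S0 : S !=set0.
  have [Vw nw] := normalize mO fV Vv1 v1n0.
  exists (\row_i inner O ((norm O v1)^-1 *: v1) (e i)).
  by rewrite /S /= -nvec -coord.
have [c cS cmax] := EVT_max_rV S0 (@compact_rV_sphere N) (continuous_subspaceT cf).
rewrite inE in cS; pose w := vec c; pose mu := f c.
have nw : inner O w w = 1 by rewrite nvec.
have Rayleigh z : V z -> inner O (A z) z <= mu * inner O z z.
  move=> Vz; have [->|/eqP z0] := eqVneq z 0.
    by rewrite A0 !inner0l mulr0.
  have [Vy ny] := normalize mO fV Vz z0; set y := _ *: z in Vy ny.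
  have : inner O (A y) y <= mu.
    have := cmax (\row_i inner O y (e i)); rewrite /f -coord //; apply.
    by rewrite inE /S /= -nvec -coord.
  have Lz := VL _ Vz; have LAz := VL _ (VA _ Vz).
  have Ay : A y = (norm O z)^-1 *: A z.
    by rewrite /y -[X in A X]addr0 Alin // A0 addr0.
  rewrite Ay /y innerZl ?innerZr //; last exact: L2Z.
  have nz : 0 < norm O z.
    rewrite lt0r norm_ge0 andbT; apply/eqP => /(Vdef _ Vz); exact: z0.
  by rewrite mulrA -invfM -expr2 norm_sqr mulrC ler_pdivrMr // -norm_sqr exprn_gt0.
have Vw : V w by exact: Vvec.
exists w, mu; split => //.
have VAw := VA _ Vw.
have Lw := VL _ Vw; have LAw := VL _ VAw.
(* First variation: since [w] attains the bound [mu], the Rayleigh inequality at $tz+w$ reads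
   $t^2q+2tb\ge0$ for every $t$, which forces $b=0$. *)
have orth z : V z -> mu * inner O w z - inner O (A w) z = 0.
  move=> Vz; have Lz := VL _ Vz; have LAz := VL _ (VA _ Vz).
  set b := mu * _ - _; set q := mu * inner O z z - inner O (A z) z.
  have q0 : 0 <= q by rewrite subr_ge0 Rayleigh.
  have key t : 0 <= t ^+ 2 * q + 2 * t * b.
    have Vtz : V (t *: z + w) by exact: Vlin.
    have expand (z1 z2 w1 w2 : fn) : L2 O z1 -> L2 O z2 -> L2 O w1 -> L2 O w2 ->
        inner O (t *: z1 + w1) (t *: z2 + w2) = t ^+ 2 * inner O z1 z2 +
          t * (inner O z1 w2 + inner O w1 z2) + inner O w1 w2.
      move=> L1 L2 L3 L4; have Ltz := L2Z mO t L2.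
      rewrite inner_lin // ?innerDr ?innerZr //; first by ring.
      exact: L2D.
    have := Rayleigh _ Vtz; rewrite Alin // !expand // nw.
    rewrite (Asym z w) // (innerC O z (A w)) (innerC O z w) -[inner O (A w) w]/mu.
    by rewrite -subr_ge0 /q /b; congr (_ <= _); ring.
  apply/eqP; apply: contraT => b0.
  (* [q] may vanish, hence the denominator $q+1$; the value becomes $-b^2(q+2)/(q+1)^2$, negative
     unless $b=0$. *)
  have := key (- b / (q + 1)).
  have q1 : 0 < q + 1 by rewrite ltr_wpDl.
  have -> : (- b / (q + 1)) ^+ 2 * q + 2 * (- b / (q + 1)) * b =
     - (b ^+ 2 * (q + 2) / (q + 1) ^+ 2) by field; rewrite gt_eqF.
  rewrite oppr_ge0 leNgt => /negP[].
  rewrite divr_gt0 ?exprn_gt0 // mulr_gt0 ?ltr_wpDl // lt0r sqr_ge0 andbT.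
  by rewrite sqrf_eq0.
apply/eqP; rewrite -subr_eq0; apply/eqP.
have Vr : V (A w - mu *: w).
  by rewrite addrC -scaleNr; apply: Vlin.
apply: Vdef => //; apply/eqP; rewrite -sqrf_eq0 norm_sqr.
set r := A w - _ in Vr *; have Lr := VL _ Vr.
rewrite {1}/r innerBl ?innerZl //; last exact: L2Z.
by rewrite -opprB orth // oppr0.
Qed.

(** Deflation: the vectors of [V] orthogonal to the eigenvectors already found form a subspace that
    [A] preserves by symmetry, and the same functionals [ev] separate its points.
    [exists_eigenvector] on this subspace provides the next vector. *)
Lemma spectral_basis V A : finite_subspace O ev V -> symmetric_on V A ->
  exists N (e : 'I_N -> fn) (mu : 'I_N -> R),
    [/\ forall i, V (e i), forall i, A (e i) = mu i *: e i,
        forall i j, inner O (e i) (e j) = (i == j)%:R &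
        forall v, V v -> v = \sum_i inner O v (e i) *: e i].
Proof.
move=> fV sA; have [VA Alin Asym] := sA.
have [V0 Vlin VL Vdef Vev] := fV.
have [|N [e [Ve Pe oe spane]]] :=
    maximal_orthonormal mO ev_lin (Pr := fun w => exists mu, A w = mu *: w) fV.
  move=> p e [Ve oe] Pe v Vv v0 ve.
  pose V' := [set w | V w /\ forall i, (i < p)%N -> inner O w (e i) = 0].
  have Le i : (i < p)%N -> L2 O (e i) by move=> ip; exact/VL/Ve.
  have fV' : finite_subspace O ev V'.
    split.
    - by split => // i _; rewrite inner0l.
    - move=> a x y [Vx xe] [Vy ye]; split; first exact: Vlin.
      move=> i ip; rewrite inner_lin ?xe ?ye ?mulr0 ?addr0 //.
      - exact: VL. - exact: VL. - exact: Le.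
    - by move=> x [/VL].
    - by move=> x [Vx _]; exact: Vdef.
    - by move=> x [Vx _]; exact: Vev.
  have sA' : symmetric_on V' A.
    split.
    - move=> x [Vx xe]; split; first exact: VA.
      move=> i ip; rewrite Asym //; last exact: Ve.
      have [mu ->] := Pe i ip; rewrite innerZr ?xe ?mulr0 //; [exact: Le|exact: VL].
    - by move=> a x y [Vx _] [Vy _]; exact: Alin.
    - by move=> x y [Vx _] [Vy _]; exact: Asym.
  have [|w [mu [[Vw we] nw Aw]]] := exists_eigenvector fV' sA'.
    by exists v.
  by exists w; split => //; exists mu.
have /choice[mu Amu] := Pe.
by exists N, e, mu.
Qed.

End spectral.

Section subspace_operators.
Variables (R : realType) (d : nat) (O : set 'rV[R]_d) (mO : measurable O).
Notation fn := ('rV[R]_d -> R).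
Variables (J : finType) (ev : J -> fn -> R).
Hypothesis ev_lin : forall j a v w, ev j (a *: v + w) = a * ev j v + ev j w.
Variables (V : set fn) (fV : finite_subspace O ev V).

Let VL v : V v -> L2 O v. Proof. by case: fV => _ _ + _ _; apply. Qed.
Let Vlin a v w : V v -> V w -> V (a *: v + w).
Proof. by case: fV => _ + _ _ _; apply. Qed.
Let V0 : V 0. Proof. by case: fV. Qed.

Lemma subspaceB v w : V v -> V w -> V (v - w).
Proof. by move=> Vv Vw; rewrite addrC -scaleN1r; exact: Vlin. Qed.

Lemma subspaceD v w : V v -> V w -> V (v + w).
Proof. by move=> Vv Vw; rewrite -[v]scale1r; exact: Vlin. Qed.

Lemma subspace_inner_inj z z' : V z -> V z' ->
  (forall psi, V psi -> inner O z psi = inner O z' psi) -> z = z'.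
Proof.
move=> Vz Vz' h; have Vr := subspaceB Vz Vz'.
apply/eqP; rewrite -subr_eq0; apply/eqP; have [_ _ _ Vdef _] := fV; apply: Vdef => //.
apply/eqP; rewrite -sqrf_eq0 norm_sqr innerBl //; try exact: VL.
by rewrite h // subrr.
Qed.

(** The vector is $\sum_il(e_i)e_i$. [L2projP] and [discrete_laplacian_cases] obtain from it an
    element that [xget] can choose. *)
Lemma subspace_Riesz (l : fn -> R) :
  (forall a v w, V v -> V w -> l (a *: v + w) = a * l v + l w) ->
  exists z, V z /\ forall psi, V psi -> inner O z psi = l psi.
Proof.
move=> llin; have [N [e [Ve oe spane]]] := orthonormal_basis mO ev_lin fV.
have Le i : L2 O (e i) by exact/VL/Ve.
have Vz : V (\sum_i l (e i) *: e i) by apply: (subspace_sum _ _ fV).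
have l0 : l 0 = 0.
  have := llin 1 0 0 V0 V0; rewrite scaler0 addr0 mul1r => /eqP.
  by rewrite -subr_eq subrr => /eqP.
exists (\sum_i l (e i) *: e i); split => // psi Vpsi.
rewrite inner_suml //; [|by move=> i _; exact: L2Z|exact: VL].
rewrite [in RHS](spane _ Vpsi).
suff [] : V (\sum_i inner O psi (e i) *: e i) /\
    \sum_i inner O (l (e i) *: e i) psi = l (\sum_i inner O psi (e i) *: e i) by [].
elim/big_rec2: _ => [|i y z _ [Vy ->]]; first by rewrite l0.
split; first exact: Vlin.
rewrite llin // innerZl //; last exact: VL.
by rewrite innerC mulrC.
Qed.

Lemma L2projP w : L2 O w ->
  V (L2proj O V w) /\ forall psi, V psi -> inner O (L2proj O V w) psi = inner O w psi.
Proof.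
move=> Lw; rewrite /L2proj.
apply: (@xgetPex _ _ [set z | V z /\ forall psi, V psi -> inner O z psi = inner O w psi]).
apply: subspace_Riesz => a v v' Vv Vv'.
by rewrite !(innerC O w) inner_lin //; exact: VL.
Qed.

Lemma norm_L2proj w : L2 O w -> norm O (L2proj O V w) <= norm O w.
Proof.
move=> Lw; have [Vp hp] := L2projP Lw.
have [->|p0] := eqVneq (norm O (L2proj O V w)) 0; first exact: norm_ge0.
have := inner_CauchySchwarz mO Lw (VL Vp); rewrite -hp // -norm_sqr.
rewrite ger0_norm ?sqr_ge0 // expr2 ler_pM2r //.
by rewrite lt0r p0 norm_ge0.
Qed.

Section eigenbasis.
Variables (A : fn -> fn) (N : nat) (e : 'I_N -> fn) (mu : 'I_N -> R).
Hypotheses (Ve : forall i, V (e i)) (Ae : forall i, A (e i) = mu i *: e i).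
Hypothesis oe : forall i j, inner O (e i) (e j) = (i == j)%:R.
Hypothesis spane : forall v, V v -> v = \sum_i inner O v (e i) *: e i.
Hypothesis symA : symmetric_on O V A.

(** [op_calculus] picks some operator that multiplies each eigenspace by the value of [F]. The
    spectral formula defines one, so the choice succeeds; and since eigenvectors span [V], whichever
    operator is chosen coincides with the formula on [V]. *)
Lemma op_calculusE (F : R -> R) v : V v ->
  op_calculus V A F v = \sum_i (F (mu i) * inner O v (e i)) *: e i.
Proof.
move=> Vv; have [VA Alin Asym] := symA.
have Le i : L2 O (e i) by exact/VL/Ve.
pose P := [set B : fn -> fn | [/\ forall v, V v -> V (B v),
    forall a v w, V v -> V w -> B (a *: v + w) = a *: B v + B w &
    forall (nu : R) v, V v -> A v = nu *: v -> B v = F nu *: v]].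
have : P (op_calculus V A F).
  apply: (@xgetPex _ _ P).
  exists (fun v => \sum_i (F (mu i) * inner O v (e i)) *: e i); split.
  - by move=> x Vx; apply: (subspace_sum _ _ fV).
  - move=> a x y Vx Vy; rewrite scaler_sumr -big_split /=; apply: eq_bigr => i _.
    rewrite inner_lin //; try exact: VL.
    by rewrite scalerA -scalerDl; congr (_ *: _); ring.
  - move=> nu x Vx Ax; rewrite [in RHS](spane Vx) scaler_sumr; apply: eq_bigr => i _.
    rewrite scalerA; congr (_ *: _).
    (* Symmetry gives $\nu(x,e_i)=\mu_i(x,e_i)$: either the coefficient vanishes or $\mu_i=\nu$. *)
    have := Asym x (e i) Vx (Ve i).
    rewrite Ax Ae innerZl ?innerZr //; try exact: VL.
    have [->|xe0] := eqVneq (inner O x (e i)) 0; first by rewrite !mulr0.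
    by move=> /(mulIf xe0) ->.
move=> [VB Blin Beig].
have B0 : op_calculus V A F 0 = 0.
  have := Blin 1 0 0 V0 V0; rewrite scale1r addr0 scale1r => /eqP.
  by rewrite -subr_eq subrr => /eqP.
rewrite {1}(spane Vv).
suff [] : V (\sum_i inner O v (e i) *: e i) /\
   op_calculus V A F (\sum_i inner O v (e i) *: e i) =
   \sum_i (F (mu i) * inner O v (e i)) *: e i by [].
elim/big_rec2: _ => [|i y z _ [Vy <-]]; first by split.
split; first exact: Vlin.
by rewrite Blin // (Beig (mu i)) // scalerA mulrC.
Qed.

End eigenbasis.

End subspace_operators.

(** * The discrete Laplacian and its eigenbasis *)

Section discrete_laplacian.
Variables (R : realType) (d : nat) (O : set 'rV[R]_d).
Hypothesis O_domain : convex_polygonal_domain O.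
Variable T : mesh R d.
Hypothesis T_triang : triangulation O T.
Notation fn := ('rV[R]_d -> R).
Notation V := (fespace O T).
Let mO := convex_polygonal_measurable O_domain.
Let bO : bounded_set O. Proof. by case: O_domain. Qed.

Definition vertex_value (Ki : 'I_(mesh_card T) * 'I_d.+1) (v : fn) : R :=
  v (mesh_vertex Ki.1 Ki.2).

Lemma vertex_value_lin j a v w :
  vertex_value j (a *: v + w) = a * vertex_value j v + vertex_value j w.
Proof. by []. Qed.

Lemma fespace_finite : finite_subspace O vertex_value V.
Proof.
split.
- exact: fespace0.
- exact: fespace_lin.
- exact: fespace_L2.
- exact: fespace_definite.
- move=> v Vv h; apply: (fespace_eq0_vertex T_triang) => // K i.
  exact: (h (K, i)).
Qed.

Lemma fespace_weak_gradient v : V v -> exists g : 'I_d -> fn, weak_gradient O v g.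
Proof. by move=> [[g [wg _]] _ _ _]; exists g. Qed.

Notation A := (discrete_laplacian O V).

(* Uniqueness of weak gradients (the du Bois-Reymond lemma) is not needed: if it
   failed, no discrete Laplacian would exist and A would be identically 0. *)
Lemma discrete_laplacian_cases : (forall w, V w -> A w = 0) \/
  forall w, V w -> V (A w) /\ forall psi, V psi -> forall gw gpsi : 'I_d -> fn,
    weak_gradient O w gw -> weak_gradient O psi gpsi ->
    inner O (A w) psi = \sum_i inner O (gw i) (gpsi i).
Proof.
have Lg f (g : 'I_d -> fn) i : weak_gradient O f g -> L2 O (g i).
  by move=> [_ /(_ i)[]].
have [[del [wdel del0]]|uniq] := pselect (exists del : 'I_d -> fn,
    weak_gradient O 0 del /\ \sum_i inner O (del i) (del i) <> 0).
  (* Test with $\psi=0$, of which [del] is a gradient. Exchanging a gradient $g$ of [w] for $g+del$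
     changes the right-hand side by $\sum_i\|del_i\|^2\ne0$ and leaves the left-hand side as it is;
     so no [z] qualifies, and [xget] returns its default 0. *)
  left=> w Vw; apply: xgetPN => z [Vz hz]; apply: del0.
  have [g wg] := fespace_weak_gradient Vw.
  have V0 : V 0 by exact: fespace0.
  have h1 := hz _ V0 _ _ wg wdel.
  have wg' : weak_gradient O w (fun i => 1 *: g i + del i).
    have h0 := weak_gradient_lin mO bO 1 wg wdel; rewrite scale1r addr0 in h0.
    exact: h0.
  have := hz _ V0 _ _ wg' wdel; rewrite h1.
  rewrite [RHS](_ : _ = \sum_i inner O (g i) (del i) + \sum_i inner O (del i) (del i)).
    by rewrite -[LHS]addr0 => /addrI <-.
  rewrite -big_split; apply: eq_bigr => i _.
  by rewrite (inner_lin mO) ?mul1r //; [exact: Lg wg|exact: Lg wdel|exact: Lg wdel].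
right=> w Vw.
(* Two gradients of one function differ by a gradient of 0, which here has norm zero; inner products
   therefore do not depend on the gradient chosen. *)
have gradE f (g g' : 'I_d -> fn) h i : weak_gradient O f g -> weak_gradient O f g' ->
    L2 O h -> inner O (g i) h = inner O (g' i) h.
  move=> wg wg' Lh; apply: eqL2_inner => //; [exact: Lg wg|exact: Lg wg'|].
  have wd := weak_gradient_lin mO bO (-1) wg' wg.
  rewrite scaleN1r addNr in wd.
  have : \sum_i inner O (-1 *: g' i + g i) (-1 *: g' i + g i) = 0.
    by apply: contrapT => h0; apply: uniq; exists (fun i => -1 *: g' i + g i).
  move=> /eqP; rewrite psumr_eq0; last by move=> j _; exact: inner_ge0.
  move=> /allP/(_ i (mem_index_enum i))/implyP/(_ isT).
  by rewrite scaleN1r addrC -norm_sqr sqrf_eq0 => /eqP.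
have [g wg] := fespace_weak_gradient Vw.
pose G psi : 'I_d -> fn := xget (fun=> 0) [set g : 'I_d -> fn | weak_gradient O psi g].
have GP psi : V psi -> weak_gradient O psi (G psi).
  by move=> /fespace_weak_gradient; exact: (@xgetPex _ _ [set g | weak_gradient O psi g]).
apply: (@xgetPex _ _ [set z | V z /\ forall psi, V psi -> forall gw gpsi : 'I_d -> fn,
    weak_gradient O w gw -> weak_gradient O psi gpsi ->
    inner O z psi = \sum_i inner O (gw i) (gpsi i)]).
have [|z [Vz hz]] := @subspace_Riesz _ _ _ mO _ _ vertex_value_lin _ fespace_finite
    (fun psi => \sum_i inner O (G psi i) (g i)).
  move=> a v v' Vv Vv'; rewrite mulr_sumr -big_split /=; apply: eq_bigr => i _.
  rewrite -(inner_lin mO); [|exact: Lg (GP _ Vv)|exact: Lg (GP _ Vv')|exact: Lg wg].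
  have wG := weak_gradient_lin mO bO a (GP _ Vv) (GP _ Vv').
  apply: (gradE _ _ _ _ _ _ wG); last exact: Lg wg.
  by apply: GP; exact: fespace_lin.
exists z; split => // psi Vpsi gw gpsi wgw wgpsi; rewrite hz //; apply: eq_bigr => i _.
rewrite (gradE _ _ _ _ _ (GP _ Vpsi) wgpsi); last exact: Lg wg.
by rewrite innerC (gradE _ _ _ _ _ wg wgw) //; exact: Lg wgpsi.
Qed.

(** Read off from the form $\sum_i(\partial_iv,\partial_iw)$, linearity being tested against all of
    [V]; where [A] vanishes on [V] the claims are trivial. *)
Lemma discrete_laplacian_symmetric :
  symmetric_on O V A /\ forall v, V v -> 0 <= inner O (A v) v.
Proof.
have V0 : V 0 by exact: fespace0.
have [A0|AP] := discrete_laplacian_cases.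
  split; last by move=> v Vv; rewrite A0 // inner0l.
  split.
  - by move=> v Vv; rewrite A0.
  - move=> a v w Vv Vw; rewrite !A0 ?scaler0 ?addr0 //.
    exact: fespace_lin.
  - by move=> v w Vv Vw; rewrite !A0 // inner0l inner0r.
split; last first.
  move=> v Vv; have [_ h] := AP _ Vv; have [g wg] := fespace_weak_gradient Vv.
  by rewrite (h _ Vv _ _ wg wg) sumr_ge0 // => i _; exact: inner_ge0.
have Lg f (g : 'I_d -> fn) i : weak_gradient O f g -> L2 O (g i).
  by move=> [_ /(_ i)[]].
split.
- by move=> v /AP[].
- move=> a v w Vv Vw; have Vvw := fespace_lin mO bO a Vv Vw.
  have [VAv hv] := AP _ Vv; have [VAw hw] := AP _ Vw; have [VAvw hvw] := AP _ Vvw.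
  apply: (subspace_inner_inj mO fespace_finite) => //; first exact: fespace_lin.
  move=> psi Vpsi; rewrite inner_lin //; try exact: (fespace_L2 (T := T)).
  have [gv wgv] := fespace_weak_gradient Vv; have [gw wgw] := fespace_weak_gradient Vw.
  have [gp wgp] := fespace_weak_gradient Vpsi.
  have wgvw := weak_gradient_lin mO bO a wgv wgw.
  rewrite (hvw _ Vpsi _ _ wgvw wgp) (hv _ Vpsi _ _ wgv wgp) (hw _ Vpsi _ _ wgw wgp).
  rewrite mulr_sumr -big_split /=; apply: eq_bigr => i _.
  by rewrite (inner_lin mO) //; [exact: Lg wgv|exact: Lg wgw|exact: Lg wgp].
- move=> v w Vv Vw; have [VAv hv] := AP _ Vv; have [VAw hw] := AP _ Vw.
  have [gv wgv] := fespace_weak_gradient Vv; have [gw wgw] := fespace_weak_gradient Vw.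
  rewrite (hv _ Vw _ _ wgv wgw) innerC (hw _ Vv _ _ wgw wgv).
  by apply: eq_bigr => i _; rewrite innerC.
Qed.

(** Together with [fespace_finite], the interface to all that follows: the discrete operators are
    handled through the coefficients $(v,e_i)$ and the eigenvalues. These are nonnegative because
    $\mu_i=(A_he_i,e_i)$. *)
Lemma fespace_eigenbasis : exists N (e : 'I_N -> fn) (mu : 'I_N -> R),
  [/\ forall i, V (e i), forall i, 0 <= mu i,
      forall i j, inner O (e i) (e j) = (i == j)%:R,
      forall v, V v -> v = \sum_i inner O v (e i) *: e i &
      forall F v, V v -> op_calculus V A F v = \sum_i (F (mu i) * inner O v (e i)) *: e i].
Proof.
have [symA psdA] := discrete_laplacian_symmetric.
have [N [e [mu [Ve Ae oe spane]]]] :=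
  spectral_basis mO vertex_value_lin fespace_finite symA.
exists N, e, mu; split => //.
  move=> i; have := psdA _ (Ve i); rewrite Ae innerZl ?oe ?eqxx ?mulr1 //;
    exact: (fespace_L2 (T := T)).
by move=> F v Vv; apply: (op_calculusE mO fespace_finite).
Qed.

End discrete_laplacian.

(** * Hoelder bounds and smoothing *)

Section trigonometric_increments.
Variable R : realType.
Implicit Types x y a b mu g : R.

Lemma dist_le_of_derive (f f' : R -> R) :
  (forall x, is_derive x (1 : R) (f : R -> R^o) (f' x)) -> (forall x, `|f' x| <= 1) ->
  forall x y, `|f x - f y| <= `|x - y|.
Proof.
move=> ff' f'1; suff xy x y : x < y -> `|f x - f y| <= `|x - y|.
  by move=> x y; have [/xy//|/xy|->] := ltgtP x y; rewrite ?subrr // distrC (distrC y).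
move=> xy; have cf : {within `[x, y], continuous f}.
  apply: continuous_subspaceT => z; apply: differentiable_continuous.
  by apply/derivable1_diffP; have [] := ff' z.
have [c _ fyx] := MVT xy (fun z _ => ff' z) cf.
by rewrite distrC fyx normrM (distrC x) ler_piMl.
Qed.

Lemma dist_cos x y : `|cos x - cos y| <= `|x - y|.
Proof.
apply: (@dist_le_of_derive cos (fun z => - sin z)) => z.
by rewrite normrN ler_norml sin_geN1 sin_le1.
Qed.

Lemma dist_sin x y : `|sin x - sin y| <= `|x - y|.
Proof.
by apply: (@dist_le_of_derive sin cos) => z; rewrite ler_norml cos_geN1 cos_le1.
Qed.

Lemma powR_sqr x g : x `^ (2 * g) = (x `^ g) ^+ 2.
Proof. by rewrite (mulrC 2) powRrM powR_mulrn ?powR_ge0. Qed.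

(** Interpolation: with $x=|a-b|\mu$ the difference is at most $\min(x,2)$, and $\min(x,2)\le2x^g$
    because $x\le x^g$ for $x\le1$ and $1\le x^g$ for $x\ge1$. Squaring gives the constant 4. *)
Lemma hoelder_of_dist (f : R -> R) a b mu g : 0 <= g <= 1 -> 0 <= mu ->
  (forall x, `|f x| <= 1) -> (forall x y, `|f x - f y| <= `|x - y|) ->
  (f (a * mu) - f (b * mu)) ^+ 2 <= 4 * `|a - b| `^ (2 * g) * (mu `^ g) ^+ 2.
Proof.
move=> /andP[g0 g1] mu0 f1 fd.
have -> : 4 * `|a - b| `^ (2 * g) * (mu `^ g) ^+ 2 = (2 * (`|a - b| * mu) `^ g) ^+ 2.
  by rewrite powRM // powR_sqr; ring.
rewrite -[leLHS]real_normK ?num_real // ler_pXn2r ?nnegrE ?mulr_ge0 ?powR_ge0 //.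
have abE : `|a * mu - b * mu| = `|a - b| * mu by rewrite -mulrBl normrM (ger0_norm mu0).
have ab0 : 0 <= `|a - b| * mu by exact: mulr_ge0.
have [le1|gt1] := leP (`|a - b| * mu) 1.
  apply: (le_trans (fd _ _)); rewrite abE.
  have [->|ne0] := eqVneq (`|a - b| * mu) 0; first by rewrite mulr_ge0 ?powR_ge0.
  have : `|a - b| * mu <= (`|a - b| * mu) `^ g.
    rewrite -[leLHS]powRr1 //; apply: ger_powR => //.
    by rewrite lt0r ne0 ab0.
  have := powR_ge0 (`|a - b| * mu) g; lra.
have : 1 <= (`|a - b| * mu) `^ g.
  by rewrite -[leLHS](congr1 (fun f => f g) (powR1 R)); apply: ge0_ler_powR;
     rewrite ?nnegrE // ltW.
have := le_trans (ler_normB (f (a * mu)) (f (b * mu))) (lerD (f1 _) (f1 _)); lra.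
Qed.

Lemma hoelder_cos a b mu g : 0 <= g <= 1 -> 0 <= mu ->
  (cos (a * mu) - cos (b * mu)) ^+ 2 <= 4 * `|a - b| `^ (2 * g) * (mu `^ g) ^+ 2.
Proof.
move=> g01 mu0; apply: hoelder_of_dist => // [x|x y]; last exact: dist_cos.
by rewrite ler_norml cos_geN1 cos_le1.
Qed.

Lemma hoelder_sin a b mu g : 0 <= g <= 1 -> 0 <= mu ->
  (sin (a * mu) - sin (b * mu)) ^+ 2 <= 4 * `|a - b| `^ (2 * g) * (mu `^ g) ^+ 2.
Proof.
move=> g01 mu0; apply: hoelder_of_dist => // [x|x y]; last exact: dist_sin.
by rewrite ler_norml sin_geN1 sin_le1.
Qed.

End trigonometric_increments.

Section smoothing.
Variables (R : realType) (d : nat) (O : set 'rV[R]_d) (mO : measurable O).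
Notation fn := ('rV[R]_d -> R).
Variables (lam : nat -> R) (phi : nat -> fn) (A_eigen : eigenpairs O lam phi).
Variables (J : finType) (ev : J -> fn -> R).
Hypothesis ev_lin : forall j a v w, ev j (a *: v + w) = a * ev j v + ev j w.
Variables (V : set fn) (fV : finite_subspace O ev V) (A : fn -> fn).
Variables (N : nat) (e : 'I_N -> fn) (mu : 'I_N -> R).
Hypotheses (Ve : forall i, V (e i)) (mu0 : forall i, 0 <= mu i).
Hypothesis oe : forall i j, inner O (e i) (e j) = (i == j)%:R.
Hypothesis spane : forall v, V v -> v = \sum_i inner O v (e i) *: e i.
Hypothesis opE : forall F v, V v ->
  op_calculus V A F v = \sum_i (F (mu i) * inner O v (e i)) *: e i.

Let VL v : V v -> L2 O v. Proof. by case: fV => _ _ + _ _; apply. Qed.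
Let Le i : L2 O (e i). Proof. exact/VL/Ve. Qed.

Lemma norm_sqr_span v : V v -> norm O v ^+ 2 = \sum_i inner O v (e i) ^+ 2.
Proof. by move=> Vv; rewrite {1}(spane Vv) (norm_sqr_orthonormal mO). Qed.

Lemma op_calculus_in F v : V v -> V (op_calculus V A F v).
Proof. by move=> Vv; rewrite opE //; apply: (subspace_sum _ _ fV). Qed.

Lemma inner_op_calculus F v i : V v ->
  inner O (op_calculus V A F v) (e i) = F (mu i) * inner O v (e i).
Proof.
move=> Vv; rewrite opE //.
exact: (@inner_orthonormal _ _ _ mO _ e Le oe predT).
Qed.

Lemma op_calculus_ext v w : V v -> V w ->
  (forall i, inner O v (e i) = inner O w (e i)) -> v = w.
Proof. by move=> Vv Vw vw; rewrite (spane Vv) (spane Vw); apply: eq_bigr => i _; rewrite vw. Qed.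

(** The vector is $A^g$ applied to the truncation of [w], and $A^{-g}$ undoes this: the partial sums
    that define $\mathcal P_hA^{-g}$ are constant from index [n] on and equal to the inner product
    of the truncation with $\psi$. *)
Lemma proj_pow_trunc g w n : L2 O w ->
  proj_pow O lam phi V (- g) (\sum_(j < n) (lam j `^ g * inner O w (phi j)) *: phi j)
    (L2proj O V (trunc O phi w n)).
Proof.
move=> Lw; have Lphi := L2_phi A_eigen.
have Lt := L2_trunc mO A_eigen w n.
have [Vp hp] := L2projP mO ev_lin fV Lt.
split => // psi Vpsi; rewrite hp //.
apply: cvg_near_cst; exists n => // m /= nm.
rewrite /trunc inner_suml //; [|by move=> j _; exact: L2Z|exact: VL].
rewrite [RHS](big_ord_widen m (fun j => inner O (inner O w (phi j) *: phi j) psi)) //.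
rewrite [RHS]big_mkcond /=; apply: eq_bigr => j _.
have vj : inner O (\sum_(j < n) (lam j `^ g * inner O w (phi j)) *: phi j) (phi j) =
    if (j < n)%N then lam j `^ g * inner O w (phi j) else 0.
  case: ifPn => jn.
    exact: (@inner_orthonormal _ _ _ mO _ (fun i : 'I_n => phi i) (fun i => Lphi i)
      (@inner_phi_ord _ _ _ _ _ A_eigen n) predT
      (fun i : 'I_n => lam i `^ g * inner O w (phi i)) (Ordinal jn)).
  rewrite inner_suml //; last by move=> i _; exact: L2Z.
  rewrite big1 // => i _; rewrite innerZl // (inner_phi A_eigen).
  rewrite [_ == _]negbTE ?mulr0 //; by apply: contraNneq jn => <-.
rewrite vj; case: ifP => _; last by rewrite mulr0 mul0r.
rewrite innerZl //; last exact: VL.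
by rewrite mulrA -powRD ?addNr ?powRr0 ?mul1r // (gt_eqF (lam_gt0 A_eigen j)) implybT.
Qed.

Lemma norm_sqr_pow_trunc g w n :
  norm O (\sum_(j < n) (lam j `^ g * inner O w (phi j)) *: phi j) ^+ 2 =
  \sum_(j < n) lam j `^ (2 * g) * inner O w (phi j) ^+ 2.
Proof.
have Lphi := L2_phi A_eigen.
rewrite (@norm_sqr_orthonormal _ _ _ mO _ (fun i : 'I_n => phi i) (fun i => Lphi i)
      (@inner_phi_ord _ _ _ _ _ A_eigen n)).
by apply: eq_bigr => j _; rewrite exprMn powR_sqr.
Qed.

(** The left-hand side is $\|A_h^g\mathcal P_hw\|^2$. The norm bound wants $A^gw$ in $L^2$, which
    fails when [dotnorm_sq] is infinite; so it is applied to the truncations of [w], whose norms are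
    partial sums of that series, and the finitely many coefficients on the left then converge. *)
Lemma smoothing_le (g C : R) w : L2 O w ->
  (forall v z, L2 O v -> proj_pow O lam phi V (- g) v z ->
     norm O (powA V A g z) <= C * norm O v) ->
  ((\sum_i (mu i `^ g) ^+ 2 * inner O w (e i) ^+ 2)%:E <=
     (C ^+ 2)%:E * dotnorm_sq O lam phi (2 * g) w)%E.
Proof.
move=> Lw bound; have Lphi := L2_phi A_eigen.
have term0 j : (0 <= (lam j `^ (2 * g) * inner O w (phi j) ^+ 2)%:E)%E.
  by rewrite lee_fin mulr_ge0 ?powR_ge0 ?sqr_ge0.
have trunc_le n : ((\sum_i (mu i `^ g) ^+ 2 * inner O (trunc O phi w n) (e i) ^+ 2)%:E <=
     (C ^+ 2)%:E * dotnorm_sq O lam phi (2 * g) w)%E.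
  have Lt := L2_trunc mO A_eigen w n.
  have [Vp hp] := L2projP mO ev_lin fV Lt.
  have Lv : L2 O (\sum_(j < n) (lam j `^ g * inner O w (phi j)) *: phi j).
    by apply: L2_sum => // j _; exact: L2Z.
  have := bound _ _ Lv (proj_pow_trunc g n Lw) => h.
  (* The sign of [C] is unknown; squaring the bound only asks that the whole product [C * norm O v]
     be nonnegative. *)
  have nC := le_trans (norm_ge0 O _) h.
  apply: (@le_trans _ _ ((C ^+ 2)%:E *
      (\sum_(j < n) lam j `^ (2 * g) * inner O w (phi j) ^+ 2)%:E)%E); last first.
    apply: lee_wpmul2l; first by rewrite lee_fin sqr_ge0.
    by have := @nneseries_lim_ge R _ predT 0%N n (fun j _ _ => term0 j);
       rewrite big_mkord sumEFin.
  rewrite -norm_sqr_pow_trunc -EFinM lee_fin -exprMn.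
  apply: le_trans (_ : norm O (powA V A g (L2proj O V (trunc O phi w n))) ^+ 2 <= _); last first.
    by rewrite ler_pXn2r ?nnegrE ?norm_ge0.
  rewrite norm_sqr_span; last exact: op_calculus_in.
  rewrite le_eqVlt; apply/orP; left; apply/eqP; apply: eq_bigr => i _.
  by rewrite inner_op_calculus // hp // exprMn.
have lim : (\sum_i (mu i `^ g) ^+ 2 * inner O (trunc O phi w n) (e i) ^+ 2) @[n --> \oo] -->
    \sum_i (mu i `^ g) ^+ 2 * inner O w (e i) ^+ 2.
  apply: (cvg_bigsum _ (f := fun i n => (mu i `^ g) ^+ 2 * inner O (trunc O phi w n) (e i) ^+ 2)).
  move=> i; have ci : inner O (trunc O phi w n) (e i) @[n --> \oo] --> inner O w (e i).
    by apply: (cvg_inner mO (fun n => L2_trunc mO A_eigen w n) Lw (Le i));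
      exact: (cvg_trunc mO A_eigen).
  exact: (cvgM (cvg_cst _) (cvgM ci ci)).
move: trunc_le; case: (_ * _)%E => [r||] trunc_le.
- rewrite lee_fin; apply: (ler_cvg_to lim (cvg_cst r)).
  by apply: nearW => n; rewrite -lee_fin.
- exact: leey.
- by have := trunc_le 0%N; rewrite leeNy_eq.
Qed.

End smoothing.

(** * Gaussian laws and the covariance of a Wiener process *)

Section density.
Context d (T : measurableType d) (R : realType).
Variables (mu nu : {measure set T -> \bar R}) (g : T -> R).
Hypotheses (mg : measurable_fun setT g) (g0 : forall x, 0 <= g x).
Hypothesis nuE : forall B, measurable B -> nu B = (\int[mu]_(x in B) (g x)%:E)%E.
Import HBNNSimple.
Local Open Scope ereal_scope.

Let nnsfun_density (f : {nnsfun T >-> R}) :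
  \int[nu]_x (f x)%:E = \int[mu]_x ((f x)%:E * (g x)%:E).
Proof.
under [LHS]eq_integral do rewrite fimfunE -fsumEFin//.
rewrite [LHS]ge0_integral_fsum//; last 2 first.
- by move=> r; exact/measurable_EFinP/measurableT_comp.
- by move=> n x _; rewrite EFinM nnfun_muleindic_ge0.
under [RHS]eq_integral.
  move=> x xD; rewrite fimfunE -fsumEFin// muleC ge0_mule_fsumr; last first.
    by move=> r; rewrite EFinM nnfun_muleindic_ge0.
  over.
rewrite [RHS]ge0_integral_fsum//; last 2 first.
- move=> r; apply: emeasurable_funM; first exact/measurable_EFinP.
  by apply/measurable_EFinP; do 2 apply/measurableT_comp => //.
- move=> n x _; apply: mule_ge0; first by rewrite lee_fin.
  by rewrite EFinM nnfun_muleindic_ge0.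
apply: eq_fsbigr => r _.
have mr : measurable (f @^-1` [set r]) by exact: measurable_funPTI.
rewrite integralZl_indic_nnsfun//=.
rewrite integral_indic// setIT nuE//.
have [r0|r0] := ltP r 0%R.
  rewrite (_ : f @^-1` [set r] = set0); last exact: preimage_nnfun0.
  rewrite integral_set0 mule0 integral0_eq// => x _.
  by rewrite indic0 mulr0 mule0.
rewrite integral_mkcond -ge0_integralZl//; last 2 first.
- apply/(measurable_restrictT _ _).1 => //.
  by apply/measurable_EFinP; exact: measurable_funTS.
- by move=> x _; rewrite patchE; case: ifP => // _; rewrite lee_fin.
apply: eq_integral => x _; rewrite patchE indicE; case: ifPn => _.
  by rewrite mulr1 muleC.
by rewrite mulr0 !mule0.
Qed.

(** Monotone convergence from simple functions. It converts an integral against [normal_prob], which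
    is given by its values on sets, into a Lebesgue integral with the density. *)
Lemma ge0_integral_density (f : T -> \bar R) :
  measurable_fun setT f -> (forall x, 0 <= f x) ->
  \int[nu]_x f x = \int[mu]_x (f x * (g x)%:E).
Proof.
move=> mf f0; pose f_ := nnsfun_approx measurableT mf.
have mgE : measurable_fun setT (fun x => (g x)%:E) by exact/measurable_EFinP.
transitivity (lim (\int[nu]_x (f_ n x)%:E @[n --> \oo])).
  rewrite -monotone_convergence//=.
  - apply: eq_integral => ? /[!inE] xD; apply/esym/cvg_lim => //=.
    exact: cvg_nnsfun_approx.
  - by move=> n; exact/measurable_EFinP/measurable_funTS.
  - by move=> n ? _; rewrite lee_fin.
  - by move=> ? _ ? ? mn; rewrite lee_fin; exact/lefP/nd_nnsfun_approx.
transitivity (lim (\int[mu]_x ((f_ n x)%:E * (g x)%:E) @[n --> \oo])).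
  by apply: congr_lim; apply/funext => n /=; exact: nnsfun_density.
rewrite -monotone_convergence//=.
- apply: eq_integral => x /[!inE] xD; apply/cvg_lim => //=.
  by apply: cvgeZr => //; exact: cvg_nnsfun_approx.
- by move=> n; apply: emeasurable_funM => //; exact/measurable_EFinP/measurable_funTS.
- by move=> n x _; rewrite mule_ge0 // lee_fin.
- move=> x _ m n mn; rewrite lee_wpmul2r ?lee_fin //.
  exact/lefP/nd_nnsfun_approx.
Qed.

End density.

Section gaussian.
Variable R : realType.
Notation mu := (@lebesgue_measure R).

(* Its value is 1; only its finiteness is used. *)
Definition gaussian_second_moment : R :=
  fine (\int[mu]_x (x ^+ 2 * normal_pdf 0 1 x)%:E)%E.

Lemma normal_pdf01E (s x : R) : 0 < s ->
  normal_pdf 0 s x = s^-1 * normal_pdf 0 1 (x / s).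
Proof.
move=> s0; rewrite !normal_pdfE ?gt_eqF // /normal_peak /normal_fun !subr0.
have s2 : Num.sqrt (s ^+ 2 * pi *+ 2) = s * Num.sqrt (1 ^+ 2 * pi *+ 2).
  rewrite expr1n mul1r -mulrnAr sqrtrM ?sqr_ge0 // sqrtr_sqr gtr0_norm //.
rewrite s2 invfM mulrA; congr (_ * _); congr (expR _).
by field; rewrite gt_eqF.
Qed.

Lemma measurable_sqr_normal (s : R) :
  measurable_fun setT (fun x : R => (x ^+ 2 * normal_pdf 0 s x)%:E).
Proof.
apply/measurable_EFinP; apply: measurable_funM; first exact: measurable_funX.
exact: measurable_normal_pdf.
Qed.

(** Domination by the density of $N(0,2)$:
    $x^2e^{-x^2/2}=(x^2e^{-x^2/4})\,e^{-x^2/4}\le4e^{-x^2/4}$, because $x^2/4\le e^{x^2/4}$. [K] is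
    4 times the ratio of the two normalising factors. *)
Lemma gaussian_second_moment_lty :
  (\int[mu]_x (x ^+ 2 * normal_pdf 0 1 x)%:E < +oo)%E.
Proof.
pose s := Num.sqrt 2 : R.
have s2 : s ^+ 2 = 2 by rewrite sqr_sqrtr.
have s0 : 0 < s by rewrite sqrtr_gt0.
pose K := 4 * normal_peak 1 / normal_peak s : R.
have pk1 : 0 < normal_peak (1 : R) by exact: normal_peak_gt0.
have pks : 0 < normal_peak s by apply: normal_peak_gt0; rewrite gt_eqF.
have K0 : 0 <= K by rewrite !mulr_ge0 ?invr_ge0 // ltW.
apply: (@le_lt_trans _ _ (\int[mu]_x (K%:E * (normal_pdf 0 s x)%:E))%E).
  apply: ge0_le_integral => //.
  - by move=> x _; rewrite lee_fin mulr_ge0 ?sqr_ge0 ?normal_pdf_ge0.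
  - exact: measurable_sqr_normal.
  - apply: emeasurable_funM => //; apply/measurable_EFinP; exact: measurable_normal_pdf.
  move=> x _; rewrite -EFinM lee_fin !normal_pdfE ?gt_eqF // /normal_fun !subr0 s2.
  have -> : K * (normal_peak s * expR (- x ^+ 2 / (2 *+ 2))) =
      4 * (normal_peak 1 * expR (- x ^+ 2 / (2 *+ 2))).
    by rewrite /K; field; rewrite gt_eqF.
  have -> : expR (- x ^+ 2 / (1 ^+ 2 *+ 2)) =
      expR (- x ^+ 2 / (2 *+ 2)) * expR (- x ^+ 2 / (2 *+ 2)).
    by rewrite -expRD; congr expR; field.
  set E := expR _.
  have -> : x ^+ 2 * (normal_peak 1 * (E * E)) = (x ^+ 2 * E) * (normal_peak 1 * E) by ring.
  rewrite ler_wpM2r ?mulr_ge0 ?expR_ge0 ?(ltW pk1) //.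
  have -> : E = (expR (x ^+ 2 / 4))^-1.
    by rewrite -expRN; congr expR; field.
  rewrite ler_pdivrMr ?expR_gt0 //.
  have := expR_ge1Dx (x ^+ 2 / 4); lra.
rewrite ge0_integralZl_EFin //; last 2 first.
- by move=> x _; rewrite lee_fin normal_pdf_ge0.
- by apply/measurable_EFinP; exact: measurable_normal_pdf.
by rewrite integral_normal_pdf mule1 ltry.
Qed.

(** The substitution $x\mapsto x/s$ reduces every standard deviation to the one constant. *)
Lemma integral_sqr_normal_pdf (s : R) : 0 < s ->
  (\int[mu]_x (x ^+ 2 * normal_pdf 0 s x)%:E = (gaussian_second_moment * s ^+ 2)%:E)%E.
Proof.
move=> s0; have sn0 : s != 0 by rewrite gt_eqF.
have i0 : (0 <= \int[mu]_x (x ^+ 2 * normal_pdf 0 1 x)%:E)%E.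
  by apply: integral_ge0 => x _; rewrite lee_fin mulr_ge0 ?sqr_ge0 ?normal_pdf_ge0.
rewrite EFinM fineK; last by rewrite ge0_fin_numE // gaussian_second_moment_lty.
pose F (x : R^o) : R^o := x / s.
have F'E : F^`()%classic = cst s^-1.
  apply/funext => x; rewrite /F derive1E deriveM// derive_cst scaler0.
  by rewrite add0r derive_id scaler1.
pose G (y : R) := y ^+ 2 * normal_pdf 0 1 y.
have -> : (\int[mu]_x (x ^+ 2 * normal_pdf 0 1 x)%:E =
    \int[mu]_x (((G \o F) * F^`()%classic) x)%:E)%E.
  apply: (@increasing_ge0_integration_by_substitutionT R F G) => //.
  - by move=> x y xy; rewrite /F ltr_pM2r ?invr_gt0.
  - by rewrite F'E => ?; exact: cvg_cst.
  - by rewrite F'E; exact: is_cvg_cst.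
  - by rewrite F'E; exact: is_cvg_cst.
  - by apply/gt0_cvgMlNy; [rewrite invr_gt0|exact: cvg_id].
  - by apply/gt0_cvgMly; [rewrite invr_gt0|exact: cvg_id].
  - move=> x; apply: cvgM; first exact: sqr_continuous.
    by apply: continuous_normal_pdf; rewrite oner_eq0.
  - by move=> x; rewrite mulr_ge0 ?sqr_ge0 ?normal_pdf_ge0.
rewrite muleC -ge0_integralZl_EFin //; last 3 first.
- move=> x _; rewrite lee_fin F'E !fctE /G /F /= mulr_ge0 ?invr_ge0 ?(ltW s0) //.
  by rewrite mulr_ge0 ?sqr_ge0 ?normal_pdf_ge0.
- apply: (eq_measurable_fun (fun x : R => (s^-1 ^+ 2)%:E * (x ^+ 2 * normal_pdf 0 s x)%:E)%E).
    move=> x _; rewrite -EFinM F'E !fctE /G /F /= normal_pdf01E //; congr (_%:E).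
    by field.
  by apply: emeasurable_funM => //; exact: measurable_sqr_normal.
- exact: sqr_ge0.
apply: eq_integral => x _; rewrite -EFinM F'E !fctE /G /F /= normal_pdf01E //.
by congr (_%:E); field.
Qed.

End gaussian.

Section laws.
Context d (T : measurableType d) (R : realType) (P : probability T R).
Local Open Scope ereal_scope.

Lemma ge0_integral_law d' (T' : measurableType d') (X : T -> T')
    (nu : {measure set T' -> \bar R}) (f : T' -> \bar R) :
  measurable_fun setT X ->
  (forall B, measurable B -> P (X @^-1` B) = nu B) ->
  measurable_fun setT f -> (forall y, 0 <= f y) ->
  \int[P]_x f (X x) = \int[nu]_y f y.
Proof.
move=> mX law mf f0.
pose Xm := isMeasurableFun.Build _ _ _ _ _ mX.
pose Xr : {mfun T >-> T'} := HB.pack X Xm.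
rewrite -[LHS](@ge0_integral_distribution _ _ _ _ _ P Xr) //.
by apply: eq_measure_integral => B mB _; rewrite -law.
Qed.

Lemma integral_law d' (T' : measurableType d') (X : T -> T')
    (nu : {measure set T' -> \bar R}) (f : T' -> \bar R) :
  measurable_fun setT X ->
  (forall B, measurable B -> P (X @^-1` B) = nu B) ->
  measurable_fun setT f -> P.-integrable setT (f \o X) ->
  nu.-integrable setT f /\ \int[P]_x f (X x) = \int[nu]_y f y.
Proof.
move=> mX law mf intf; split.
  apply/integrableP; split => //; have /integrableP[_] := intf.
  by rewrite (@ge0_integral_law _ _ X nu (fun y => `|f y|)) //;
     exact: measurableT_comp.
pose Xm := isMeasurableFun.Build _ _ _ _ _ mX.
pose Xr : {mfun T >-> T'} := HB.pack X Xm.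
rewrite -[LHS](@integral_distribution _ _ _ _ _ P Xr) //.
by apply: eq_measure_integral => B mB _; rewrite -law.
Qed.

Lemma integral_sqr_centered_gaussian (X : T -> R) (s2 : R) : (0 <= s2)%R ->
  measurable_fun setT X ->
  (forall B, measurable B -> P (X @^-1` B) = centered_gaussian s2 B) ->
  \int[P]_x (X x ^+ 2)%:E = (gaussian_second_moment R * s2)%:E.
Proof.
move=> s20 mX law.
have mf : measurable_fun [set: R] (fun y : R => (y ^+ 2)%:E).
  by apply/measurable_EFinP; exact: measurable_funX.
have f0 (y : R) : 0 <= (y ^+ 2)%:E by rewrite lee_fin sqr_ge0.
have [s2E|s2n0] := eqVneq s2 0%R.
  rewrite (@ge0_integral_law _ _ X (\d_(0%R : R)) (fun y : R => (y ^+ 2)%:E)) //.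
    by rewrite integral_dirac // diracT mul1e expr0n s2E mulr0.
  by move=> B mB; rewrite law // /centered_gaussian s2E eqxx.
have s0 : (0 < Num.sqrt s2)%R by rewrite sqrtr_gt0 lt0r s2n0.
rewrite (@ge0_integral_law _ (measurableTypeR R) X (normal_prob 0 (Num.sqrt s2))
    (fun y : R => (y ^+ 2)%:E)) //.
  rewrite (@ge0_integral_density _ _ _ lebesgue_measure _ (normal_pdf 0 (Num.sqrt s2))) //.
  - by under eq_integral do rewrite -EFinM; rewrite integral_sqr_normal_pdf // sqr_sqrtr.
  - exact: measurable_normal_pdf.
  - by move=> x; exact: normal_pdf_ge0.
by move=> B mB; rewrite law // /centered_gaussian (negbTE s2n0).
Qed.

(** The product rule on rectangles identifies the law of the pair with the product of the marginal
    laws, by uniqueness of the product measure; Fubini then separates the variables. *)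
Lemma integral_independentM (X Y : T -> R) :
  measurable_fun setT X -> measurable_fun setT Y ->
  P.-integrable setT (EFin \o X) -> P.-integrable setT (EFin \o Y) ->
  P.-integrable setT (fun x => (X x * Y x)%:E) ->
  (forall A B : set R, measurable A -> measurable B ->
     P (X @^-1` A `&` Y @^-1` B) = P (X @^-1` A) * P (Y @^-1` B)) ->
  \int[P]_x (X x * Y x)%:E = (\int[P]_x (X x)%:E) * (\int[P]_x (Y x)%:E).
Proof.
move=> mX mY iX iY iXY indep.
pose Xr : {mfun T >-> R} := HB.pack X (isMeasurableFun.Build _ _ _ _ _ mX).
pose Yr : {mfun T >-> R} := HB.pack Y (isMeasurableFun.Build _ _ _ _ _ mY).
have mZ : measurable_fun setT (fun x => (X x, Y x)) by exact: measurable_fun_pair.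
pose m1 := distribution P Xr; pose m2 := distribution P Yr.
have law C : measurable C -> P ((fun x => (X x, Y x)) @^-1` C) = (m1 \x m2) C.
  move=> mC; pose Zr : {mfun T >-> _} := HB.pack (fun x => (X x, Y x))
    (isMeasurableFun.Build _ _ _ _ _ mZ).
  apply/esym.
  apply: (@product_measure_unique _ _ _ _ _ m1 m2 (distribution P Zr)) => //.
have mf : measurable_fun setT (fun z : R * R => (z.1 * z.2)%:E).
  by apply/measurable_EFinP; apply: measurable_funM.
have [im ->] := integral_law mZ law mf iXY.
rewrite -integral12_prod_meas1 //.
have iX1 : m1.-integrable setT (EFin : R -> \bar R).
  by have [] := @integral_law _ _ X m1 EFin mX (fun B mB => erefl) (@EFin_measurable _ _) iX.
have iY1 : m2.-integrable setT (EFin : R -> \bar R).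
  by have [] := @integral_law _ _ Y m2 EFin mY (fun B mB => erefl) (@EFin_measurable _ _) iY.
have -> : \int[P]_x (X x)%:E = \int[m1]_y y%:E.
  by have [] := @integral_law _ _ X m1 EFin mX (fun B mB => erefl) (@EFin_measurable _ _) iX.
have -> : \int[P]_x (Y x)%:E = \int[m2]_y y%:E.
  by have [] := @integral_law _ _ Y m2 EFin mY (fun B mB => erefl) (@EFin_measurable _ _) iY.
rewrite -(fineK (integrable_fin_num measurableT iY1)) -integralZr //.
apply: eq_integral => x _; rewrite fineK ?(integrable_fin_num measurableT iY1) //.
rewrite -integralZl //.
Qed.

End laws.

Section bounded_operators.
Variables (R : realType) (d : nat) (O : set 'rV[R]_d) (mO : measurable O).
Notation fn := ('rV[R]_d -> R).

Lemma inner_bounded_operator (B : fn -> fn) a v w u : bounded_operator O (L2 O) B ->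
  L2 O v -> L2 O w -> L2 O u ->
  inner O (B (a *: v + w)) u = a * inner O (B v) u + inner O (B w) u.
Proof.
move=> [BL Blin _] Lv Lw Lu; have LBv := BL _ Lv; have LBw := BL _ Lw.
rewrite -inner_lin //; apply: eqL2_inner => //; [|exact: L2_lin|exact: Blin].
by apply: BL; exact: L2_lin.
Qed.

Lemma inner_sqrt_operator (Q S : fn -> fn) v w : is_sqrt_operator O Q S ->
  positive_operator O Q -> L2 O v -> L2 O w ->
  inner O (Q v) w = inner O (S v) (S w).
Proof.
move=> [[[SL _ _] Ssym _] SQ] [[QL _ _] _ _] Lv Lw.
rewrite -Ssym //; last exact: SL.
by apply/esym/(eqL2_inner mO) => //; [exact/SL/SL|exact: QL|exact: SQ].
Qed.

End bounded_operators.

Section Wiener_covariance.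
Variables (R : realType) (d : nat) (O : set 'rV[R]_d) (mO : measurable O).
Notation fn := ('rV[R]_d -> R).
Variables (dd : measure_display) (Om : measurableType dd) (P : probability Om R).
Variables (Ft : R -> set (set Om)) (Q : fn -> fn) (W : R -> Om -> fn).
Hypotheses (Ft_usual : usual_filtration P Ft) (Q_pos : positive_operator O Q).
Hypothesis W_Wiener : Wiener P O Ft Q W.

Notation c2 := (gaussian_second_moment R).

Lemma Wiener_L2 t omega : 0 <= t -> L2 O (W t omega).
Proof. by move=> t0; have [_ /(_ _ t0)[]] := W_Wiener. Qed.

(** Increments are the quantities whose law is prescribed. [Wiener_incr 0 t v] stands for
    $(W(t),v)$, from which it may differ on a null set, as $W(0)=0$ only almost surely. *)
Definition Wiener_incr (s t : R) (v : fn) (omega : Om) : R :=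
  inner O (W t omega - W s omega) v.

Lemma Wiener_incrE s t v omega : 0 <= s -> 0 <= t -> L2 O v ->
  Wiener_incr s t v omega = inner O (W t omega) v - inner O (W s omega) v.
Proof. by move=> s0 t0 Lv; rewrite /Wiener_incr innerBl //; exact: Wiener_L2. Qed.

Lemma Wiener_incr_lin s t a v w omega : 0 <= s -> 0 <= t -> L2 O v -> L2 O w ->
  Wiener_incr s t (a *: v + w) omega = a * Wiener_incr s t v omega + Wiener_incr s t w omega.
Proof.
move=> s0 t0 Lv Lw; rewrite /Wiener_incr.
have LW : L2 O (W t omega - W s omega) by apply: L2B => //; exact: Wiener_L2.
by rewrite !(innerC O (_ - _)) inner_lin.
Qed.

Lemma Wiener_incr_Ft s v (B : set R) : 0 <= s -> L2 O v -> measurable B ->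
  Ft s (Wiener_incr 0 s v @^-1` B).
Proof.
move=> s0 Lv mB; have [Fsig Fmon _ _] := Ft_usual.
have [sF _] := Fsig _ s0.
have [_ WF _ _ _] := W_Wiener.
(* [Ft s] becomes the sigma-algebra of a measurable type, so that the closure of measurable
   functions under differences applies to it. *)
have measE : @measurable _ (g_sigma_algebraType (Ft s)) = Ft s.
  exact: sigma_algebra_id.
have mW r : 0 <= r -> r <= s -> measurable_fun setT
    ((fun omega => inner O (W r omega) v) : g_sigma_algebraType (Ft s) -> R).
  move=> r0 rs _ C mC; rewrite setTI measE; apply: (Fmon _ _ r0 rs).
  by have [_] := WF _ r0; apply.
have : measurable_fun setT ((fun omega => inner O (W s omega) v - inner O (W 0 omega) v)
    : g_sigma_algebraType (Ft s) -> R).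
  by apply: measurable_funB; exact: mW.
move=> /(_ measurableT _ mB); rewrite setTI measE.
by rewrite (_ : Wiener_incr 0 s v = fun omega => inner O (W s omega) v - inner O (W 0 omega) v)
  //; apply/funext => omega; rewrite Wiener_incrE.
Qed.

Lemma measurable_Wiener t v : 0 <= t -> L2 O v ->
  measurable_fun setT (fun omega => inner O (W t omega) v).
Proof.
move=> t0 Lv _ B mB; rewrite setTI; have [Fsig _ _ _] := Ft_usual.
have [_ WF _ _ _] := W_Wiener.
by have [_] := Fsig _ t0; apply; have [_] := WF _ t0; apply.
Qed.

Lemma measurable_Wiener_incr s t v : 0 <= s -> 0 <= t -> L2 O v ->
  measurable_fun setT (Wiener_incr s t v).
Proof.
move=> s0 t0 Lv.
rewrite (_ : Wiener_incr s t v = fun omega => inner O (W t omega) v - inner O (W s omega) v).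
  by apply: measurable_funB; exact: measurable_Wiener.
by apply/funext => omega; rewrite Wiener_incrE.
Qed.

Lemma integral_sqr_Wiener_incr s t v : 0 <= s -> s <= t -> L2 O v ->
  (\int[P]_omega (Wiener_incr s t v omega ^+ 2)%:E =
    (c2 * ((t - s) * inner O (Q v) v))%:E)%E.
Proof.
move=> s0 st Lv; have t0 := le_trans s0 st.
apply: integral_sqr_centered_gaussian.
- by rewrite mulr_ge0 ?subr_ge0 //; case: Q_pos => _ _; apply.
- exact: measurable_Wiener_incr.
- by move=> B mB; have [_ _ WG _ _] := W_Wiener; exact: WG.
Qed.

Lemma sqint_Wiener_incr s t v : 0 <= s -> s <= t -> L2 O v ->
  sqint P setT (Wiener_incr s t v).
Proof.
move=> s0 st Lv; split.
  by apply: measurable_Wiener_incr => //; exact: le_trans st.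
by rewrite integral_sqr_Wiener_incr // ltry.
Qed.

Lemma sqint_integrable (f : Om -> R) : sqint P setT f -> P.-integrable setT (EFin \o f).
Proof.
move=> sf; have s1 : sqint P setT (cst 1 : Om -> R).
  split; first exact: measurable_cst.
  by under eq_integral do rewrite expr1n; rewrite integral_cst // mul1e
    (le_lt_trans (probability_le1 P measurableT)) ?ltry.
have := sqint_integrableM measurableT sf s1.
by apply: eq_integrable => // x _; rewrite /= mulr1.
Qed.

(** By symmetry: the law depends on [v] only through $(Qv,v)$, so the increments along $v$ and $-v$
    have the same law, and the mean equals its opposite. *)
Lemma integral_Wiener_incr s t v : 0 <= s -> s <= t -> L2 O v ->
  (\int[P]_omega (Wiener_incr s t v omega)%:E = 0)%E.
Proof.
move=> s0 st Lv; have t0 := le_trans s0 st.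
have mX := measurable_Wiener_incr s0 t0 Lv.
have iX := sqint_integrable (sqint_Wiener_incr s0 st Lv).
have [_ _ WG _ _] := W_Wiener.
have NE omega : Wiener_incr s t (- v) omega = - Wiener_incr s t v omega.
  by rewrite /Wiener_incr innerNr //; apply: L2B => //; exact: Wiener_L2.
pose X := Wiener_incr s t v.
pose Xr : {mfun Om >-> R} := HB.pack X (isMeasurableFun.Build _ _ _ _ _ mX).
have lawN B : measurable B -> P ((fun omega => - X omega) @^-1` B) = distribution P Xr B.
  move=> mB; have LNv := L2N mO Lv.
  rewrite (_ : (fun omega => - X omega) = Wiener_incr s t (- v)); last first.
    by apply/funext => omega; rewrite NE.
  apply: (etrans (WG s t (- v) s0 st LNv B mB)).
  apply/esym; apply: (etrans (WG s t v s0 st Lv B mB)).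
  congr (centered_gaussian (_ * _) B).
  have [Qb Qsym _] := Q_pos; have [QL _ _] := Qb.
  rewrite innerNr //; last exact: QL.
  by rewrite (Qsym (- v) v) // innerNl ?opprK ?Qsym //; exact: QL.
have iNX : P.-integrable setT ((EFin : R -> \bar R) \o (fun omega => - X omega)).
  have -> : (EFin : R -> \bar R) \o (fun omega => - X omega) = (-%E \o (EFin \o X))%E by [].
  exact: integrableN.
have mNX : measurable_fun setT (fun omega => - X omega) by exact: measurableT_comp.
have [_ h1] := @integral_law _ _ _ P _ _ (fun omega => - X omega) (distribution P Xr)
   EFin mNX lawN (@EFin_measurable _ _) iNX.
have [_ h2] := @integral_law _ _ _ P _ _ X (distribution P Xr)
   EFin mX (fun B mB => erefl) (@EFin_measurable _ _) iX.
have := h1; rewrite -h2.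
under eq_integral do rewrite EFinN.
have fX := integrable_fin_num measurableT iX.
rewrite integralN; last exact: integrable_add_def.
rewrite -[X in (- X)%E = X](fineK fX) -EFinN => -[] /eqP.
rewrite eq_sym -subr_eq0 opprK -mulr2n mulrn_eq0 /= => /eqP f0.
by rewrite -(fineK fX) f0.
Qed.

Lemma ip_Wiener_incr_indep s t v w : 0 <= s -> s <= t -> L2 O v -> L2 O w ->
  ip P setT (Wiener_incr 0 s v) (Wiener_incr s t w) = 0.
Proof.
move=> s0 st Lv Lw; have t0 := le_trans s0 st.
have sv := sqint_Wiener_incr (lexx 0) s0 Lv.
have sw := sqint_Wiener_incr s0 st Lw.
apply/EFin_inj; rewrite (EFin_ip measurableT sv sw).
rewrite (integral_independentM (proj1 sv) (proj1 sw) (sqint_integrable sv)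
  (sqint_integrable sw) (sqint_integrableM measurableT sv sw)); last first.
  move=> A B mA mB; have [_ _ _ Wind _] := W_Wiener.
  apply: (Wind s t) => //; first exact: Wiener_incr_Ft.
  apply: sub_sigma_algebra; exists w, B; split => //.
by rewrite (integral_Wiener_incr s0 st Lw) mule0.
Qed.

(** Polarisation of the variances along $v+w$, $v$ and $w$, with the symmetry of [Q]. *)
Lemma ip_Wiener_incr0 s v w : 0 <= s -> L2 O v -> L2 O w ->
  ip P setT (Wiener_incr 0 s v) (Wiener_incr 0 s w) = c2 * (s * inner O (Q v) w).
Proof.
move=> s0 Lv Lw; have [Qb Qsym _] := Q_pos; have [QL _ _] := Qb.
have sq u : L2 O u -> sqint P setT (Wiener_incr 0 s u).
  by move=> Lu; exact: sqint_Wiener_incr.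
have sqE u : L2 O u ->
    ip P setT (Wiener_incr 0 s u) (Wiener_incr 0 s u) = c2 * (s * inner O (Q u) u).
  move=> Lu; apply/EFin_inj; rewrite (EFin_ip measurableT (sq _ Lu) (sq _ Lu)).
  by rewrite -[s in RHS]subr0 -integral_sqr_Wiener_incr.
have Lvw : L2 O (1 *: v + w) by exact: L2_lin.
have addE : Wiener_incr 0 s (1 *: v + w) = 1 *: Wiener_incr 0 s v + Wiener_incr 0 s w.
  by apply/funext => omega; rewrite Wiener_incr_lin.
have := sqE _ Lvw; rewrite addE.
have svw := sqint_lin measurableT 1 (sq _ Lv) (sq _ Lw).
rewrite (ip_lin measurableT 1 (sq _ Lv) (sq _ Lw) svw).
have sv := sq _ Lv; have sw := sq _ Lw; have LQv := QL _ Lv; have LQw := QL _ Lw.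
rewrite !(ipC _ _ _ (1 *: _ + _)) !(ip_lin measurableT 1 sv sw) //.
rewrite inner_bounded_operator // !(innerC O (Q _) (1 *: v + w)) !inner_lin //.
rewrite (ipC _ _ (Wiener_incr 0 s w) (Wiener_incr 0 s v)).
rewrite !sqE // -!(innerC O (Q _)) (Qsym w v) // (innerC O w (Q v)).
move: (inner O (Q v) w) (inner O (Q v) v) (inner O (Q w) w) => x y z h.
have : 2 * ip P setT (Wiener_incr 0 s v) (Wiener_incr 0 s w) = 2 * (c2 * (s * x)).
  move: h; rewrite !mul1r; lra.
by move=> /mulfI; apply; rewrite pnatr_eq0.
Qed.

(** $W(t)-W(0)$ is split at time $s$: the later increment is centred and independent of the earlier
    one. *)
Lemma ip_Wiener_le s t v w : 0 <= s -> s <= t -> L2 O v -> L2 O w ->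
  ip P setT (Wiener_incr 0 s v) (Wiener_incr 0 t w) = c2 * (s * inner O (Q v) w).
Proof.
move=> s0 st Lv Lw; have t0 := le_trans s0 st.
have -> : Wiener_incr 0 t w = 1 *: Wiener_incr s t w + Wiener_incr 0 s w.
  apply/funext => omega; rewrite !fctE scale1r !Wiener_incrE //.
  by rewrite addrA subrK.
rewrite ipC (ip_lin measurableT); [|exact: sqint_Wiener_incr..].
rewrite ipC ip_Wiener_incr_indep // mulr0 add0r ipC.
exact: ip_Wiener_incr0.
Qed.

Lemma ip_Wiener s t v w : 0 <= s -> 0 <= t -> L2 O v -> L2 O w ->
  ip P setT (Wiener_incr 0 s v) (Wiener_incr 0 t w) =
  c2 * (Num.min s t * inner O (Q v) w).
Proof.
move=> s0 t0 Lv Lw; have [st|/ltW ts] := leP s t; first exact: ip_Wiener_le.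
rewrite ipC ip_Wiener_le //; have [_ Qsym _] := Q_pos.
by rewrite Qsym // innerC.
Qed.

End Wiener_covariance.

(** * The Ito inequality *)

Section integral_limits.
Context d (T : measurableType d) (R : realType) (mu : {measure set T -> \bar R}).
Variables (D : set T) (mD : measurable D).
Local Open Scope ereal_scope.

Lemma integral_lincomb (I : Type) (F : I -> T -> R) (c r : I -> R) (s : seq I) :
  (forall i, mu.-integrable D (fun x => (F i x)%:E)) ->
  (forall i, \int[mu]_(x in D) (F i x)%:E = (r i)%:E) ->
  mu.-integrable D (fun x => (\sum_(i <- s) c i * F i x)%R%:E) /\
  \int[mu]_(x in D) (\sum_(i <- s) c i * F i x)%R%:E = (\sum_(i <- s) c i * r i)%R%:E.
Proof.
move=> iF rF; elim: s => [|i s [IH1 IH2]].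
  rewrite (_ : (fun x => _) = cst 0); last by apply/funext => x; rewrite big_nil.
  by rewrite big_nil integral0; split => //; exact: integrable0.
have icF : mu.-integrable D (fun x => (c i)%:E * (F i x)%:E) by exact: integrableZl.
rewrite (_ : (fun x => _) = fun x => (c i)%:E * (F i x)%:E + (\sum_(i <- s) c i * F i x)%R%:E).
  split; first exact: integrableD.
  by rewrite integralD // IH2 integralZl // rF big_cons EFinD EFinM.
by apply/funext => x; rewrite big_cons EFinD EFinM.
Qed.

Lemma fatou_le (f : nat -> T -> \bar R) (g : T -> \bar R) (a : \bar R) (b : nat -> \bar R) :
  (forall n, measurable_fun D (f n)) -> (forall n x, D x -> 0 <= f n x) ->
  (forall x, D x -> f n x @[n --> \oo] --> g x) ->
  (forall n, \int[mu]_(x in D) f n x <= a + b n) -> b n @[n --> \oo] --> 0 -> 0 <= a ->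
  \int[mu]_(x in D) g x <= a.
Proof.
move=> mf f0 fg fab b0 a0.
have -> : \int[mu]_(x in D) g x = \int[mu]_(x in D) limn_einf (f^~ x).
  apply: eq_integral => x /[!inE] Dx; rewrite is_cvg_limn_einfE; last first.
    by apply/cvg_ex; exists (g x); exact: fg.
  by apply/esym/cvg_lim => //; exact: fg.
apply: (le_trans (fatou mu mD mf f0)); set u := fun n => _.
have ab : a + b n @[n --> \oo] --> a.
  rewrite -[X in _ --> X]adde0; apply: cvgeD => //; last exact: cvg_cst.
  by rewrite fin_num_adde_defl.
rewrite limn_einf_lim -(cvg_lim _ ab) //; apply: lee_lim.
- exact: is_cvg_einfs.
- by apply/cvg_ex; exists a.
- apply: nearW => n; apply: le_trans (fab n).
  by apply: ereal_inf_lbound; exists n => /=.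
Qed.

End integral_limits.

Section indicator.
Variable R : realType.
Notation mu := (@lebesgue_measure R).

(** The indicator of $]0,t]$, half-open like the steps of [step_eval]. The product of two of them
    integrates to $\min(s,t)$, the time covariance of the Wiener process. *)
Definition chi (t tau : R) : R := (0 < tau <= t)%R%:R.

Lemma chi_min s t tau : chi s tau * chi t tau = chi (Num.min s t) tau.
Proof. by rewrite /chi -natrM mulnb le_min andbACA andbb. Qed.

Lemma chiE (t : R) : chi t = \1_(`]0, t]%classic).
Proof. by apply/funext => tau; rewrite /chi indicE mem_setE in_itv. Qed.

Lemma measurable_chi t : measurable_fun setT (chi t).
Proof. by rewrite chiE; exact: measurable_indic. Qed.

Lemma chi_le1 t tau : chi t tau <= 1.
Proof. by rewrite /chi lern1 leq_b1. Qed.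

Lemma chi_ge0 t tau : 0 <= chi t tau.
Proof. by rewrite /chi ler0n. Qed.

Lemma chi_itv (a b tau : R) : 0 <= a -> a <= b ->
  (a < tau <= b)%R%:R = chi b tau - chi a tau.
Proof.
move=> a0 ab; rewrite /chi; have [ta|at_] := leP tau a.
  by rewrite (le_trans ta ab) /= !andbT; case: (0 < tau); rewrite subrr.
by rewrite (le_lt_trans a0 at_) /= subr0.
Qed.

Lemma integral_chi t T : 0 <= t <= T -> (\int[mu]_(tau in `[0%R, T]) (chi t tau)%:E = t%:E)%E.
Proof.
move=> /andP[t0 tT]; rewrite chiE integral_indic //.
rewrite (_ : _ `&` _ = `]0, t]%classic).
  rewrite /= lebesgue_measure_itv /= lte_fin.
  by have [_|] := ltP 0 t; [rewrite oppr0 adde0|move=> t0'; congr (_%:E);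
    apply/eqP; rewrite eq_le t0 t0'].
apply/seteqP; split => x /=; rewrite !in_itv /=; first by move=> [].
by move=> /andP[x0 xt]; rewrite x0 xt (ltW x0) (le_trans xt tT).
Qed.

Lemma integrable_chi t T : 0 <= t <= T ->
  mu.-integrable `[0%R, T] (fun tau => (chi t tau)%:E).
Proof.
move=> tT; apply/integrableP; split.
  by apply/measurable_EFinP; apply: measurable_funTS; exact: measurable_chi.
under eq_integral do rewrite gee0_abs ?lee_fin ?chi_ge0 //.
by rewrite integral_chi // ltry.
Qed.

End indicator.

Section Ito.
Variables (R : realType) (d : nat) (O : set 'rV[R]_d) (mO : measurable O).
Notation fn := ('rV[R]_d -> R).
Variables (lam : nat -> R) (phi : nat -> fn) (A_eigen : eigenpairs O lam phi).
Variables (dd : measure_display) (Om : measurableType dd) (P : probability Om R).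
Variables (Ft : R -> set (set Om)) (Q S : fn -> fn) (W : R -> Om -> fn).
Hypotheses (Ft_usual : usual_filtration P Ft) (Q_cov : covariance_operator O phi Q).
Hypotheses (S_sqrt : is_sqrt_operator O Q S) (W_Wiener : Wiener P O Ft Q W).

Notation c2 := (gaussian_second_moment R).
Notation mu := (@lebesgue_measure R).
Let Lphi := L2_phi A_eigen.
Let Q_pos : positive_operator O Q. Proof. by case: Q_cov. Qed.
Let SL v : L2 O v -> L2 O (S v). Proof. by case: S_sqrt => [[[+ _ _] _ _] _]; apply. Qed.
Let Ssym v w : L2 O v -> L2 O w -> inner O (S v) w = inner O v (S w).
Proof. by case: S_sqrt => [[_ + _] _]; apply. Qed.
Let QL v : L2 O v -> L2 O (Q v). Proof. by case: Q_pos => [[+ _ _] _ _]; apply. Qed.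
Let Qsym v w : L2 O v -> L2 O w -> inner O (Q v) w = inner O v (Q w).
Proof. by case: Q_pos => [_ + _]; apply. Qed.

Lemma gaussian_second_moment_ge0 : 0 <= c2.
Proof.
apply: fine_ge0; apply: integral_ge0 => x _.
by rewrite lee_fin mulr_ge0 ?sqr_ge0 ?normal_pdf_ge0.
Qed.

(** With $P_n$ the truncation, $\sum_j\|S\phi_j-P_nS\phi_j\|^2=\sum_j\sum_{l\ge
    n}(S\phi_j,\phi_l)^2=\sum_{l\ge n}\|S\phi_l\|^2=\sum_{l\ge n}(Q\phi_l,\phi_l)$, by Parseval,
    exchange of the sums and symmetry of [S]. This is the tail of the trace of [Q]. *)
Lemma Hilbert_Schmidt_tail :
  (\sum_(0 <= j <oo) (norm O (S (phi j) - trunc O phi (S (phi j)) n) ^+ 2)%:E)%E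
    @[n --> \oo] --> 0%E.
Proof.
have [_ trQ] := Q_cov.
have Q0 l : (0 <= (inner O (Q (phi l)) (phi l))%:E)%E.
  by rewrite lee_fin; case: Q_pos => _ _; apply.
have := nneseries_tail_cvg trQ (fun l _ => Q0 l).
rewrite [X in X @ _ --> _ -> _](_ : _ = (fun n =>
  (\sum_(0 <= j <oo) (norm O (S (phi j) - trunc O phi (S (phi j)) n) ^+ 2)%:E)%E)) //.
apply/funext => n; rewrite eseries_cond eseries_mkcond.
transitivity (\sum_(0 <= l <oo) \sum_(0 <= j <oo)
    if (n <= l)%N then (inner O (S (phi j)) (phi l) ^+ 2)%:E else 0)%E.
  apply: eq_eseriesr => l _ /=; case: ifPn => nl; last by rewrite eseries0.
  rewrite (inner_sqrt_operator mO S_sqrt Q_pos) // -norm_sqr.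
  rewrite -(Parseval mO A_eigen) //; last exact: SL.
  by apply: eq_eseriesr => j _; rewrite Ssym // innerC.
rewrite nneseries_interchange; last by move=> l j; case: ifP => //; rewrite lee_fin sqr_ge0.
apply: eq_eseriesr => j _; have LSj := SL (Lphi j).
have Lt := L2_trunc mO A_eigen (S (phi j)) n.
rewrite -(Parseval mO A_eigen); last exact: L2B.
apply: eq_eseriesr => l _; rewrite innerBl // (inner_trunc mO A_eigen).
by rewrite ltnNge; case: ifPn => _; rewrite ?subr0 // subrr expr0n.
Qed.

Section finite_family.
Variables (I : finType) (t : I -> R) (T : R).
Hypothesis t_range : forall i, 0 <= t i <= T.

Let t_min i k : 0 <= Num.min (t i) (t k) <= T.
Proof.
have /andP[i0 iT] := t_range i; have /andP[k0 _] := t_range k.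
by rewrite le_min i0 k0 /= ge_min iT.
Qed.

(** An identity, since both sides equal $c\sum_{i,k}\min(t_i,t_k)(Qv_i,v_k)$. On the right, for
    fixed $\tau$ and $u=\sum_i\chi_{t_i}(\tau)v_i$, the series is $\|Su\|^2=(Qu,u)$ by Parseval, and
    $\chi_s\chi_t=\chi_{\min(s,t)}$. *)
Lemma Ito_inner (v : I -> fn) : (forall i, L2 O (v i)) ->
  (\int[P]_omega ((\sum_i Wiener_incr O W 0 (t i) (v i) omega) ^+ 2)%:E =
   \int[mu]_(tau in `[0%R, T]) (c2%:E * \sum_(0 <= j <oo)
     ((\sum_i chi (t i) tau * inner O (S (phi j)) (v i)) ^+ 2)%:E))%E.
Proof.
move=> Lv.
have t0 i : 0 <= t i by have /andP[] := t_range i.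
pose b i := Wiener_incr O W 0 (t i) (v i).
have sb i : sqint P setT (b i) by exact: (sqint_Wiener_incr mO Ft_usual Q_pos W_Wiener).
have [_ lhs] := @integral_lincomb _ _ _ P setT measurableT (I * I)%type
  (fun ik omega => b ik.1 omega * b ik.2 omega) (fun=> 1)
  (fun ik => c2 * (Num.min (t ik.1) (t ik.2) * inner O (Q (v ik.1)) (v ik.2)))
  (enum {: I * I}) (fun ik => sqint_integrableM measurableT (sb ik.1) (sb ik.2))
  (fun ik => etrans (esym (EFin_ip measurableT (sb ik.1) (sb ik.2)))
     (congr1 EFin (ip_Wiener mO Ft_usual Q_pos W_Wiener (t0 ik.1) (t0 ik.2) (Lv ik.1) (Lv ik.2)))).
transitivity ((\sum_(ik <- enum {: I * I})
    1 * (c2 * (Num.min (t ik.1) (t ik.2) * inner O (Q (v ik.1)) (v ik.2))))%:E).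
  rewrite -lhs; apply: eq_integral => omega _; congr (_%:E).
  rewrite big_enum /= expr2 big_distrlr pair_bigA /=.
  by apply: eq_bigr => ik _; rewrite mul1r.
have [_ rhs] := @integral_lincomb _ _ _ mu `[0%R, T]%classic (measurable_itv _) (I * I)%type
  (fun ik => chi (Num.min (t ik.1) (t ik.2)))
  (fun ik => c2 * inner O (Q (v ik.1)) (v ik.2)) (fun ik => Num.min (t ik.1) (t ik.2))
  (enum {: I * I}) (fun ik => integrable_chi (t_min ik.1 ik.2))
  (fun ik => integral_chi (t_min ik.1 ik.2)).
transitivity ((\sum_(ik <- enum {: I * I})
    c2 * inner O (Q (v ik.1)) (v ik.2) * Num.min (t ik.1) (t ik.2))%:E).
  by congr (_%:E); apply: eq_bigr => ik _; ring.
rewrite -rhs; apply: eq_integral => tau _.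
pose u := \sum_i chi (t i) tau *: v i.
have Lu : L2 O u by apply: L2_sum => // i _; exact: L2Z.
have -> : (\sum_(0 <= j <oo) ((\sum_i chi (t i) tau * inner O (S (phi j)) (v i)) ^+ 2)%:E =
    (norm O (S u) ^+ 2)%:E)%E.
  rewrite -(Parseval mO A_eigen); last exact: SL.
  apply: eq_eseriesr => j _; rewrite Ssym // /u inner_suml //; last 2 first.
  - by move=> i _; exact: L2Z.
  - exact: SL.
  congr ((_ ^+ 2)%:E); apply: eq_bigr => i _.
  by rewrite innerZl ?(innerC O (v i)) //; exact: SL.
rewrite -EFinM; congr (_%:E); rewrite norm_sqr -(inner_sqrt_operator mO S_sqrt Q_pos) //.
rewrite Qsym // {1}/u inner_suml //; [|by move=> i _; exact: L2Z|exact: QL].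
rewrite big_enum /= -(pair_bigA _ (fun i k => c2 * inner O (Q (v i)) (v k) *
  chi (Num.min (t i) (t k)) tau)) /= mulr_sumr; apply: eq_bigr => i _.
rewrite innerZl //; last exact: QL.
rewrite -Qsym // /u inner_sumr //; [|by move=> k _; exact: L2Z|exact: QL].
rewrite !mulr_sumr; apply: eq_bigr => k _.
rewrite innerZr //; last exact: QL.
by rewrite -chi_min; ring.
Qed.

Definition bounded_functional (l : fn -> R) := 
  (forall a v w, L2 O v -> L2 O w -> l (a *: v + w) = a * l v + l w) /\
  exists2 M, 0 <= M & forall v, L2 O v -> `|l v| <= M * norm O v.

Lemma bounded_functional_trunc l v n : bounded_functional l -> L2 O v ->
  l (trunc O phi v n) = inner O v (\sum_(j < n) l (phi j) *: phi j).
Proof.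
move=> [llin _] Lv; rewrite inner_sumr //; last by move=> j _; exact: L2Z.
have l0 : l 0 = 0.
  have := llin 1 0 0 (L2_0 O) (L2_0 O); rewrite scaler0 addr0 mul1r => /eqP.
  by rewrite -subr_eq subrr => /eqP.
suff [] : L2 O (trunc O phi v n) /\ l (trunc O phi v n) =
  \sum_(j < n) inner O v (l (phi j) *: phi j) by [].
rewrite /trunc; elim/big_rec2: _ => [|j y z _ [Lz <-]]; first by split => //; exact: L2_0.
split; first exact: L2_lin.
by rewrite llin // innerZr // mulrC.
Qed.

Lemma bounded_functionalB l v w : bounded_functional l -> L2 O v -> L2 O w ->
  l (v - w) = l v - l w.
Proof.
by move=> [llin _] Lv Lw; rewrite addrC -scaleN1r llin // mulN1r addrC.
Qed.

(** This is $\|\Psi(\tau)Q^{1/2}\|_{HS}^2$ for the scalar step integrand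
    $\Psi(\tau)=\sum_i\chi_{t_i}(\tau)\,l_i$. *)
Definition integrand (l : I -> fn -> R) (tau : R) : \bar R :=
  (\sum_(0 <= j <oo) ((\sum_i chi (t i) tau * l i (S (phi j))) ^+ 2)%:E)%E.

Lemma integrand_ge0 l tau : (0 <= integrand l tau)%E.
Proof. by apply: nneseries_ge0 => j _ _; rewrite lee_fin sqr_ge0. Qed.

Lemma measurable_integrand l D : measurable_fun D (integrand l).
Proof.
apply: measurable_funTS; apply: ge0_emeasurable_sum => [j x _ _|j _].
  by rewrite lee_fin sqr_ge0.
apply/measurable_EFinP/measurable_funX/measurable_sum => i.
by apply: measurable_funM => //; exact: measurable_chi.
Qed.

(* An inequality only: each [l i] is represented by a vector after truncation of its
   argument in the basis phi, and Fatou's lemma removes the truncation. *)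
Lemma Ito_functional (l : I -> fn -> R) : 0 <= T -> (forall i, bounded_functional (l i)) ->
  (\int[P]_omega ((\sum_i l i (W (t i) omega - W 0 omega)%R) ^+ 2)%:E <=
   (2 * c2)%:E * \int[mu]_(tau in `[0%R, T]) integrand l tau)%E.
Proof.
move=> T0 bl; have c20 := gaussian_second_moment_ge0.
have t0 i : 0 <= t i by have /andP[] := t_range i.
have LW i omega : L2 O (W (t i) omega - W 0 omega).
  by apply: L2B => //; exact: (Wiener_L2 W_Wiener).
pose vn n i := \sum_(j < n) l i (phi j) *: phi j.
have Lvn n i : L2 O (vn n i) by apply: L2_sum => // j _; exact: L2Z.
have /choice[M hM] : forall i, exists M, 0 <= M /\ forall v, L2 O v -> `|l i v| <= M * norm O v.
  by move=> i; have [_ [M M0 hM]] := bl i; exists M.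
pose MM := \sum_i M i.
have MM0 : 0 <= MM by apply: sumr_ge0 => i _; have [] := hM i.
pose rho n := (\sum_(0 <= j <oo)
  (norm O (S (phi j) - trunc O phi (S (phi j)) n) ^+ 2)%:E)%E.
have rho0 n : (0 <= rho n)%E by apply: nneseries_ge0 => j _ _; rewrite lee_fin sqr_ge0.
have K0 : 0 <= 2 * c2 * MM ^+ 2 * T by rewrite !mulr_ge0 ?sqr_ge0.
(* The vanishing term is the truncation error: [MM] bounds the functionals together, [rho n] sums
   the squared remainders of $S\phi_j$, and [T] is the length of the time interval. *)
apply: (@fatou_le _ _ _ P setT measurableT
  (fun n omega => ((\sum_i Wiener_incr O W 0 (t i) (vn n i) omega) ^+ 2)%:E) _ _
  (fun n => (2 * c2 * MM ^+ 2 * T)%:E * rho n)%E).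
- move=> n; apply/measurable_EFinP/measurable_funX/measurable_sum => i.
  exact: (measurable_Wiener_incr mO Ft_usual W_Wiener).
- by move=> n omega _; rewrite lee_fin sqr_ge0.
- move=> omega _; apply/fine_cvgP; split; first exact: nearW.
  have c1 : (\sum_i Wiener_incr O W 0 (t i) (vn n i) omega) @[n --> \oo] -->
      \sum_i l i (W (t i) omega - W 0 omega).
    apply: (cvg_bigsum _ (f := fun i n => Wiener_incr O W 0 (t i) (vn n i) omega)) => i.
    apply: (@cvg_dist_le _ _ (fun n => M i *
      norm O (trunc O phi (W (t i) omega - W 0 omega) n - (W (t i) omega - W 0 omega)))).
      move=> n; rewrite /Wiener_incr -bounded_functional_trunc //.
      have Lt := L2_trunc mO A_eigen (W (t i) omega - W 0 omega) n.
      rewrite -bounded_functionalB //; have [_] := hM i; apply; exact: L2B.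
    have := cvgM (cvg_cst (M i)) (cvg_trunc mO A_eigen (LW i omega)).
    by rewrite mulr0; apply.
  exact: (cvgM c1 c1).
- move=> n; rewrite Ito_inner //.
  apply: (@le_trans _ _ (\int[mu]_(tau in `[0%R, T])
     ((2 * c2)%:E * integrand l tau + (2 * c2 * MM ^+ 2)%:E * rho n))%E).
    apply: ge0_le_integral => //.
    - move=> tau _; apply: mule_ge0; first by rewrite lee_fin.
      by apply: nneseries_ge0 => j _ _; rewrite lee_fin sqr_ge0.
    - apply: emeasurable_funM => //; apply: measurable_funTS.
      apply: ge0_emeasurable_sum => [j x _ _|j _]; first by rewrite lee_fin sqr_ge0.
      apply/measurable_EFinP/measurable_funX/measurable_sum => i.
      by apply: measurable_funM => //; exact: measurable_chi.
    - apply: emeasurable_funD => //; apply: emeasurable_funM => //.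
      exact: measurable_integrand.
    move=> tau _.
    have -> : ((2 * c2)%:E * integrand l tau + (2 * c2 * MM ^+ 2)%:E * rho n =
        c2%:E * (2%:E * integrand l tau + (2 * MM ^+ 2)%:E * rho n))%E.
      rewrite ge0_muleDr ?mule_ge0 ?lee_fin ?mulr_ge0 ?sqr_ge0 ?integrand_ge0 //.
      by rewrite !muleA -!EFinM; congr (_%:E * _ + _%:E * _)%E; ring.
    apply: lee_wpmul2l; first by rewrite lee_fin.
    rewrite /integrand /rho -!nneseriesZl; last 2 first.
    - by move=> j _; rewrite lee_fin sqr_ge0.
    - by move=> j _; rewrite lee_fin sqr_ge0.
    rewrite -nneseriesD; last 2 first.
    - by move=> j _ _; rewrite -EFinM lee_fin mulr_ge0 ?sqr_ge0.
    - by move=> j _ _; rewrite -EFinM lee_fin; apply: mulr_ge0;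
      rewrite ?sqr_ge0 // mulr_ge0 ?sqr_ge0.
    apply: lee_nneseries => [j _ _|j _]; first by rewrite lee_fin sqr_ge0.
    rewrite -!EFinM -EFinD lee_fin.
    have LSj := SL (Lphi j); have Lt := L2_trunc mO A_eigen (S (phi j)) n.
    set r := norm O _; set x := \sum_i chi (t i) tau * l i (S (phi j)).
    set y := \sum_i _.
    have xy : `|x - y| <= MM * r.
      rewrite /x /y -sumrB; apply: (le_trans (ler_norm_sum _ _ _)).
      rewrite /MM mulr_suml; apply: ler_sum => i _.
      rewrite -mulrBr -bounded_functional_trunc // -bounded_functionalB // normrM.
      rewrite ger0_norm ?chi_ge0 //.
      apply: le_trans (_ : `|l i (S (phi j) - trunc O phi (S (phi j)) n)| <= _).
        by rewrite ler_piMl // chi_le1.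
      by have [_] := hM i; apply; exact: L2B.
    have xy2 : (x - y) ^+ 2 <= MM ^+ 2 * r ^+ 2.
      rewrite -exprMn -[leLHS]real_normK ?num_real // ler_pXn2r ?nnegrE //.
      by rewrite mulr_ge0 // norm_ge0.
    (* This yields $y^2\le2x^2+2(x-y)^2$; the coefficient of $x^2$ is the factor 2 of the
       statement. *)
    have := sqr_ge0 (x + (x - y)); have -> : x + (x - y) = 2 * x - y by ring.
    have -> : (2 * x - y) ^+ 2 = 2 * x ^+ 2 + 2 * (x - y) ^+ 2 - y ^+ 2 by ring.
    rewrite mulrA; lra.
  rewrite ge0_integralD //; last 3 first.
  - by move=> tau _; apply: mule_ge0; [rewrite lee_fin mulr_ge0|exact: integrand_ge0].
  - by apply: emeasurable_funM => //; exact: measurable_integrand.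
  - by move=> tau _; apply: mule_ge0 => //; rewrite lee_fin !mulr_ge0 ?sqr_ge0.
  rewrite ge0_integralZl_EFin //; last 3 first.
  - by move=> tau _; exact: integrand_ge0.
  - exact: measurable_integrand.
  - by rewrite mulr_ge0.
  apply: leeD2l; rewrite integral_cst //= lebesgue_measure_itv /= lte_fin.
  case: ltP => [_|_]; last first.
    by rewrite mule0; apply: mule_ge0 => //; rewrite lee_fin.
  by rewrite oppr0 adde0 muleAC -EFinM.
- have := Hilbert_Schmidt_tail => /(cvgeZl (_ : (2 * c2 * MM ^+ 2 * T)%:E \is a fin_num)).
  by rewrite mule0; apply.
- apply: mule_ge0; first by rewrite lee_fin mulr_ge0.
  by apply: integral_ge0 => tau _; exact: integrand_ge0.
Qed.

End finite_family.

End Ito.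

Lemma lee_adde_cvg0 (R : realType) (x a : \bar R) (b : nat -> \bar R) :
  (forall n, x <= a + b n)%E -> b n @[n --> \oo] --> 0%E -> (x <= a)%E.
Proof.
move=> xab b0; have ab : (a + b n)%E @[n --> \oo] --> a.
  rewrite -[X in _ --> X]adde0; apply: cvgeD => //; last exact: cvg_cst.
  by rewrite fin_num_adde_defl.
rewrite -(cvg_lim _ ab) //; apply: lime_ge; first by apply/cvg_ex; exists a.
exact: nearW.
Qed.

(** Integrated form of $\|a+b\|^2\le2\|a\|^2+2\|b\|^2$. The pointwise bound is asked almost
    everywhere because the mild formula holds only almost surely. *)
Lemma le_integral_twice d (M : measurableType d) (R : realType)
    (nu : {measure set M -> \bar R}) (D : set M) (f g h : M -> \bar R) :
  measurable D -> measurable_fun D f -> measurable_fun D g -> measurable_fun D h ->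
  (forall x, D x -> 0 <= f x)%E -> (forall x, D x -> 0 <= g x)%E ->
  (forall x, D x -> 0 <= h x)%E ->
  {ae nu, forall x, D x -> f x <= 2%:E * g x + 2%:E * h x}%E ->
  (\int[nu]_(x in D) f x <=
   2%:E * \int[nu]_(x in D) g x + 2%:E * \int[nu]_(x in D) h x)%E.
Proof.
move=> mD mf mg mh f0 g0 h0 fgh.
have m2 u : measurable_fun D u -> measurable_fun D (fun x => 2%:E * u x)%E.
  by move=> mu; exact: emeasurable_funM.
have p2 u x : (0 <= u x)%E -> (0 <= 2%:E * u x :> \bar R)%E.
  by move=> u0; apply: mule_ge0.
rewrite -!ge0_integralZl_EFin // -ge0_integralD //; last 4 first.
- by move=> x Dx; apply: p2; exact: g0.
- exact: m2.
- by move=> x Dx; apply: p2; exact: h0.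
- exact: m2.
apply: ae_ge0_le_integral => //; last by apply: emeasurable_funD; exact: m2.
by move=> x Dx; apply: adde_ge0; apply: p2; [exact: g0|exact: h0].
Qed.

Lemma mule_two_two (R : realType) (c : R) (a b : \bar R) : (0 <= a)%E -> (0 <= b)%E ->
  (2%:E * ((2 * c)%:E * (2%:E * a + 2%:E * b)) = (8 * c)%:E * a + (8 * c)%:E * b)%E.
Proof.
move=> a0 b0; rewrite -!ge0_muleDr // !muleA -!EFinM.
by congr (_%:E * _)%E; ring.
Qed.

(** * Step integrals and their limits *)

Section step_integrals.
Variables (R : realType) (d : nat) (O : set 'rV[R]_d) (mO : measurable O).
Notation fn := ('rV[R]_d -> R).
Variables (lam : nat -> R) (phi : nat -> fn) (A_eigen : eigenpairs O lam phi).
Variables (dd : measure_display) (Om : measurableType dd) (P : probability Om R).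
Variables (Ft : R -> set (set Om)) (Q S : fn -> fn) (W : R -> Om -> fn).
Hypotheses (Ft_usual : usual_filtration P Ft) (Q_cov : covariance_operator O phi Q).
Hypotheses (S_sqrt : is_sqrt_operator O Q S) (W_Wiener : Wiener P O Ft Q W).
Variables (J : finType) (ev : J -> fn -> R) (V : set fn).
Hypothesis fV : finite_subspace O ev V.
Variables (N : nat) (e : 'I_N -> fn).
Hypotheses (Ve : forall i, V (e i)).
Hypothesis oe : forall i j, inner O (e i) (e j) = (i == j)%:R.
Hypothesis spane : forall v, V v -> v = \sum_i inner O v (e i) *: e i.
Variable T : R.
Hypothesis T0 : 0 <= T.

Notation c2 := (gaussian_second_moment R).
Notation mu := (@lebesgue_measure R).
Let Lphi := L2_phi A_eigen.
Let VL v : V v -> L2 O v. Proof. by case: fV => _ _ + _ _; apply. Qed.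
Let V0 : V 0. Proof. by case: fV. Qed.
Let Le i : L2 O (e i). Proof. exact: VL. Qed.
Let SL v : L2 O v -> L2 O (S v). Proof. by case: S_sqrt => [[[+ _ _] _ _] _]; apply. Qed.

(** [L2measurable] speaks of inner products; [l] is the pointwise limit of the inner products with
    $\sum_{j<n}l(\phi_j)\phi_j$. *)
Lemma measurable_functional_Wiener t (l : fn -> R) : 0 <= t -> bounded_functional O l ->
  measurable_fun setT (fun omega => l (W t omega - W 0 omega)).
Proof.
move=> t0 bl; have [_ [M M0 hM]] := bl.
have LW omega : L2 O (W t omega - W 0 omega).
  by apply: L2B => //; exact: (Wiener_L2 W_Wiener).
pose vn n := \sum_(j < n) l (phi j) *: phi j.
have Lvn n : L2 O (vn n) by apply: L2_sum => // j _; exact: L2Z.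
apply: (@measurable_fun_cvg _ _ _ _ (fun n => Wiener_incr O W 0 t (vn n))) => [n|omega _].
  exact: (measurable_Wiener_incr mO Ft_usual W_Wiener).
apply: (@cvg_dist_le _ _ (fun n => M *
      norm O (trunc O phi (W t omega - W 0 omega) n - (W t omega - W 0 omega)))).
  move=> n; rewrite /Wiener_incr -(bounded_functional_trunc mO A_eigen) //.
  have Lt := L2_trunc mO A_eigen (W t omega - W 0 omega) n.
  by rewrite -(bounded_functionalB bl) //; apply: hM; exact: L2B.
have := cvgM (cvg_cst M) (cvg_trunc mO A_eigen (LW omega)).
by rewrite mulr0; apply.
Qed.

Lemma bounded_functional_operator (B : fn -> fn) i : bounded_operator O V B ->
  bounded_functional O (fun v => inner O (B v) (e i)).
Proof.
move=> [BV Blin [M hM]]; split.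
  move=> a v w Lv Lw; have LBv := VL (BV _ Lv); have LBw := VL (BV _ Lw).
  have Lvw := L2_lin mO a Lv Lw.
  rewrite -inner_lin //; apply: (eqL2_inner mO (VL (BV _ Lvw)) _ (Le i)).
    exact: L2_lin.
  exact: Blin.
exists `|M| => // v Lv; apply: (le_trans (inner_CauchySchwarz mO (VL (BV _ Lv)) (Le i))).
have -> : norm O (e i) = 1 by rewrite /norm oe eqxx sqrtr1.
rewrite mulr1; apply: (le_trans (hM _ Lv)).
by rewrite ler_wpM2r ?norm_ge0 // ler_norm.
Qed.

Lemma bounded_functionalZ (a : R) l : bounded_functional O l ->
  bounded_functional O (fun v => a * l v).
Proof.
move=> [llin [M M0 hM]]; split; first by move=> b v w Lv Lw; rewrite llin //; ring.
exists (`|a| * M); first by rewrite mulr_ge0.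
by move=> v Lv; rewrite normrM -mulrA ler_wpM2l // hM.
Qed.

(* A step integral is a combination of functionals of W(t) - W(0), t ranging over the
   two ends of each step; the boolean [ib.2] selects the right end. *)
Definition knot (X : step_integrand R d) (ib : 'I_(step_card X) * bool) : R :=
  step_time X (if ib.2 then ib.1.+1 else ib.1).

Definition knot_functional (X : step_integrand R d) m
    (ib : 'I_(step_card X) * bool) (v : fn) : R :=
  (-1) ^+ (~~ ib.2) * inner O (step_op X ib.1 v) (e m).

Lemma step_time_range X i : step_valid O V T X -> (i <= step_card X)%N ->
  0 <= step_time X i <= T.
Proof.
move=> [[X0 XT] mono _] iX.
have mon j k : (j <= k)%N -> (k <= step_card X)%N -> step_time X j <= step_time X k.
  move=> jk; elim: k jk => [|k IH]; first by rewrite leqn0 => /eqP ->.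
  rewrite leq_eqVlt => /orP[/eqP -> //|jk kX].
  by apply: (le_trans (IH jk (ltnW kX))); exact: mono.
by rewrite (le_trans X0 (mon 0%N i _ _)) // (le_trans (mon i _ iX _) XT).
Qed.

Lemma knot_range X ib : step_valid O V T X -> 0 <= knot (X := X) ib <= T.
Proof.
by move=> vX; apply: step_time_range => //; case: ib => i [] /=; rewrite // ltnW.
Qed.

Lemma bounded_knot_functional X m ib : step_valid O V T X ->
  bounded_functional O (knot_functional (X := X) m ib).
Proof.
move=> [_ _ opX]; apply: bounded_functionalZ; apply: bounded_functional_operator.
exact: opX.
Qed.

Lemma step_integral_in X omega : step_valid O V T X -> V (step_integral W X omega).
Proof.
move=> vX; have [_ _ opX] := vX; rewrite /step_integral.
elim/big_ind: _ => [//||i _]; first by move=> v w; exact: (subspaceD fV).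
have [BV _ _] := opX _ (ltn_ord i); apply: BV.
have /andP[a0 _] := step_time_range vX (ltn_ord i).
have /andP[b0 _] := step_time_range vX (ltnW (ltn_ord i)).
by apply: L2B => //; exact: (Wiener_L2 W_Wiener).
Qed.

Lemma step_eval_in X tau w : step_valid O V T X -> L2 O w -> V (step_eval X tau w).
Proof.
move=> vX Lw; have [_ _ opX] := vX; rewrite /step_eval.
elim/big_ind: _ => [//||i _]; first by move=> v v'; exact: (subspaceD fV).
by have [BV _ _] := opX _ (ltn_ord i); exact: BV.
Qed.

Lemma inner_step_integral X m omega : step_valid O V T X ->
  inner O (step_integral W X omega) (e m) =
  \sum_ib knot_functional m ib (W (knot (X := X) ib) omega - W 0 omega).
Proof.
move=> vX; have [_ _ opX] := vX; rewrite /step_integral.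
have LW (i : 'I_(step_card X).+1) : L2 O (W (step_time X i) omega).
  have /andP[a0 _] := step_time_range vX (ltn_ord i : (i <= step_card X)%N).
  exact: (Wiener_L2 W_Wiener).
have LWi (i : 'I_(step_card X)) : L2 O (W (step_time X i) omega).
  exact: (LW (widen_ord (leqnSn _) i)).
have LWi1 (i : 'I_(step_card X)) : L2 O (W (step_time X i.+1) omega).
  exact: (LW (lift ord0 i)).
have LW0 : L2 O (W 0 omega) by exact: (Wiener_L2 W_Wiener).
rewrite inner_suml //; last first.
  move=> i _; have [BV _ _] := opX _ (ltn_ord i); apply/VL/BV; exact: L2B.
rewrite -(pair_bigA _ (fun i b => knot_functional m (i, b)
  (W (knot (X := X) (i, b)) omega - W 0 omega))) /=.
apply: eq_bigr => i _; rewrite big_bool /knot_functional /knot /= expr0 expr1 mul1r mulN1r.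
have bf := bounded_functional_operator m (opX _ (ltn_ord i)).
have <- : W (step_time X i.+1) omega - W 0 omega - (W (step_time X i) omega - W 0 omega) =
    W (step_time X i.+1) omega - W (step_time X i) omega by rewrite opprB addrA subrK.
by apply: (bounded_functionalB bf); exact: L2B.
Qed.

Lemma inner_step_eval X m tau w : step_valid O V T X -> L2 O w ->
  inner O (step_eval X tau w) (e m) =
  \sum_ib chi (knot (X := X) ib) tau * knot_functional m ib w.
Proof.
move=> vX Lw; have [_ mono opX] := vX; rewrite /step_eval inner_suml //; last first.
  by move=> i _; have [BV _ _] := opX _ (ltn_ord i); exact/VL/BV.
rewrite -(pair_bigA _ (fun i b => chi (knot (X := X) (i, b)) tau *
  knot_functional m (i, b) w)) /= big_mkcond /=.
apply: eq_bigr => i _; rewrite big_bool /knot_functional /knot /= expr0 expr1 mul1r mulN1r.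
have /andP[a0 _] := step_time_range vX (ltnW (ltn_ord i)).
rewrite mulrN -mulrBl -chi_itv ?mono //.
by case: ifP => _; rewrite ?mul1r ?mul0r.
Qed.

Let norm_sqr_coord v : V v -> (norm O v ^+ 2)%:E = (\sum_(m < N) (inner O v (e m) ^+ 2)%:E)%E.
Proof. by move=> Vv; rewrite (norm_sqr_span mO fV Ve oe spane Vv) sumEFin. Qed.

Let sum_nneseries (a : 'I_N -> nat -> \bar R) : (forall m j, 0 <= a m j)%E ->
  (\sum_(0 <= j <oo) \sum_(m < N) a m j)%E = (\sum_(m < N) \sum_(0 <= j <oo) a m j)%E.
Proof. by move=> a0; rewrite nneseries_sum. Qed.

(** Instead of a common refinement of the two partitions, the knots of [X] and [Y] form one finite
    family indexed by a disjoint sum, with a minus sign on the second half. [Ito_functional] applies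
    to each coefficient on $e_m$, and the [N] bounds add up to squared norms. *)
Lemma Ito_step_dist X Y : step_valid O V T X -> step_valid O V T Y ->
  (\int[P]_omega (norm O (step_integral W X omega - step_integral W Y omega) ^+ 2)%:E <=
   (2 * c2)%:E * \int[mu]_(tau in `[0%R, T]) \sum_(0 <= j <oo)
     (norm O (step_eval X tau (S (phi j)) - step_eval Y tau (S (phi j))) ^+ 2)%:E)%E.
Proof.
move=> vX vY; have c20 := gaussian_second_moment_ge0 R.
pose I := (('I_(step_card X) * bool) + ('I_(step_card Y) * bool))%type.
pose t (i : I) := match i with inl ib => knot (X := X) ib | inr ib => knot (X := Y) ib end.
pose l m (i : I) v : R := match i with
  | inl ib => knot_functional (X := X) m ib v
  | inr ib => (-1) * knot_functional (X := Y) m ib v end.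
have tT i : 0 <= t i <= T by case: i => ib; exact: knot_range.
have bl m i : bounded_functional O (l m i).
  case: i => ib; first exact: bounded_knot_functional.
  by apply: bounded_functionalZ; exact: bounded_knot_functional.
have intE m omega : inner O (step_integral W X omega - step_integral W Y omega) (e m) =
    \sum_i l m i (W (t i) omega - W 0 omega).
  rewrite innerBl //; try exact/VL/step_integral_in.
  rewrite !inner_step_integral // big_sumType /=; congr (_ + _).
  by rewrite -sumrN; apply: eq_bigr => i _; rewrite mulN1r.
have evE m tau j : inner O (step_eval X tau (S (phi j)) - step_eval Y tau (S (phi j))) (e m) =
    \sum_i chi (t i) tau * l m i (S (phi j)).
  have LSj := SL (Lphi j).
  rewrite innerBl //; try exact/VL/step_eval_in.
  rewrite !inner_step_eval // big_sumType /=; congr (_ + _).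
  by rewrite -sumrN; apply: eq_bigr => i _; rewrite mulN1r mulrN.
have lhsE omega : (norm O (step_integral W X omega - step_integral W Y omega) ^+ 2)%:E =
    (\sum_(m < N) ((\sum_i l m i (W (t i) omega - W 0 omega)%R) ^+ 2)%:E)%E.
  rewrite norm_sqr_coord; first by apply: eq_bigr => m _; rewrite intE.
  by apply: (subspaceB fV); exact: step_integral_in.
under eq_integral do rewrite lhsE.
rewrite ge0_integral_sum //; last 2 first.
- move=> m; apply/measurable_EFinP/measurable_funX/measurable_sum => i.
  by apply: measurable_functional_Wiener => //; have /andP[] := tT i.
- by move=> m omega _; rewrite lee_fin sqr_ge0.
apply: (@le_trans _ _ (\sum_(m < N) ((2 * c2)%:E *
    \int[mu]_(tau in `[0%R, T]) integrand phi S t (l m) tau))%E).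
  apply: lee_sum => m _.
  exact: (Ito_functional mO A_eigen Ft_usual Q_cov S_sqrt W_Wiener tT).
rewrite -ge0_sume_distrr; last first.
  by move=> m _; apply: integral_ge0 => tau _; exact: integrand_ge0.
rewrite -ge0_integral_sum //; last 2 first.
- by move=> m; exact: measurable_integrand.
- by move=> m tau _; exact: integrand_ge0.
rewrite le_eqVlt; apply/orP; left; apply/eqP; congr (_ * _)%E.
apply: eq_integral => tau _; rewrite /integrand -sum_nneseries; last first.
  by move=> m j; rewrite lee_fin sqr_ge0.
apply: eq_eseriesr => j _; rewrite norm_sqr_coord.
  by apply: eq_bigr => m _; rewrite evE.
by apply: (subspaceB fV); apply: step_eval_in => //; exact: SL.
Qed.

(** Measurability is available for coefficients; in [V] the squared norm is a finite sum of their
    squares. *)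
Lemma measurable_norm_sqr_dist d' (M : measurableType d')
    (D' : set M) (f g : M -> fn) :
  (forall x, D' x -> V (f x)) -> (forall x, D' x -> V (g x)) ->
  (forall m, measurable_fun D' (fun x => inner O (f x) (e m))) ->
  (forall m, measurable_fun D' (fun x => inner O (g x) (e m))) ->
  measurable_fun D' (fun x => (norm O (f x - g x) ^+ 2)%:E).
Proof.
move=> Vf Vg mf mg.
apply: (eq_measurable_fun (fun x =>
   (\sum_(m < N) (inner O (f x) (e m) - inner O (g x) (e m)) ^+ 2)%:E)).
  move=> x /[!inE] Dx; rewrite norm_sqr_coord; last by apply: (subspaceB fV); [exact: Vf|exact: Vg].
  rewrite sumEFin; congr (_%:E); apply: eq_bigr => m _.
  by rewrite innerBl //; apply: VL; [exact: Vf|exact: Vg].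
apply/measurable_EFinP/measurable_sum => m; apply: measurable_funX.
exact: measurable_funB.
Qed.

Lemma measurable_inner_step_eval X m w D : step_valid O V T X -> L2 O w ->
  measurable_fun D (fun tau => inner O (step_eval X tau w) (e m)).
Proof.
move=> vX Lw; rewrite (_ : (fun tau => _) = fun tau =>
    \sum_ib chi (knot (X := X) ib) tau * knot_functional m ib w).
  apply: measurable_funTS; apply: measurable_sum => ib.
  by apply: measurable_funM => //; exact: measurable_chi.
by apply/funext => tau; rewrite inner_step_eval.
Qed.

Lemma measurable_inner_step_integral X m : step_valid O V T X ->
  measurable_fun setT (fun omega => inner O (step_integral W X omega) (e m)).
Proof.
move=> vX; rewrite (_ : (fun omega => _) = fun omega =>
    \sum_ib knot_functional m ib (W (knot (X := X) ib) omega - W 0 omega)).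
  apply: measurable_sum => ib; apply: measurable_functional_Wiener.
    by have /andP[] := knot_range ib vX.
  exact: bounded_knot_functional.
by apply/funext => omega; rewrite inner_step_integral.
Qed.

(** [Y] is compared with the step integrands $X_n$ that define the integral. The triangle inequality
    is used once on the sample space and once on the time interval, around the factor $2c$ of
    [Ito_step_dist], whence $8c=2\cdot2c\cdot2$. The terms that compare $X_n$ with [Phi] and its
    integral with [I] tend to 0. *)
Lemma stochastic_integral_dist (Phi : R -> fn -> fn) (I : Om -> fn) Y :
  step_valid O V T Y -> stochastic_integral P O phi V S W T Phi I ->
  (forall tau j, V (Phi tau (S (phi j)))) ->
  (forall j m, measurable_fun `[0, T]%classic (fun tau => inner O (Phi tau (S (phi j))) (e m))) ->
  (\int[P]_omega (norm O (step_integral W Y omega - I omega) ^+ 2)%:E <=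
   (8 * c2)%:E * \int[mu]_(tau in `[0%R, T]) \sum_(0 <= j <oo)
     (norm O (step_eval Y tau (S (phi j)) - Phi tau (S (phi j))) ^+ 2)%:E)%E.
Proof.
move=> vY [VI [_ mI] [X [vX Xa Xb]]] VPhi mPhi; have c20 := gaussian_second_moment_ge0 R.
have mIe m : measurable_fun setT (fun omega => inner O (I omega) (e m)).
  by move=> _ B mB; rewrite setTI; exact: mI.
pose al n := (\int[mu]_(tau in `[0%R, T]) \sum_(0 <= j <oo)
   (norm O (step_eval (X n) tau (S (phi j)) - Phi tau (S (phi j))) ^+ 2)%:E)%E.
pose be n := (\int[P]_omega (norm O (step_integral W (X n) omega - I omega) ^+ 2)%:E)%E.
have sq0 v : (0 <= (norm O v ^+ 2)%:E)%E by rewrite lee_fin sqr_ge0.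
have mSY Z : step_valid O V T Z ->
    measurable_fun setT (fun omega => (norm O (step_integral W Z omega - I omega) ^+ 2)%:E).
  move=> vZ; apply: measurable_norm_sqr_dist => //.
  - by move=> omega _; exact: step_integral_in.
  - by move=> m; exact: measurable_inner_step_integral.
have mSe Z : step_valid O V T Z -> measurable_fun `[0, T]%classic (fun tau =>
    \sum_(0 <= j <oo) (norm O (step_eval Z tau (S (phi j)) - Phi tau (S (phi j))) ^+ 2)%:E)%E.
  move=> vZ; apply: ge0_emeasurable_sum => // j _.
  have LSj := SL (Lphi j).
  apply: measurable_norm_sqr_dist => //.
  - by move=> tau _; exact: step_eval_in.
  - by move=> m; exact: measurable_inner_step_eval.
apply: (@lee_adde_cvg0 _ _ _ (fun n => (8 * c2)%:E * al n + 2%:E * be n)%E); last first.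
  rewrite -[X in _ --> X]adde0; apply: cvgeD => //.
    by rewrite -[X in _ --> X](mule0 (8 * c2)%:E); apply: cvgeZl.
  by rewrite -[X in _ --> X](mule0 2%:E); apply: cvgeZl.
move=> n.
have mSS : measurable_fun setT (fun omega =>
    (norm O (step_integral W Y omega - step_integral W (X n) omega) ^+ 2)%:E).
  apply: measurable_norm_sqr_dist.
  - by move=> omega _; exact: step_integral_in.
  - by move=> omega _; exact: step_integral_in.
  - by move=> m; exact: measurable_inner_step_integral.
  - by move=> m; exact: measurable_inner_step_integral.
have mSSe : measurable_fun `[0, T]%classic (fun tau => \sum_(0 <= j <oo)
    (norm O (step_eval Y tau (S (phi j)) - step_eval (X n) tau (S (phi j))) ^+ 2)%:E)%E.
  apply: ge0_emeasurable_sum => // j _.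
  have LSj := SL (Lphi j).
  apply: measurable_norm_sqr_dist.
  - by move=> tau _; exact: step_eval_in.
  - by move=> tau _; exact: step_eval_in.
  - by move=> m; exact: measurable_inner_step_eval.
  - by move=> m; exact: measurable_inner_step_eval.
have tri u v w : V u -> V v -> V w ->
    norm O (u - v) ^+ 2 <= 2 * norm O (u - w) ^+ 2 + 2 * norm O (w - v) ^+ 2.
  move=> Vu Vv Vw; rewrite -[in leLHS](subrK w u) -addrA.
  by apply: (norm_sqrD_le mO); apply: L2B => //; exact: VL.
have S0 (f : nat -> fn) : (0 <= \sum_(0 <= j <oo) (norm O (f j) ^+ 2)%:E)%E.
  by apply: nneseries_ge0.
have step1 := @le_integral_twice _ _ _ P setT _ _ _ measurableT (mSY _ vY) mSS (mSY _ (vX n))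
  (fun omega _ => sq0 _) (fun omega _ => sq0 _) (fun omega _ => sq0 _).
have {}step1 := step1 (aeW _ (fun omega _ =>
  tri _ _ _ (step_integral_in omega vY) (VI omega) (step_integral_in omega (vX n)))).
apply: (le_trans step1).
have step2 := Ito_step_dist vY (vX n).
have step3 := @le_integral_twice _ _ _ mu `[0, T]%classic _ _ _ (measurable_itv _)
  mSSe (mSe _ vY) (mSe _ (vX n))
  (fun omega _ => S0 _) (fun omega _ => S0 _) (fun omega _ => S0 _).
rewrite addeA; apply: leeD => //.
apply: (@le_trans _ _ (2%:E * ((2 * c2)%:E * (2%:E * \int[mu]_(tau in `[0%R, T])
     \sum_(0 <= j <oo) (norm O (step_eval Y tau (S (phi j)) - Phi tau (S (phi j))) ^+ 2)%:E +
     2%:E * al n)))%E).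
  apply: lee_wpmul2l => //; apply: (le_trans step2).
  apply: lee_wpmul2l; first by rewrite lee_fin mulr_ge0.
  apply: step3; apply: aeW => tau _.
  rewrite -[X in (_ <= X + _)%E]nneseriesZl // -[X in (_ <= _ + X)%E]nneseriesZl //.
  rewrite -nneseriesD //; last 2 first.
  - by move=> j _ _; apply: mule_ge0.
  - by move=> j _ _; apply: mule_ge0.
  apply: lee_nneseries => [j _ _ //|j _].
  rewrite -!EFinM -EFinD lee_fin; have LSj := SL (Lphi j).
  have := tri _ _ _ (step_eval_in tau vY LSj) (step_eval_in tau (vX n) LSj) (VPhi tau j).
  have -> : norm O (Phi tau (S (phi j)) - step_eval (X n) tau (S (phi j))) =
      norm O (step_eval (X n) tau (S (phi j)) - Phi tau (S (phi j))).
    by apply: (normBC mO); apply: VL => //; exact: step_eval_in.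
  by [].
rewrite mule_two_two //; first by apply: integral_ge0 => tau _; exact: S0.
by apply: integral_ge0 => tau _; exact: S0.
Qed.

End step_integrals.

(** * The trigonometric scheme *)

Section trigonometric_steps.
Variables (R : realType) (d : nat) (O : set 'rV[R]_d) (mO : measurable O).
Notation fn := ('rV[R]_d -> R).
Variables (lam : nat -> R) (phi : nat -> fn) (A_eigen : eigenpairs O lam phi).
Variables (J : finType) (ev : J -> fn -> R) (V : set fn).
Hypothesis ev_lin : forall j a v w, ev j (a *: v + w) = a * ev j v + ev j w.
Hypothesis fV : finite_subspace O ev V.
Variables (A : fn -> fn) (N : nat) (e : 'I_N -> fn) (mu : 'I_N -> R).
Hypotheses (Ve : forall i, V (e i)) (mu0 : forall i, 0 <= mu i).
Hypothesis oe : forall i j, inner O (e i) (e j) = (i == j)%:R.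
Hypothesis spane : forall v, V v -> v = \sum_i inner O v (e i) *: e i.
Hypothesis opE : forall F v, V v ->
  op_calculus V A F v = \sum_i (F (mu i) * inner O v (e i)) *: e i.

Notation c2 := (gaussian_second_moment R).
Notation leb := (@lebesgue_measure R).
Let Lphi := L2_phi A_eigen.
Let VL v : V v -> L2 O v. Proof. by case: fV => _ _ + _ _; apply. Qed.
Let VP w : L2 O w -> V (L2proj O V w).
Proof. by move=> Lw; have [] := L2projP mO ev_lin fV Lw. Qed.

(** The operator $f(sA_h)\mathcal P_h$; for [cos] and [sin] and $s=t-\tau$ it is convertible with
    the integrands in [mild_solution]. *)
Definition trig_op (f : R -> R) (s : R) (w : fn) : fn :=
  op_calculus V A (fun nu => f (s * nu)) (L2proj O V w).

Lemma trig_op_in f s w : L2 O w -> V (trig_op f s w).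
Proof. by move=> Lw; apply: (op_calculus_in fV Ve opE); exact: VP. Qed.

Lemma inner_trig_op f s w i : L2 O w ->
  inner O (trig_op f s w) (e i) = f (s * mu i) * inner O w (e i).
Proof.
move=> Lw; rewrite (inner_op_calculus mO fV Ve oe opE) //; last exact: VP.
by have [_ ->] := L2projP mO ev_lin fV Lw.
Qed.

Lemma trig_op_bounded f s : (forall x, `|f x| <= 1) ->
  bounded_operator O V (trig_op f s).
Proof.
move=> f1; split.
- by move=> v Lv; exact: trig_op_in.
- move=> a v w Lv Lw; rewrite /eqL2.
  have -> : trig_op f s (a *: v + w) = a *: trig_op f s v + trig_op f s w.
    have Vv := trig_op_in f s Lv; have Vw := trig_op_in f s Lw.
    have Lvw := L2_lin mO a Lv Lw.
    apply: (op_calculus_ext spane); [exact: trig_op_in| |].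
      by case: fV => _ + _ _ _; apply.
    move=> i; rewrite inner_lin //; try exact: VL.
    by rewrite !inner_trig_op // inner_lin //; [ring|exact: VL].
  by rewrite subrr norm0.
- exists 1 => v Lv; rewrite mul1r; apply: (le_trans _ (norm_L2proj mO ev_lin fV Lv)).
  rewrite -(@ler_pXn2r _ 2%N) ?nnegrE ?norm_ge0 //.
  rewrite !(norm_sqr_span mO fV Ve oe spane) //; [|exact: VP|exact: trig_op_in].
  apply: ler_sum => i _; rewrite inner_trig_op //.
  have [_ ->] := L2projP mO ev_lin fV Lv; last by [].
  rewrite exprMn -[leRHS]mul1r ler_wpM2r ?sqr_ge0 //.
  by rewrite -[leLHS]real_normK ?num_real // expr_le1.
Qed.

Variables (g C : R).
Hypothesis g01 : 0 <= g <= 1.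
Hypothesis smoothing : forall w, L2 O w ->
  ((\sum_i (mu i `^ g) ^+ 2 * inner O w (e i) ^+ 2)%:E <=
     (C ^+ 2)%:E * dotnorm_sq O lam phi (2 * g) w)%E.

Variables (f : R -> R) (cf : continuous f).
Hypothesis f1 : forall x, `|f x| <= 1.
Hypothesis fH : forall a b nu, 0 <= nu ->
  (f (a * nu) - f (b * nu)) ^+ 2 <= 4 * `|a - b| `^ (2 * g) * (nu `^ g) ^+ 2.

Lemma norm_sqr_trig_op_dist a b k w : L2 O w -> `|a - b| <= k ->
  ((norm O (trig_op f a w - trig_op f b w) ^+ 2)%:E <=
   (4 * k `^ (2 * g) * C ^+ 2)%:E * dotnorm_sq O lam phi (2 * g) w)%E.
Proof.
move=> Lw abk; have k0 : 0 <= k by apply: le_trans abk.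
have /andP[g0 _] := g01.
have Va := trig_op_in f a Lw; have Vb := trig_op_in f b Lw.
apply: (@le_trans _ _ ((4 * k `^ (2 * g))%:E *
   (\sum_i (mu i `^ g) ^+ 2 * inner O w (e i) ^+ 2)%:E)%E); last first.
  rewrite (EFinM (4 * _)) -muleA; apply: lee_wpmul2l; last exact: smoothing.
  by rewrite lee_fin mulr_ge0 ?powR_ge0.
rewrite (norm_sqr_span mO fV Ve oe spane); last exact: (subspaceB fV).
rewrite -EFinM lee_fin mulr_sumr; apply: ler_sum => i _.
rewrite innerBl //; try exact: VL.
rewrite !inner_trig_op // -mulrBl exprMn [leRHS]mulrA ler_wpM2r ?sqr_ge0 //.
apply: (le_trans (fH _ _ (mu0 i))); rewrite ler_wpM2r ?sqr_ge0 // ler_wpM2l //.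
by apply: ge0_ler_powR; rewrite ?nnegrE // mulr_ge0.
Qed.

Definition trig_step (n : nat) (k : R) : step_integrand R d :=
  StepIntegrand n (fun j => j%:R * k) (fun j => trig_op f (n%:R * k - j%:R * k)).

Lemma trig_step_valid n k : 0 < k -> step_valid O V (n%:R * k) (trig_step n k).
Proof.
move=> k0; split => /=.
- by rewrite mul0r.
- by move=> i _; rewrite ler_pM2r // ler_nat.
- by move=> i _; exact: trig_op_bounded.
Qed.

Lemma trig_step_eval n k tau w : 0 < k -> L2 O w -> 0 < tau <= n%:R * k ->
  exists2 s, `|s - (n%:R * k - tau)| <= k & step_eval (trig_step n k) tau w = trig_op f s w.
Proof.
move=> k0 Lw /andP[tau0 tauT].
have [i [ik iki]] : exists i : 'I_n, i%:R * k < tau /\ tau <= i.+1%:R * k.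
  have : exists m : nat, tau <= m%:R * k by exists n.
  (* [m] is the least index with $\tau\le mk$. It is not 0 since $\tau>0$, and its predecessor is
     the index of the step that contains $\tau$. *)
  move=> /(@ex_minnP (fun m : nat => tau <= m%:R * k)) [m taum minm].
  case: m taum minm => [|m] taum minm; first by move: taum; rewrite mul0r leNgt tau0.
  have mn : (m < n)%N by apply: minm.
  exists (Ordinal mn); split => //=; rewrite ltNge; apply/negP => /minm.
  by rewrite ltnn.
exists (n%:R * k - i%:R * k).
  have -> : n%:R * k - i%:R * k - (n%:R * k - tau) = tau - i%:R * k by ring.
  rewrite ger0_norm ?subr_ge0 ?(ltW ik) // lerBlDl.
  by rewrite -natr1 mulrDl mul1r in iki.
rewrite /step_eval (bigD1 i) /= ?ik ?iki // big1 ?addr0 // => i' /andP[/andP[h1 h2] i'i].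
move/negP: i'i => []; apply/eqP/val_inj/eqP => /=.
rewrite eqn_leq; apply/andP; split.
  have := lt_le_trans h1 iki; rewrite ltr_pM2r // ltr_nat ltnS; exact.
have := lt_le_trans ik h2; rewrite ltr_pM2r // ltr_nat ltnS; exact.
Qed.

Lemma measurable_inner_trig_op (T : R) w i (D : set R) : L2 O w ->
  measurable_fun D (fun tau => inner O (trig_op f (T - tau) w) (e i)).
Proof.
move=> Lw; rewrite (_ : (fun tau => _) = fun tau => f ((T - tau) * mu i) * inner O w (e i)).
  apply: measurable_funTS; apply: measurable_funM => //.
  apply: (measurableT_comp (continuous_measurable_fun cf)).
  by apply: measurable_funM => //; apply: measurable_funB.
by apply/funext => tau; rewrite inner_trig_op.
Qed.

Variables (dd : measure_display) (Om : measurableType dd) (P : probability Om R).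
Variables (Ft : R -> set (set Om)) (Q S : fn -> fn) (W : R -> Om -> fn).
Hypotheses (Ft_usual : usual_filtration P Ft) (Q_cov : covariance_operator O phi Q).
Hypotheses (S_sqrt : is_sqrt_operator O Q S) (W_Wiener : Wiener P O Ft Q W).
Let SL v : L2 O v -> L2 O (S v). Proof. by case: S_sqrt => [[[+ _ _] _ _] _]; apply. Qed.

Lemma trig_step_dist n k (I : Om -> fn) : 0 < k ->
  stochastic_integral P O phi V S W (n%:R * k) (fun tau => trig_op f (n%:R * k - tau)) I ->
  (\int[P]_omega (norm O (step_integral W (trig_step n k) omega - I omega) ^+ 2)%:E <=
   (8 * c2 * (n%:R * k) * (4 * k `^ (2 * g) * C ^+ 2))%:E *
   \sum_(0 <= j <oo) dotnorm_sq O lam phi (2 * g) (S (phi j)))%E.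
Proof.
move=> k0 hI; have T0 : 0 <= n%:R * k by rewrite mulr_ge0 // ltW.
have c20 := gaussian_second_moment_ge0 R.
have vY := trig_step_valid n k0.
have dn0 w : (0 <= dotnorm_sq O lam phi (2 * g) w)%E.
  by apply: nneseries_ge0 => j _ _; rewrite lee_fin mulr_ge0 ?powR_ge0 ?sqr_ge0.
pose HS := (\sum_(0 <= j <oo) dotnorm_sq O lam phi (2 * g) (S (phi j)))%E.
have HS0 : (0 <= HS)%E by apply: nneseries_ge0.
have K0 : 0 <= 4 * k `^ (2 * g) * C ^+ 2   by rewrite mulr_ge0 ?sqr_ge0 // mulr_ge0 ?powR_ge0.
apply: (le_trans (stochastic_integral_dist mO A_eigen Ft_usual Q_cov S_sqrt W_Wiener
  fV Ve oe spane T0 vY hI _ _)).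
- by move=> tau j; apply: trig_op_in; exact/SL.
- by move=> j m; apply: measurable_inner_trig_op; exact/SL.
rewrite -(mulrA (8 * c2)) (EFinM (8 * c2) (_ * _)) -muleA.
apply: lee_wpmul2l; first by rewrite lee_fin mulr_ge0.
set G := fun tau : R => (\sum_(0 <= j <oo) _)%E.
have mG : measurable_fun `[0, n%:R * k]%classic G.
  apply: ge0_emeasurable_sum => [j tau _ _|j _]; first by rewrite lee_fin sqr_ge0.
  have LSj := SL (Lphi j).
  apply: (measurable_norm_sqr_dist mO fV Ve oe spane).
  - by move=> tau _; exact: (step_eval_in fV tau vY LSj).
  - by move=> tau _; exact: trig_op_in.
  - by move=> m; exact: (measurable_inner_step_eval mO fV Ve m vY LSj).
  - by move=> m; exact: measurable_inner_trig_op.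
have mG' : measurable_fun `]0, n%:R * k]%classic G.
  by apply: measurable_funS mG => // x /=; rewrite !in_itv /= => /andP[/ltW -> ->].
(* No step is active at $\tau=0$; the point is removed as a null set. *)
rewrite -integral_itv_obnd_cbnd //.
apply: (@le_trans _ _ (\int[leb]_(tau in `]0%R, (n%:R * k)%R])
    ((4 * k `^ (2 * g) * C ^+ 2)%:E * HS))%E).
  apply: ge0_le_integral => //.
  - by move=> tau _; apply: nneseries_ge0 => j _ _; rewrite lee_fin sqr_ge0.
  move=> tau /=; rewrite in_itv /= => tauT.
  rewrite /HS -nneseriesZl; last by move=> j _; exact: dn0.
  apply: lee_nneseries => [j _ _|j _]; first by rewrite lee_fin sqr_ge0.
  have LSj := SL (Lphi j).
  have [s sk ->] := trig_step_eval k0 LSj tauT.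
  exact: norm_sqr_trig_op_dist.
rewrite integral_cst //= lebesgue_measure_itv /= lte_fin.
set K := 4 * _ * _ in K0 *.
have -> : ((n%:R * k * K)%:E * HS = K%:E * HS * (n%:R * k)%:E)%E.
  by rewrite EFinM -muleA muleC.
case: ltP => [_|_]; first by rewrite oppr0 adde0.
by rewrite mule0; apply: mule_ge0; [apply: mule_ge0; rewrite ?lee_fin|rewrite lee_fin].
Qed.

End trigonometric_steps.

(** * Closed form of the scheme and the mean-square error *)

Section scheme.
Variables (R : realType) (d : nat) (O : set 'rV[R]_d) (mO : measurable O).
Notation fn := ('rV[R]_d -> R).
Variables (lam : nat -> R) (phi : nat -> fn) (A_eigen : eigenpairs O lam phi).
Variables (J : finType) (ev : J -> fn -> R) (V : set fn).
Hypothesis ev_lin : forall j a v w, ev j (a *: v + w) = a * ev j v + ev j w.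
Hypothesis fV : finite_subspace O ev V.
Notation A := (discrete_laplacian O V).
Variables (N : nat) (e : 'I_N -> fn) (mu : 'I_N -> R).
Hypotheses (Ve : forall i, V (e i)) (mu0 : forall i, 0 <= mu i).
Hypothesis oe : forall i j, inner O (e i) (e j) = (i == j)%:R.
Hypothesis spane : forall v, V v -> v = \sum_i inner O v (e i) *: e i.
Hypothesis opE : forall F v, V v ->
  op_calculus V A F v = \sum_i (F (mu i) * inner O v (e i)) *: e i.

Notation c2 := (gaussian_second_moment R).
Let Lphi := L2_phi A_eigen.
Let VL v : V v -> L2 O v. Proof. by case: fV => _ _ + _ _; apply. Qed.
Let VP w : L2 O w -> V (L2proj O V w).
Proof. by move=> Lw; have [] := L2projP mO ev_lin fV Lw. Qed.
Let VD v w : V v -> V w -> V (v + w). Proof. exact: (subspaceD fV). Qed.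
Let VB v w : V v -> V w -> V (v - w). Proof. exact: (subspaceB fV). Qed.

Lemma expA_in t a b : V a -> V b -> V (expA V A t (a, b)).1 /\ V (expA V A t (a, b)).2.
Proof.
by move=> Va Vb; split; [apply: VB|apply: VD]; exact: (op_calculus_in fV Ve opE).
Qed.

Lemma inner_expA t a b i : V a -> V b ->
  inner O (expA V A t (a, b)).1 (e i) =
    cos (t * mu i) * inner O a (e i) - sin (t * mu i) * inner O b (e i) /\
  inner O (expA V A t (a, b)).2 (e i) =
    sin (t * mu i) * inner O a (e i) + cos (t * mu i) * inner O b (e i).
Proof.
move=> Va Vb; have LF F v : V v -> L2 O (op_calculus V A F v).
  by move=> Vv; apply/VL/(op_calculus_in fV Ve opE).
have iF F v : V v -> inner O (op_calculus V A F v) (e i) = F (mu i) * inner O v (e i).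
  by move=> Vv; exact: (inner_op_calculus mO fV Ve oe opE).
split; rewrite /expA /=.
  by rewrite innerBl // ?iF //; [exact: LF|exact: LF|exact/VL/Ve].
by rewrite innerDl // ?iF //; [exact: LF|exact: LF|exact/VL/Ve].
Qed.

Variables (dd : measure_display) (Om : measurableType dd) (P : probability Om R).
Variables (Ft : R -> set (set Om)).
Hypothesis Ft_usual : usual_filtration P Ft.

Lemma inner_trig_step (f : R -> R) Q W n k omega i : 0 <= k ->
  Wiener P O Ft Q W ->
  inner O (step_integral W (trig_step O V A f n k) omega) (e i) =
  \sum_(j < n) f ((n%:R * k - j%:R * k) * mu i) *
    inner O (W (j.+1%:R * k) omega - W (j%:R * k) omega) (e i).
Proof.
move=> k0 hW; have Lincr (j : nat) : L2 O (W (j.+1%:R * k) omega - W (j%:R * k) omega).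
  by apply: L2B => //; apply: (Wiener_L2 hW); exact: mulr_ge0.
rewrite /step_integral /= inner_suml //; last 2 first.
- by move=> j _; apply/VL/(trig_op_in mO ev_lin fV Ve opE).
- exact/VL/Ve.
by apply: eq_bigr => j _; rewrite (inner_trig_op mO ev_lin fV Ve oe opE).
Qed.

Section two_noises.
Variables (Q1 Q2 : fn -> fn) (W1 W2 : R -> Om -> fn).
Hypotheses (hW1 : Wiener P O Ft Q1 W1) (hW2 : Wiener P O Ft Q2 W2).
Variables (k : R) (k0 : 0 < k) (U0 : Om -> fn * fn).
Hypothesis VU0 : forall omega, V (U0 omega).1 /\ V (U0 omega).2.

Notation U := (trigonometric_scheme O V W1 W2 k U0).
Notation SI W f n omega := (step_integral W (trig_step O V A f n k) omega).

Lemma scheme_in n omega : V (U n omega).1 /\ V (U n omega).2.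
Proof.
elim: n => [|n [IH1 IH2]] /=; first exact: VU0.
have LW Q W : Wiener P O Ft Q W -> L2 O (W (n.+1%:R * k) omega - W (n%:R * k) omega).
  by move=> hW; apply: L2B => //; apply: (Wiener_L2 hW); rewrite mulr_ge0 // ltW.
have [V1 V2] := expA_in k (VP (LW _ _ hW1)) (VP (LW _ _ hW2)).
have [V3 V4] := expA_in k IH1 IH2; rewrite -surjective_pairing in V3 V4.
by split; exact: VD.
Qed.

Let noise (W : R -> Om -> fn) omega i (j : nat) :=
  inner O (W (j.+1%:R * k) omega - W (j%:R * k) omega) (e i).

(** In the [i]-th coefficient $e^{k\mathbb A_h}$ is the rotation by the angle $k\mu_i$, so the
    induction consists of the addition formulas: one more rotation turns every $t_n-t_j$ into
    $t_{n+1}-t_j$, and the newest increment enters with the angle $k\mu_i$. *)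
Let inner_scheme_sum n omega i :
  inner O (U n omega).1 (e i) =
    cos (n%:R * k * mu i) * inner O (U0 omega).1 (e i) -
    sin (n%:R * k * mu i) * inner O (U0 omega).2 (e i) +
    (\sum_(j < n) cos ((n%:R * k - j%:R * k) * mu i) * noise W1 omega i j -
     \sum_(j < n) sin ((n%:R * k - j%:R * k) * mu i) * noise W2 omega i j) /\
  inner O (U n omega).2 (e i) =
    sin (n%:R * k * mu i) * inner O (U0 omega).1 (e i) +
    cos (n%:R * k * mu i) * inner O (U0 omega).2 (e i) +
    (\sum_(j < n) sin ((n%:R * k - j%:R * k) * mu i) * noise W1 omega i j +
     \sum_(j < n) cos ((n%:R * k - j%:R * k) * mu i) * noise W2 omega i j).
Proof.
elim: n => [|n [IH1 IH2]].
  by rewrite !big_ord0 !mul0r cos0 sin0; split; ring.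
have LW Q W : Wiener P O Ft Q W -> L2 O (W (n.+1%:R * k) omega - W (n%:R * k) omega).
  by move=> hW; apply: L2B => //; apply: (Wiener_L2 hW); rewrite mulr_ge0 // ltW.
have [V1 V2] := expA_in k (VP (LW _ _ hW1)) (VP (LW _ _ hW2)).
have [VU1 VU2] := scheme_in n omega.
have [V3 V4] := expA_in k VU1 VU2.
have [E1 E2] := inner_expA k i VU1 VU2.
have [E3 E4] := inner_expA k i (VP (LW _ _ hW1)) (VP (LW _ _ hW2)).
have UE : U n.+1 omega = expA V A k ((U n omega).1, (U n omega).2) +
    expA V A k (L2proj O V (W1 (n.+1%:R * k) omega - W1 (n%:R * k) omega),
                L2proj O V (W2 (n.+1%:R * k) omega - W2 (n%:R * k) omega)).
  by rewrite -surjective_pairing.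
have cE z : cos ((n.+1%:R * k - z) * mu i) =
    cos (k * mu i) * cos ((n%:R * k - z) * mu i) - sin (k * mu i) * sin ((n%:R * k - z) * mu i).
  by rewrite -cosD; congr cos; rewrite -natr1; ring.
have sE z : sin ((n.+1%:R * k - z) * mu i) =
    sin (k * mu i) * cos ((n%:R * k - z) * mu i) + cos (k * mu i) * sin ((n%:R * k - z) * mu i).
  by rewrite -sinD; congr sin; rewrite -natr1; ring.
have c0 : cos (n.+1%:R * k * mu i) =
    cos (k * mu i) * cos (n%:R * k * mu i) - sin (k * mu i) * sin (n%:R * k * mu i).
  by have := cE 0; rewrite !subr0.
have s0 : sin (n.+1%:R * k * mu i) =
    sin (k * mu i) * cos (n%:R * k * mu i) + cos (k * mu i) * sin (n%:R * k * mu i).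
  by have := sE 0; rewrite !subr0.
have cn : cos ((n.+1%:R * k - n%:R * k) * mu i) = cos (k * mu i).
  by rewrite cE subrr mul0r cos0 sin0; ring.
have sn : sin ((n.+1%:R * k - n%:R * k) * mu i) = sin (k * mu i).
  by rewrite sE subrr mul0r cos0 sin0; ring.
have cS (p : nat -> R) : \sum_(j < n) cos ((n.+1%:R * k - j%:R * k) * mu i) * p j =
    cos (k * mu i) * (\sum_(j < n) cos ((n%:R * k - j%:R * k) * mu i) * p j) -
    sin (k * mu i) * (\sum_(j < n) sin ((n%:R * k - j%:R * k) * mu i) * p j).
  by rewrite !mulr_sumr -sumrB; apply: eq_bigr => j _; rewrite cE; ring.
have sS (p : nat -> R) : \sum_(j < n) sin ((n.+1%:R * k - j%:R * k) * mu i) * p j =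
    sin (k * mu i) * (\sum_(j < n) cos ((n%:R * k - j%:R * k) * mu i) * p j) +
    cos (k * mu i) * (\sum_(j < n) sin ((n%:R * k - j%:R * k) * mu i) * p j).
  by rewrite !mulr_sumr -big_split /=; apply: eq_bigr => j _; rewrite sE; ring.
have [_ hp1] := L2projP mO ev_lin fV (LW _ _ hW1).
have [_ hp2] := L2projP mO ev_lin fV (LW _ _ hW2).
rewrite (hp1 _ (Ve i)) (hp2 _ (Ve i)) in E3 E4.
move: E1 E2 E3 E4 V1 V2 V3 V4 UE; move: (expA _ _ _ _) (expA _ _ _ _) => Z1 Z2.
move=> E1 E2 E3 E4 V1 V2 V3 V4 ->.
have [-> ->] : (Z2 + Z1).1 = Z2.1 + Z1.1 /\ (Z2 + Z1).2 = Z2.2 + Z1.2 by [].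
rewrite !(innerDl mO) ?E1 ?E2 ?E3 ?E4 ?IH1 ?IH2; try exact/VL; try exact/VL/Ve.
rewrite !big_ord_recr /= !cS !sS c0 s0 cn sn /noise.
by split; ring.
Qed.

Lemma inner_scheme n omega i :
  inner O (U n omega).1 (e i) =
    cos (n%:R * k * mu i) * inner O (U0 omega).1 (e i) -
    sin (n%:R * k * mu i) * inner O (U0 omega).2 (e i) +
    (inner O (SI W1 cos n omega) (e i) - inner O (SI W2 sin n omega) (e i)) /\
  inner O (U n omega).2 (e i) =
    sin (n%:R * k * mu i) * inner O (U0 omega).1 (e i) +
    cos (n%:R * k * mu i) * inner O (U0 omega).2 (e i) +
    (inner O (SI W1 sin n omega) (e i) + inner O (SI W2 cos n omega) (e i)).
Proof.
have k0' := ltW k0; have [E1 E2] := inner_scheme_sum n omega i.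
split; [apply: etrans E1 _; congr (_ + (_ - _))|apply: etrans E2 _; congr (_ + (_ + _))].
- exact/esym/(inner_trig_step cos n omega i k0' hW1).
- exact/esym/(inner_trig_step sin n omega i k0' hW2).
- exact/esym/(inner_trig_step sin n omega i k0' hW1).
- exact/esym/(inner_trig_step cos n omega i k0' hW2).
Qed.

End two_noises.

Variables (g C : R).
Hypothesis g01 : 0 <= g <= 1.
Hypothesis smoothing : forall w, L2 O w ->
  ((\sum_i (mu i `^ g) ^+ 2 * inner O w (e i) ^+ 2)%:E <=
     (C ^+ 2)%:E * dotnorm_sq O lam phi (2 * g) w)%E.

Let cos1 (x : R) : `|cos x| <= 1. Proof. by rewrite ler_norml cos_geN1 cos_le1. Qed.
Let sin1 (x : R) : `|sin x| <= 1. Proof. by rewrite ler_norml sin_geN1 sin_le1. Qed.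
Let hs (S : fn -> fn) := (\sum_(0 <= j <oo) dotnorm_sq O lam phi (2 * g) (S (phi j)))%E.

(** The error bound with $n=0$ and a positive step, here $k=1$: the step integral is empty, and the
    bound contains the length $nk=0$ as a factor, which gives 0 even against an infinite series. So
    [I] has zero second moment. *)
Lemma stochastic_integral0 (f : R -> R) Q S W (I : Om -> fn) : continuous f ->
  (forall x, `|f x| <= 1) ->
  (forall a b nu, 0 <= nu ->
    (f (a * nu) - f (b * nu)) ^+ 2 <= 4 * `|a - b| `^ (2 * g) * (nu `^ g) ^+ 2) ->
  covariance_operator O phi Q -> is_sqrt_operator O Q S -> Wiener P O Ft Q W ->
  stochastic_integral P O phi V S W 0 (fun tau => trig_op O V A f (0 - tau)) I ->
  {ae P, forall omega, I omega = 0}.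
Proof.
move=> cf f1 fH hQ hS hW hI; have [VI [_ mI] _] := hI.
have hI' : stochastic_integral P O phi V S W (0%:R * 1)
    (fun tau => trig_op O V A f (0%:R * 1 - tau)) I by rewrite mul0r.
have := trig_step_dist mO A_eigen ev_lin fV Ve mu0 oe spane opE g01 smoothing cf f1 fH
  Ft_usual hQ hS hW ltr01 hI'.
rewrite mul0r mulr0 mul0r mul0e => int0.
have V0 : V 0 by case: fV.
have VS omega : V (step_integral W (trig_step O V A f 0 1) omega).
  by rewrite /step_integral big_ord0.
have m0 : measurable_fun setT (fun omega =>
    (norm O (step_integral W (trig_step O V A f 0 1) omega - I omega) ^+ 2)%:E).
  apply: (measurable_norm_sqr_dist mO fV Ve oe spane) => //.
  - move=> m; rewrite (_ : (fun omega => _) = cst 0) //; apply/funext => omega.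
    by rewrite /step_integral big_ord0 inner0l.
  - by move=> m _ B mB; rewrite setTI; apply: mI => //; exact/VL.
have /(ae_eq_integral_abs P measurableT m0)[Z [mZ PZ hZ]] :
   (\int[P]_omega `|(norm O (step_integral W (trig_step O V A f 0 1) omega - I omega) ^+ 2)%:E|
   = 0)%E.
  under eq_integral do rewrite gee0_abs ?lee_fin ?sqr_ge0 //.
  apply/eqP; rewrite eq_le int0 /=; apply: integral_ge0 => omega _.
  by rewrite lee_fin sqr_ge0.
exists Z; split => //; apply: subset_trans hZ => omega /= hI0 h.
apply: hI0; have := h Logic.I; rewrite /step_integral big_ord0 sub0r => -[] /eqP.
rewrite sqrf_eq0 normN //; last exact/VL.
by move=> /eqP; have [_ _ _ Vdef _] := fV; exact: Vdef.
Qed.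

Section error.
Variables (Q1 Q2 S1 S2 : fn -> fn) (W1 W2 : R -> Om -> fn).
Hypotheses (hQ1 : covariance_operator O phi Q1) (hQ2 : covariance_operator O phi Q2).
Hypotheses (hS1 : is_sqrt_operator O Q1 S1) (hS2 : is_sqrt_operator O Q2 S2).
Hypotheses (hW1 : Wiener P O Ft Q1 W1) (hW2 : Wiener P O Ft Q2 W2).
Variables (X0 : Om -> fn * fn) (X : R -> Om -> fn * fn).
Hypothesis VX0 : forall omega, V (X0 omega).1 /\ V (X0 omega).2.
Hypothesis X_mild : mild_solution P O phi V Ft S1 S2 W1 W2 X0 X.
Variables (k : R) (k0 : 0 < k).

Notation U := (trigonometric_scheme O V W1 W2 k (X 0)).
Notation SI W f n omega := (step_integral W (trig_step O V A f n k) omega).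

Let hcos (a b nu : R) : 0 <= nu ->
  (cos (a * nu) - cos (b * nu)) ^+ 2 <= 4 * `|a - b| `^ (2 * g) * (nu `^ g) ^+ 2.
Proof. exact: hoelder_cos. Qed.

Let hsin (a b nu : R) : 0 <= nu ->
  (sin (a * nu) - sin (b * nu)) ^+ 2 <= 4 * `|a - b| `^ (2 * g) * (nu `^ g) ^+ 2.
Proof. exact: hoelder_sin. Qed.

(* The stochastic integrals over [0, 0] vanish only almost surely. *)
Lemma mild_solution0 : {ae P, forall omega, X 0 omega = X0 omega}.
Proof.
have [_ _ _ [IC1 [IS2 [IS1 [IC2 [hC1 hS2' hS1' hC2 XE]]]]]] := X_mild (lexx 0).
have zC1 := stochastic_integral0 (@continuous_cos R) cos1 hcos hQ1 hS1 hW1 hC1.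
have zS2 := stochastic_integral0 (@continuous_sin R) sin1 hsin hQ2 hS2 hW2 hS2'.
have zS1 := stochastic_integral0 (@continuous_sin R) sin1 hsin hQ1 hS1 hW1 hS1'.
have zC2 := stochastic_integral0 (@continuous_cos R) cos1 hcos hQ2 hS2 hW2 hC2.
apply: filterS3 XE (filterI zC1 zS2) (filterI zS1 zC2).
move=> omega -> [-> ->] [-> ->].
have [V1 V2] := VX0 omega.
rewrite subrr addr0; case: (X0 omega) V1 V2 => a b /= Va Vb.
have [Ea Eb] := expA_in 0 Va Vb.
rewrite [LHS]surjective_pairing /= addr0 addr0; congr (_, _);
  apply: (op_calculus_ext spane) => // i; have [E1 E2] := inner_expA 0 i Va Vb.
- by apply: etrans E1 _; rewrite mul0r cos0 sin0; ring.
- by apply: etrans E2 _; rewrite mul0r cos0 sin0; ring.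
Qed.

Let vstep f n : (forall x : R, `|f x| <= 1) -> step_valid O V (n%:R * k) (trig_step O V A f n k).
Proof. by move=> f1; exact: (trig_step_valid mO ev_lin fV Ve oe spane opE f1 n k0). Qed.

Let VSI Q W f n omega : Wiener P O Ft Q W -> (forall x : R, `|f x| <= 1) ->
  V (SI W f n omega).
Proof. by move=> hW f1; exact: (step_integral_in mO hW fV omega (vstep n f1)). Qed.

Let mSI Q W f n m : Wiener P O Ft Q W -> (forall x : R, `|f x| <= 1) ->
  measurable_fun setT (fun omega => inner O (SI W f n omega) (e m)).
Proof.
move=> hW f1.
exact: (measurable_inner_step_integral mO A_eigen Ft_usual hW fV Ve oe m (vstep n f1)).
Qed.

Let mL2 (G : set (set Om)) (Y : Om -> fn) m : G `<=` measurable -> L2measurable O G Y ->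
  measurable_fun setT (fun omega => inner O (Y omega) (e m)).
Proof.
by move=> Gm [_ hY] _ B mB; rewrite setTI; apply: Gm; apply: hY => //; exact/VL.
Qed.

Let Ft_measurable t : 0 <= t -> Ft t `<=` measurable.
Proof. by move=> t0; have [Fsig _ _ _] := Ft_usual; have [] := Fsig _ t0. Qed.

Let VX t omega : 0 <= t -> V (X t omega).1 /\ V (X t omega).2.
Proof. by move=> t0; have [] := X_mild t0. Qed.

Let mX t m : 0 <= t ->
  measurable_fun setT (fun omega => inner O (X t omega).1 (e m)) /\
  measurable_fun setT (fun omega => inner O (X t omega).2 (e m)).
Proof.
move=> t0; have [_ m1 m2 _] := X_mild t0.
by split; [exact: (mL2 m (Ft_measurable t0) m1)|exact: (mL2 m (Ft_measurable t0) m2)].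
Qed.

Let VU n omega : V (U n omega).1 /\ V (U n omega).2.
Proof. by apply: (scheme_in hW1 hW2 k0) => om; exact: VX. Qed.

(** Read off from the closed form [inner_scheme]; both components have the shape
    [a * f1 + b * f2 + (f3 + c * f4)], with the signs carried by the constants. *)
Let mU n m :
  measurable_fun setT (fun omega => inner O (U n omega).1 (e m)) /\
  measurable_fun setT (fun omega => inner O (U n omega).2 (e m)).
Proof.
have VX' omega : V (X 0 omega).1 /\ V (X 0 omega).2 by exact: VX.
have [mX1 mX2] := mX m (lexx 0).
have mc1 := mSI n m hW1 cos1; have mc2 := mSI n m hW2 cos1.
have ms1 := mSI n m hW1 sin1; have ms2 := mSI n m hW2 sin1.
have mlin (a b c : R) (f1 f2 f3 f4 : Om -> R) : measurable_fun setT f1 ->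
    measurable_fun setT f2 -> measurable_fun setT f3 -> measurable_fun setT f4 ->
    measurable_fun setT (fun omega => a * f1 omega + b * f2 omega + (f3 omega + c * f4 omega)).
  move=> h1 h2 h3 h4; apply: measurable_funD; apply: measurable_funD => //.
  - exact: measurable_funM.
  - exact: measurable_funM.
  - exact: measurable_funM.
have meq1 (a b x1 x2 x3 x4 y : R) : y = a * x1 - b * x2 + (x3 - x4) ->
    a * x1 + - b * x2 + (x3 + -1 * x4) = y by move=> ->; ring.
have meq2 (a b x1 x2 x3 x4 y : R) : y = a * x1 + b * x2 + (x3 + x4) ->
    a * x1 + b * x2 + (x3 + 1 * x4) = y by move=> ->; ring.
split.
  apply: eq_measurable_fun (mlin (cos (n%:R * k * mu m)) (- sin (n%:R * k * mu m)) (-1)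
    _ _ _ _ mX1 mX2 mc1 ms2) => omega _.
  have [E1 _] := inner_scheme hW1 hW2 k0 VX' n omega m.
  exact: meq1 E1.
apply: eq_measurable_fun (mlin (sin (n%:R * k * mu m)) (cos (n%:R * k * mu m)) 1
    _ _ _ _ mX1 mX2 ms1 mc2) => omega _.
have [_ E2] := inner_scheme hW1 hW2 k0 VX' n omega m.
exact: meq2 E2.
Qed.

Let hs0 S : (0 <= hs S)%E.
Proof.
apply: nneseries_ge0 => j _ _; apply: nneseries_ge0 => i _ _.
by rewrite lee_fin mulr_ge0 ?powR_ge0 ?sqr_ge0.
Qed.

(* [sg] is the sign with which the second noise enters the component. *)
Let component_error n (f1 f2 : R -> R) (sg : R) (Z Y I1 I2 : Om -> fn) :
  continuous f1 -> (forall x, `|f1 x| <= 1) ->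
  (forall a b nu, 0 <= nu ->
    (f1 (a * nu) - f1 (b * nu)) ^+ 2 <= 4 * `|a - b| `^ (2 * g) * (nu `^ g) ^+ 2) ->
  continuous f2 -> (forall x, `|f2 x| <= 1) ->
  (forall a b nu, 0 <= nu ->
    (f2 (a * nu) - f2 (b * nu)) ^+ 2 <= 4 * `|a - b| `^ (2 * g) * (nu `^ g) ^+ 2) ->
  `|sg| = 1 ->
  (forall omega, V (Z omega)) -> (forall omega, V (Y omega)) ->
  (forall m, measurable_fun setT (fun omega => inner O (Z omega) (e m))) ->
  (forall m, measurable_fun setT (fun omega => inner O (Y omega) (e m))) ->
  stochastic_integral P O phi V S1 W1 (n%:R * k)
    (fun tau => trig_op O V A f1 (n%:R * k - tau)) I1 ->
  stochastic_integral P O phi V S2 W2 (n%:R * k)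
    (fun tau => trig_op O V A f2 (n%:R * k - tau)) I2 ->
  {ae P, forall omega, Z omega - Y omega =
    (SI W1 f1 n omega - I1 omega) + sg *: (SI W2 f2 n omega - I2 omega)} ->
  (\int[P]_omega (norm O (Z omega - Y omega) ^+ 2)%:E <=
    (64 * c2 * (n%:R * k) * k `^ (2 * g) * C ^+ 2)%:E * (hs S1 + hs S2))%E.
Proof.
move=> cf1 f11 fH1 cf2 f21 fH2 sg1 VZ VY mZ mY hI1 hI2 ZY.
have [VI1 [_ mI1] _] := hI1; have [VI2 [_ mI2] _] := hI2.
have mIe (I : Om -> fn) m : (forall v B, L2 O v -> measurable B ->
    measurable ((fun omega => inner O (I omega) v) @^-1` B)) ->
    measurable_fun setT (fun omega => inner O (I omega) (e m)).
  by move=> mI _ B mB; rewrite setTI; apply: mI => //; exact/VL.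
have sq0 (v : fn) : (0 <= (norm O v ^+ 2)%:E)%E by rewrite lee_fin sqr_ge0.
have m1 : measurable_fun setT (fun omega => (norm O (SI W1 f1 n omega - I1 omega) ^+ 2)%:E).
  apply: (measurable_norm_sqr_dist mO fV Ve oe spane) => [omega _|//|m|m].
  - exact: VSI hW1 f11.
  - exact: mSI hW1 f11.
  - exact: mIe.
have m2 : measurable_fun setT (fun omega => (norm O (SI W2 f2 n omega - I2 omega) ^+ 2)%:E).
  apply: (measurable_norm_sqr_dist mO fV Ve oe spane) => [omega _|//|m|m].
  - exact: VSI hW2 f21.
  - exact: mSI hW2 f21.
  - exact: mIe.
have mZY : measurable_fun setT (fun omega => (norm O (Z omega - Y omega) ^+ 2)%:E).
  by apply: (measurable_norm_sqr_dist mO fV Ve oe spane).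
apply: (le_trans (@le_integral_twice _ _ _ P setT _ _ _ measurableT mZY m1 m2
  (fun omega _ => sq0 _) (fun omega _ => sq0 _) (fun omega _ => sq0 _) _)).
  apply: filterS ZY => omega -> _.
  have Va := VB (VSI n omega hW1 f11) (VI1 omega).
  have Vb := VB (VSI n omega hW2 f21) (VI2 omega).
  rewrite -!EFinM -EFinD lee_fin.
  apply: (le_trans (norm_sqrD_le mO (VL Va) (L2Z mO sg (VL Vb)))).
  by rewrite normZ ?sg1 ?mul1r //; exact: VL.
have b1 := trig_step_dist mO A_eigen ev_lin fV Ve mu0 oe spane opE g01 smoothing cf1 f11 fH1
  Ft_usual hQ1 hS1 hW1 k0 hI1.
have b2 := trig_step_dist mO A_eigen ev_lin fV Ve mu0 oe spane opE g01 smoothing cf2 f21 fH2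
  Ft_usual hQ2 hS2 hW2 k0 hI2.
have p20 : (0 <= 2%:E :> \bar R)%E by rewrite lee_fin.
(* The constant is $64c=2\cdot8c\cdot4$: the split into two noises, the limit passage, the Hoelder
   bound. *)
apply: (le_trans (leeD (lee_wpmul2l p20 b1) (lee_wpmul2l p20 b2))).
have reassoc (a b : R) (x y : \bar R) : 0 <= b -> (0 <= x)%E -> (0 <= y)%E -> 2 * a = b ->
    (2%:E * (a%:E * x) + 2%:E * (a%:E * y) <= b%:E * (x + y))%E.
  by move=> b0 x0 y0 <-; rewrite ge0_muleDr // !muleA -!EFinM.
apply: reassoc; [|exact: hs0|exact: hs0|ring].
apply: mulr_ge0 (sqr_ge0 _); apply: mulr_ge0 (powR_ge0 _ _); apply: mulr_ge0.
  exact: mulr_ge0 (ler0n _ _) (gaussian_second_moment_ge0 R).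
exact: mulr_ge0 (ler0n _ _) (ltW k0).
Qed.

(** Scheme and mild solution both contain $e^{t_n\mathbb A_h}$ applied to their starting values,
    which agree almost surely by [mild_solution0]. What remains are step integrals minus stochastic
    integrals, with the sign $-1$ on the sine term of the first component. *)
Lemma mean_square_error n :
  (\int[P]_omega (norm O ((U n omega).1 - (X (n%:R * k) omega).1) ^+ 2)%:E <=
    (64 * c2 * (n%:R * k) * k `^ (2 * g) * C ^+ 2)%:E * (hs S1 + hs S2))%E /\
  (\int[P]_omega (norm O ((U n omega).2 - (X (n%:R * k) omega).2) ^+ 2)%:E <=
    (64 * c2 * (n%:R * k) * k `^ (2 * g) * C ^+ 2)%:E * (hs S1 + hs S2))%E.
Proof.
have nk0 : 0 <= n%:R * k by rewrite mulr_ge0 // ltW.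
have VX' omega : V (X 0 omega).1 /\ V (X 0 omega).2 by exact: VX.
have [_ _ _ [IC1 [IS2 [IS1 [IC2 [hC1 hS2' hS1' hC2 XE]]]]]] := X_mild nk0.
have [VC1 _ _] := hC1; have [VS2 _ _] := hS2'; have [VS1 _ _] := hS1'; have [VC2 _ _] := hC2.
split.
  apply: (component_error (@continuous_cos R) cos1 hcos (@continuous_sin R) sin1 hsin
    (normrN1 R) _ _ _ _ hC1 hS2').
  - by move=> omega; have [] := VU n omega.
  - by move=> omega; have [] := VX omega nk0.
  - by move=> m; have [] := mU n m.
  - by move=> m; have [] := mX m nk0.
  apply: filterS2 XE mild_solution0 => omega -> XX0.
  have [Va Vb] := VX' omega.
  have [E1 _] := expA_in (n%:R * k) Va Vb; rewrite -XX0 [X 0 omega]surjective_pairing.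
  have V1 := VSI n omega hW1 cos1; have V2 := VSI n omega hW2 sin1.
  have [VU1 _] := VU n omega; have IE i := inner_expA (n%:R * k) i Va Vb.
  move: E1 IE; move: (expA V A (n%:R * k) _) => Z VZ IE.
  have -> : (U n omega).1 = Z.1 + (SI W1 cos n omega - SI W2 sin n omega).
    apply: (op_calculus_ext spane) => // [|i]; first by apply: VD => //; exact: VB.
    have [E1 _] := inner_scheme hW1 hW2 k0 VX' n omega i.
    apply: etrans E1 _; have [<- _] := IE i; symmetry.
    apply: etrans (innerDl mO (VL VZ) (VL (VB V1 V2)) (VL (Ve i))) _.
    by congr (_ + _); exact: (innerBl mO (VL V1) (VL V2) (VL (Ve i))).
  rewrite scaleN1r.
  rewrite -[(Z + _).1]/(Z.1 + (IC1 omega - IS2 omega)).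
  by apply/funext => x; rewrite !fctE /=; ring.
apply: (component_error (@continuous_sin R) sin1 hsin (@continuous_cos R) cos1 hcos
    (normr1 R) _ _ _ _ hS1' hC2).
- by move=> omega; have [] := VU n omega.
- by move=> omega; have [] := VX omega nk0.
- by move=> m; have [] := mU n m.
- by move=> m; have [] := mX m nk0.
apply: filterS2 XE mild_solution0 => omega -> XX0.
have [Va Vb] := VX' omega.
have [_ E2] := expA_in (n%:R * k) Va Vb; rewrite -XX0 [X 0 omega]surjective_pairing.
have V1 := VSI n omega hW1 sin1; have V2 := VSI n omega hW2 cos1.
have [_ VU2] := VU n omega; have IE i := inner_expA (n%:R * k) i Va Vb.
move: E2 IE; move: (expA V A (n%:R * k) _) => Z VZ IE.
have -> : (U n omega).2 = Z.2 + (SI W1 sin n omega + SI W2 cos n omega).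
  apply: (op_calculus_ext spane) => // [|i]; first by apply: VD => //; exact: VD.
  have [_ E2] := inner_scheme hW1 hW2 k0 VX' n omega i.
  apply: etrans E2 _; have [_ <-] := IE i; symmetry.
  apply: etrans (innerDl mO (VL VZ) (VL (VD V1 V2)) (VL (Ve i))) _.
  by congr (_ + _); exact: (innerDl mO (VL V1) (VL V2) (VL (Ve i))).
rewrite scale1r.
rewrite -[(Z + _).2]/(Z.2 + (IS1 omega + IC2 omega)).
by apply/funext => x; rewrite !fctE /=; ring.
Qed.

End error.

End scheme.

(** * From squared errors to norms *)

Section square_root.
Variable R : realType.
Local Open Scope ereal_scope.

Lemma poweR12_subadd (x y : \bar R) : 0 <= x -> 0 <= y ->
  (x + y) `^ 2^-1 <= x `^ 2^-1 + y `^ 2^-1.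
Proof.
have i0 : (2^-1 != 0 :> R)%R by [].
case: x y => [x| |] [y| |] //; rewrite ?lee_fin => x0 y0; last 3 first.
- by rewrite addey // poweRyr // addey // poweR_EFin.
- by rewrite addye // poweRyr // addye // poweR_EFin.
- by rewrite addye // poweRyr // addye.
rewrite !powR12_sqrt ?addr_ge0 //.
rewrite -(@ler_pXn2r _ 2) ?nnegrE ?addr_ge0 ?sqrtr_ge0 // sqrrD !sqr_sqrtr ?addr_ge0 //.
by rewrite -addrA [(_ *+ 2 + _)%R]addrC addrA lerDl mulrn_wge0 // mulr_ge0 ?sqrtr_ge0.
Qed.

(** The mean-square bound carries the sum of the squared Hilbert-Schmidt norms, the theorem the sum
    of the norms; $\sqrt{x+y}\le\sqrt x+\sqrt y$ leads from one to the other, infinite values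
    included. *)
Lemma Lnorm2_le (dd : measure_display) (T : measurableType dd)
    (mu : {measure set T -> \bar R}) (f : T -> R) (M : R) (x y : \bar R) :
  (0 <= M)%R -> 0 <= x -> 0 <= y ->
  \int[mu]_t (f t ^+ 2)%:E <= (M ^+ 2)%:E * (x + y) ->
  Lnorm mu 2%:E (fun t => (f t)%:E) <= M%:E * (x `^ 2^-1 + y `^ 2^-1).
Proof.
move=> M0 x0 y0 intf; have i0 : (0 <= 2^-1 :> R)%R by [].
rewrite unlock.
rewrite (_ : (\int[mu]_t _)%E = \int[mu]_t (f t ^+ 2)%:E); last first.
  by apply: eq_integral => t _; rewrite poweR_EFin powR_mulrn // real_normK ?num_real.
have M20 : 0 <= (M ^+ 2)%:E by rewrite lee_fin sqr_ge0.
have int0 : 0 <= \int[mu]_t (f t ^+ 2)%:E.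
  by apply: integral_ge0 => t _; rewrite lee_fin sqr_ge0.
apply: (le_trans (gt0_ler_poweR i0 _ _ intf)).
- by rewrite in_itv /= int0 leey.
- by rewrite in_itv /= leey andbT mule_ge0 // adde_ge0.
rewrite poweRM ?adde_ge0 // poweR_EFin powR12_sqrt ?sqr_ge0 // sqrtr_sqr ger0_norm //.
by apply: lee_wpmul2l; rewrite ?lee_fin // poweR12_subadd.
Qed.

End square_root.

Theorem theorem1p2 (R : realType) (d : nat) (d_range : (1 <= d <= 3)%N)
    (O : set 'rV[R]_d) (O_domain : convex_polygonal_domain O)
    (lam : nat -> R) (phi : nat -> 'rV[R]_d -> R)
    (A_eigen : eigenpairs O lam phi)
    (H : set R) (Th : R -> mesh R d) (Th_regular : regular_family O H Th)
    (Th_bound : discrete_norm_bound O lam phi H Th)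
    (theta T : R) (theta_range : 0 <= theta <= 2) (T_gt0 : 0 < T) :
  exists C : R,
  forall (dd : measure_display) (Om : measurableType dd) (P : probability Om R)
    (Ft : R -> set (set Om)) (Q1 Q2 S1 S2 : ('rV[R]_d -> R) -> 'rV[R]_d -> R)
    (W1 W2 : R -> Om -> 'rV[R]_d -> R),
  usual_filtration P Ft ->
  covariance_operator O phi Q1 -> covariance_operator O phi Q2 ->
  is_sqrt_operator O Q1 S1 -> is_sqrt_operator O Q2 S2 ->
  Wiener P O Ft Q1 W1 -> Wiener P O Ft Q2 W2 ->
  (HSnorm O lam phi theta S1 + HSnorm O lam phi theta S2 < +oo)%E ->
  forall h : R, H h ->
  forall (X0 : Om -> ('rV[R]_d -> R) * ('rV[R]_d -> R))
    (X : R -> Om -> ('rV[R]_d -> R) * ('rV[R]_d -> R)),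
  let V := fespace O (Th h) in
  (forall omega, V (X0 omega).1 /\ V (X0 omega).2) ->
  L2measurable O (Ft 0) (fun omega => (X0 omega).1) ->
  L2measurable O (Ft 0) (fun omega => (X0 omega).2) ->
  mild_solution P O phi V Ft S1 S2 W1 W2 X0 X ->
  forall k : R, 0 < k -> forall n : nat, n%:R * k <= T ->
  let U := trigonometric_scheme O V W1 W2 k (X 0) in
  let bound := ((C * k `^ (theta / 2))%:E *
                (HSnorm O lam phi theta S1 + HSnorm O lam phi theta S2))%E in
  (Lnorm P 2%:E (fun omega =>
     (norm O ((U n omega).1 - (X (n%:R * k) omega).1))%:E) <= bound)%E /\
  (Lnorm P 2%:E (fun omega =>
     (norm O ((U n omega).2 - (X (n%:R * k) omega).2))%:E) <= bound)%E.
Proof.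
pose c := gaussian_second_moment R; have c0 : 0 <= c := gaussian_second_moment_ge0 R.
have mO := convex_polygonal_measurable O_domain.
have g01 : 0 <= theta / 2 <= 1 by case/andP: theta_range => ? ?; lra.
(* $\theta\in[0,2]$ puts $\gamma=\theta/2$ in $[0,1]$, inside the range of the standing bound; [B]
   is obtained before [h] is. *)
have [|B hB] := Th_bound (theta / 2).
  by case/andP: g01 => ? ?; apply/andP; split; lra.
have D0 : 0 <= 64 * c * T * B ^+ 2.
  by apply: mulr_ge0 (sqr_ge0 _); apply: mulr_ge0 (ltW T_gt0); apply: mulr_ge0.
(* The square root of the mean-square constant with $nk$ replaced by its bound [T] and the power of
   [k] left out; it is fixed before the noises, [h], [k] and [n]. *)
exists (Num.sqrt (64 * c * T * B ^+ 2)).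
move=> dd Om P Ft Q1 Q2 S1 S2 W1 W2 hFt hQ1 hQ2 hS1 hS2 hW1 hW2 _ h Hh X0 X V VX0 _ _ hX.
move=> k k0 n nkT U bound.
have [T_triang _] := Th_regular.1 h Hh.
have fV := fespace_finite O_domain T_triang.
have [N [e [mu [Ve mu0 oe spane opE]]]] := fespace_eigenbasis O_domain T_triang.
have sm w (Lw : L2 O w) := smoothing_le mO A_eigen (@vertex_value_lin R d (Th h)) fV
  Ve oe spane opE Lw (hB h Hh).
have [E1 E2] := mean_square_error mO A_eigen (@vertex_value_lin R d (Th h)) fV Ve mu0 oe
  spane opE hFt g01 sm hQ1 hQ2 hS1 hS2 hW1 hW2 VX0 hX k0 n.
have theta2 : 2 * (theta / 2) = theta by field.
rewrite theta2 in E1 E2.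
have hs0 S : (0 <= \sum_(0 <= j <oo) dotnorm_sq O lam phi theta (S (phi j)))%E.
  apply: nneseries_ge0 => j _ _; apply: nneseries_ge0 => i _ _.
  by rewrite lee_fin mulr_ge0 ?powR_ge0 ?sqr_ge0.
pose D := Num.sqrt (64 * c * T * B ^+ 2) * k `^ (theta / 2).
have D_ge0 : 0 <= D by rewrite mulr_ge0 ?sqrtr_ge0 ?powR_ge0.
have coef : 64 * c * (n%:R * k) * k `^ theta * B ^+ 2 <= D ^+ 2.
  have -> : k `^ theta = k `^ (theta / 2) ^+ 2.
    by rewrite -powR_mulrn ?powR_ge0 // -powRrM; congr (_ `^ _); field.
  rewrite exprMn sqr_sqrtr //; move: (k `^ _) => z.
  rewrite -subr_ge0.
  have -> : 64 * c * T * B ^+ 2 * z ^+ 2 - 64 * c * (n%:R * k) * z ^+ 2 * B ^+ 2 =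
    64 * c * (T - n%:R * k) * (B * z) ^+ 2 by ring.
  by apply: mulr_ge0 (sqr_ge0 _); apply: mulr_ge0; [exact: mulr_ge0|rewrite subr_ge0].
have enlarge (x : \bar R) : (0 <= x)%E ->
    ((64 * c * (n%:R * k) * k `^ theta * B ^+ 2)%:E * x <= (D ^+ 2)%:E * x)%E.
  by move=> x0; apply: lee_wpmul2r => //; rewrite lee_fin.
have s0 := adde_ge0 (hs0 S1) (hs0 S2).
split; apply: Lnorm2_le D_ge0 (hs0 S1) (hs0 S2) _.
- exact: le_trans E1 (enlarge _ s0).
- exact: le_trans E2 (enlarge _ s0).
Qed.
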